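(* Let $R_0\in SO(2)$. A vector field $u\in W^{1,2}_{loc}(\mathbb{R}^2,\mathbb{R}^2)$ satisfies $\mathrm{dist}(\nabla u,SO(2))\in L^2(\mathbb{R}^2)$ and $$\min_{R\in SO(2)}\|\nabla u-R\|_{L^2(\mathbb{R}^2)}=\|\nabla u-R_0\|_{L^2(\mathbb{R}^2)}=\sqrt2\,\|\mathrm{dist}(\nabla u,SO(2))\|_{L^2(\mathbb{R}^2)}\qquad( * )$$ if and only if there exist $\alpha,a,b\in L^2(\mathbb{R}^2)$ (real-valued) such that, for a.e. $x\in\mathbb{R}^2$, $$\nabla u(x)=R_0R(\alpha(x))+\begin{bmatrix}a(x)&b(x)\\ b(x)&-a(x)\end{bmatrix}.\qquad( ** )$$ Moreover, for every $\alpha\in L^2(\mathbb{R}^2)$ there exist $a,b\in L^2(\mathbb{R}^2)$ and $u\in W^{1,2}_{loc}(\mathbb{R}^2,\mathbb{R}^2)$ such that $( * )$ and $( ** )$ hold.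
   Context: $SO(2)$ is the group of proper rotations of $\mathbb{R}^2$, viewed in $\mathbb{R}^{2\times2}$, and $R(\alpha)=\begin{bmatrix}\cos\alpha&-\sin\alpha\\ \sin\alpha&\cos\alpha\end{bmatrix}$ for $\alpha\in\mathbb{R}$. Matrices carry the Frobenius norm $|A|^2=\mathrm{tr}(A^TA)$, and $L^2$ norms of matrix fields as well as the distance $\mathrm{dist}(F,SO(2))=\min_{R\in SO(2)}|F-R|$ (applied pointwise to $\nabla u(x)$) use this norm. $\nabla u=[\partial_ju^i]_{ij}$. $\|\nabla u-R\|_{L^2(\mathbb{R}^2)}$ may equal $+\infty$ for some $R$. *)

(* Defs.v *)
From HB Require Import structures.
From mathcomp Require Import all_boot all_order all_algebra.
From mathcomp Require Import all_classical all_reals all_analysis.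
From mathcomp Require Import ring lra.

Set Implicit Arguments.
Unset Strict Implicit.
Unset Printing Implicit Defensive.

Import Order.TTheory GRing.Theory Num.Theory.
Import numFieldNormedType.Exports.

Local Open Scope classical_set_scope.
Local Open Scope ring_scope.

(* Points of the plane are pairs, so that the Lebesgue measure on it is a
   product measure; values of vector fields are column vectors. *)
Definition plane (R : realType) : Type :=
  (measurableTypeR R * measurableTypeR R)%type.

Definition leb2 (R : realType) :=
  (@lebesgue_measure R \x @lebesgue_measure R)%E.

Section Matrices.
Context {R : realType}.
Implicit Types A F Q : 'M[R]_2.

Definition mx22 (p q r s : R) : 'M[R]_2 :=
  \matrix_(i < 2, j < 2)
    (if i == 0 then (if j == 0 then p else q)
     else (if j == 0 then r else s)).

Definition rot (t : R) : 'M[R]_2 := mx22 (cos t) (- sin t) (sin t) (cos t).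

Definition SO2 : set 'M[R]_2 := [set Q | Q^T *m Q = 1%:M /\ \det Q = 1].

Definition frob A : R := Num.sqrt (\tr (A^T *m A)).

(* The infimum is attained, see dist_SO2_min below. *)
Definition dist_SO2 F : R := inf [set frob (F - Q) | Q in SO2].

End Matrices.

Section DistAttained.
Context {R : realType}.
Implicit Types F P Q : 'M[R]_2.

Let o1 : lift ord0 ord0 = 1 :> 'I_2. Proof. exact/val_inj. Qed.

Lemma frobE F : frob F = Num.sqrt
  (F 0 0 ^+ 2 + F 0 1 ^+ 2 + F 1 0 ^+ 2 + F 1 1 ^+ 2).
Proof.
rewrite /frob /mxtrace !big_ord_recl !big_ord0 !mxE.
rewrite !big_ord_recl !big_ord0 !mxE o1.
by congr Num.sqrt; ring.
Qed.

Lemma det_mx2E Q : \det Q = Q 0 0 * Q 1 1 - Q 0 1 * Q 1 0.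
Proof.
rewrite (expand_det_row _ 0) !big_ord_recl big_ord0 /cofactor !det_mx11 !mxE.
rewrite !o1 (_ : lift 1 0 = 0 :> 'I_2); last exact/val_inj.
by rewrite /= expr0 expr1; ring.
Qed.

Lemma SO2P Q : SO2 Q <->
  [/\ Q 1 1 = Q 0 0, Q 0 1 = - Q 1 0 & Q 0 0 ^+ 2 + Q 1 0 ^+ 2 = 1].
Proof.
split => [[QQ dQ]|[h1 h2 h3]].
  move: dQ; rewrite det_mx2E => dQ.
  have /matrixP QE := QQ.
  have := QE 0 0; have := QE 1 1; have := QE 0 1.
  rewrite !mxE !big_ord_recl !big_ord0 !mxE o1 !addr0 /= => e01 e11 e00.
  have e : (Q 1 1 - Q 0 0) ^+ 2 + (Q 0 1 + Q 1 0) ^+ 2 = 0.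
    rewrite (_ : _ + _ = (Q 0 0 * Q 0 0 + Q 1 0 * Q 1 0)
      + (Q 0 1 * Q 0 1 + Q 1 1 * Q 1 1)
      - 2 * (Q 0 0 * Q 1 1 - Q 0 1 * Q 1 0)); last by ring.
    by rewrite e00 e11 dQ; ring.
  move: e => /eqP; rewrite paddr_eq0 ?sqr_ge0// !sqrf_eq0 subr_eq0 addr_eq0.
  by move=> /andP[/eqP -> /eqP ->]; rewrite !expr2.
split; last by rewrite det_mx2E h1 h2 -h3; ring.
apply/matrixP => i j; rewrite !mxE !big_ord_recl !big_ord0 !mxE o1 addr0.
have [] : i = 0 \/ i = 1.
  by case: i => [[|[|//]] ?]; [left|right]; exact/val_inj.
all: move=> ->.
all: have [] : j = 0 \/ j = 1
  by case: j => [[|[|//]] ?]; [left|right]; exact/val_inj.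
all: by move=> ->; rewrite /= ?h1 ?h2 -?h3; ring.
Qed.

Lemma dist_SO2_min F :
  exists2 Q, SO2 Q & dist_SO2 F = frob (F - Q) /\
    forall P, SO2 P -> frob (F - Q) <= frob (F - P).
Proof.
pose p := F 0 0 + F 1 1; pose q := F 1 0 - F 0 1.
pose r := Num.sqrt (p ^+ 2 + q ^+ 2).
have r0 : 0 <= r by exact: sqrtr_ge0.
have rE : r ^+ 2 = p ^+ 2 + q ^+ 2 by rewrite sqr_sqrtr ?addr_ge0 ?sqr_ge0.
pose N := F 0 0 ^+ 2 + F 0 1 ^+ 2 + F 1 0 ^+ 2 + F 1 1 ^+ 2.
have frobP P : SO2 P ->
    frob (F - P) = Num.sqrt (N + 2 - 2 * (P 0 0 * p + P 1 0 * q)).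
  move=> /SO2P[h1 h2 h3]; rewrite frobE !mxE h1 h2 /N /p /q.
  rewrite (_ : 2 = 2 * (P 0 0 ^+ 2 + P 1 0 ^+ 2)) ?h3 ?mulr1//.
  by congr Num.sqrt; rewrite -{1}[2]mulr1 -{1}h3; ring.
have [c [s [cs1 csr]]] : exists c s, c ^+ 2 + s ^+ 2 = 1 /\ c * p + s * q = r.
  have [r_eq0|r_neq0] := eqVneq r 0.
    exists 1, 0; split; first by ring.
    move: rE; rewrite r_eq0 expr0n /= => /esym/eqP.
    rewrite paddr_eq0 ?sqr_ge0// !sqrf_eq0 => /andP[/eqP -> /eqP ->].
    by ring.
  exists (p / r), (q / r); split.
    by rewrite !expr_div_n -mulrDl -rE divff// expf_neq0.
  rewrite (_ : _ + _ = (p ^+ 2 + q ^+ 2) / r); last by ring.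
  by rewrite -rE expr2 mulfK.
pose Q := mx22 c (- s) s c.
have SQ : SO2 Q by apply/SO2P; rewrite !mxE.
have Qmin P : SO2 P -> frob (F - Q) <= frob (F - P).
  move=> SP; rewrite !frobP//; apply: ler_wsqrtr.
  rewrite lerD2l lerN2 ler_pM2l// !mxE /= csr.
  move/SO2P : SP => [_ _ P1].
  rewrite (le_trans (ler_norm _))// -(@ler_pXn2r _ 2) ?nnegrE//.
  rewrite real_normK ?num_real// rE -[leRHS]mul1r -P1 -subr_ge0.
  rewrite (_ : _ - _ = (P 0 0 * q - P 1 0 * p) ^+ 2) ?sqr_ge0//.
  by ring.
exists Q => //; split => //; apply/eqP; rewrite eq_le; apply/andP; split.
  apply: ge_inf; last by exists Q.
  by exists 0 => _ [P _ <-]; exact: sqrtr_ge0.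
apply: lb_le_inf; first by exists (frob (F - Q)), Q.
by move=> _ [P SP <-]; exact: Qmin.
Qed.

End DistAttained.

Definition is_min (R : realType) (A : set (\bar R)) (m : \bar R) : Prop :=
  A m /\ lbound A m.

Section Sobolev.
Context {R : realType}.
Local Notation R2 := (R * R)%type.
Local Notation mu := (@leb2 R).

Definition L2 (f : R2 -> R) : Prop := f \in Lfun mu 2%:E.

Definition L2loc (f : R2 -> R) : Prop :=
  measurable_fun setT (f : plane R -> R) /\
  forall K : set R2, compact K ->
    (\int[mu]_(x in K) (`|f x| ^+ 2)%:E < +oo)%E.

(* Extended-real valued, and possibly +oo. *)
Definition L2norm_mx (F : R2 -> 'M[R]_2) : \bar R :=
  ('N[mu]_2%:E[(fun x => (frob (F x))%:E)])%E.

Definition e_ (j : 'I_2) : R2 := if j == 0 then (1, 0) else (0, 1).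

Definition partial (j : 'I_2) (f : R2 -> R) : R2 -> R :=
  fun x => 'D_(e_ j) f x.

Definition smooth (f : R2 -> R) : Prop :=
  forall s : seq 'I_2, let g := foldr partial f s in
    continuous g /\ forall j x, derivable g x (e_ j).

Definition test_function (f : R2 -> R) : Prop :=
  smooth f /\ compact (closure [set x | f x != 0]).

Definition weak_gradient (u : R2 -> 'cV[R]_2) (G : R2 -> 'M[R]_2) : Prop :=
  forall (i j : 'I_2) (phi : R2 -> R), test_function phi ->
    (\int[mu]_x (u x i 0 * partial j phi x)%:E =
     - \int[mu]_x (G x i j * phi x)%:E)%E.

(* u is in W^{1,2}_loc(R^2, R^2) and G is a representative of its gradient,
   which is only determined up to a null set. *)
Definition W12loc_grad (u : R2 -> 'cV[R]_2) (G : R2 -> 'M[R]_2) : Prop :=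
  [/\ forall i, L2loc (fun x => u x i 0),
      forall i j, L2loc (fun x => G x i j) &
      weak_gradient u G].

Definition min_equality (R0 : 'M[R]_2) (G : R2 -> 'M[R]_2) : Prop :=
  is_min [set L2norm_mx (fun x => (G x - Q)%R) | Q in SO2]
         (L2norm_mx (fun x => (G x - R0)%R)) /\
  (L2norm_mx (fun x => (G x - R0)%R) =
   (Num.sqrt 2)%:E * 'N[mu]_2%:E[(fun x => (dist_SO2 (G x))%:E)])%E.

Definition grad_form (R0 : 'M[R]_2) (alpha a b : R2 -> R)
    (G : R2 -> 'M[R]_2) : Prop :=
  {ae mu, forall x : R2,
    G x = R0 *m rot (alpha x) + mx22 (a x) (b x) (b x) (- a x)}.

End Sobolev.

(* Main.v *)
(* Write a 2x2 matrix as [[p + a, b - q], [b + q, p - a]]: the conformal part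
   (p, q) and the anticonformal part (a, b) have |F|^2 = 2 (p^2 + q^2 + a^2 +
   b^2) and dist(F, SO(2))^2 = 2 ((|(p, q)| - 1)^2 + a^2 + b^2).  If grad u - Q
   is square integrable, its conformal and anticonformal parts have the same L2
   norm (the Beurling transform is an isometry).  Hence ||grad u - Q||^2 is
   4 (||a||^2 + ||b||^2) for every rotation Q for which it is finite, and the
   equality with 2 ||dist||^2 says exactly that |(p, q)| = 1 almost everywhere,
   i.e. that the conformal part is R0 R(alpha).  Moreover alpha is square
   integrable because |R(alpha) - 1| and |alpha| are comparable on [-pi, pi].

   For gradients of test functions the isometry is the vanishing of the integral
   of the Jacobian.  Given p, q in L2, minimize the distance from (p, q) to the
   conformal parts of such gradients: a minimizing sequence is Cauchy, and its
   limit is (p, q), because the gradient of a truncation of log |x - c| shows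
   that an L2 field orthogonal to all these conformal parts has vanishing
   integrals against an approximate identity.  By the isometry the anticonformal
   parts converge too, which gives a and b; a weighted Poincare inequality makes
   the potentials converge after subtraction of constants, which gives u.  The
   isometry for an arbitrary grad u follows, since (a, b) is determined by
   (p, q): a difference of two choices is orthogonal to all test gradients. *)
From HB Require Import structures.
Require Import Defs.
From mathcomp Require Import all_boot all_order all_algebra.
From mathcomp Require Import all_classical all_reals all_analysis.
From mathcomp Require Import measurable_realfun.
From mathcomp Require Import ring lra.

Set Implicit Arguments.
Unset Strict Implicit.
Unset Printing Implicit Defensive.

Import Order.TTheory GRing.Theory Num.Theory.
Import numFieldNormedType.Exports.

Local Open Scope classical_set_scope.
Local Open Scope ring_scope.

(** * Square-integrable functions and their inner product *)

Section SquareIntegrable.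
Context d (T : measurableType d) (R : realType).
Variable mu : {measure set T -> \bar R}.
Implicit Types f g h : T -> R.

(** The gradient itself is never square integrable, only its difference with a rotation is;
    constants are therefore subtracted throughout, and the linear map [R0] is added back to the
    potential at the end. The isometry costs little, because the Jacobian is a null Lagrangian. The
    obstacle is the density of the conformal parts: a field orthogonal to all of them solves the
    Cauchy-Riemann system weakly, and a Liouville theorem for L2 solutions is needed. Neither the
    Fourier transform nor elliptic regularity enters. The test field is radial, also after
    truncation, hence curl free; pairing the system with it eliminates one unknown and leaves the
    other one against an explicit divergence. Its tails are only square integrable, which is exactly
    what pairing with an L2 function tolerates. Every Cauchy sequence carries the rate 1/(n+1),
    which minimization provides and which all later limits inherit. *)

Definition intg f := mu.-integrable setT (EFin \o f).

Definition sqi f :=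
  measurable_fun setT f /\ intg (fun x => f x ^+ 2).

(** An infinite integral is read as 0 here, so the algebra below asks for [sqi] at every step. *)
Definition ip f g := \int[mu]_x (f x * g x).

Lemma intg_meas f : intg f -> measurable_fun setT f.
Proof. by move=> /measurable_int/measurable_EFinP. Qed.

Lemma intgD f g : intg f -> intg g -> intg (fun x => f x + g x).
Proof. by move=> hf hg; exact: (integrableD measurableT hf hg). Qed.

Lemma intgZ k f : intg f -> intg (fun x => k * f x).
Proof. by move=> hf; exact: (integrableZl measurableT k hf). Qed.

Lemma intg_le f g : measurable_fun setT f -> (forall x, `|f x| <= g x) ->
  intg g -> intg f.
Proof.
move=> mf fg ig; apply: le_integrable ig => //.
  exact/measurable_EFinP.
by move=> x _; rewrite /= lee_fin (le_trans (fg x))// ler_norm.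
Qed.

Lemma RintD f g : intg f -> intg g ->
  \int[mu]_x (f x + g x) = \int[mu]_x f x + \int[mu]_x g x.
Proof. by move=> hf hg; rewrite -RintegralD. Qed.

Lemma RintB f g : intg f -> intg g ->
  \int[mu]_x (f x - g x) = \int[mu]_x f x - \int[mu]_x g x.
Proof. by move=> hf hg; rewrite -RintegralB. Qed.

Lemma RintZ k f : intg f -> \int[mu]_x (k * f x) = k * \int[mu]_x f x.
Proof. by move=> hf; rewrite -RintegralZl. Qed.

Lemma Rint_ge0 f : (forall x, 0 <= f x) -> 0 <= \int[mu]_x f x.
Proof. by move=> h; apply: Rintegral_ge0 => x _. Qed.

Lemma Rint_le f g : intg f -> intg g -> (forall x, f x <= g x) ->
  \int[mu]_x f x <= \int[mu]_x g x.
Proof. by move=> hf hg fg; apply: le_Rintegral => // x _. Qed.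

Lemma RintE f : intg f -> (\int[mu]_x (f x)%:E = (\int[mu]_x f x)%:E)%E.
Proof.
by move=> hf; rewrite /Rintegral fineK//; apply: integrable_fin_num.
Qed.

Lemma sqi_meas f : sqi f -> measurable_fun setT f. Proof. by case. Qed.

Lemma sqi_mul f g : sqi f -> sqi g -> intg (fun x => f x * g x).
Proof.
move=> [mf hf] [mg hg]; apply: (@intg_le _ (fun x => f x ^+ 2 + g x ^+ 2)).
- exact: measurable_funM.
- move=> x; rewrite normrM.
  have := sqr_ge0 (`|f x| - `|g x|); rewrite sqrrB !real_normK ?num_real//.
  have := normr_ge0 (f x); have := normr_ge0 (g x); nra.
- exact: intgD.
Qed.

Lemma sqiZ k f : sqi f -> sqi (fun x => k * f x).
Proof.
move=> [mf hf]; split; first exact: measurable_funM.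
rewrite /intg; under eq_fun do rewrite exprMn; exact: intgZ.
Qed.

Lemma sqi_le f g : measurable_fun setT f -> sqi g ->
  (forall x, `|f x| <= `|g x|) -> sqi f.
Proof.
move=> mf [mg hg] fg; split => //; apply: intg_le hg.
  exact: measurable_funX.
move=> x; rewrite normrX -[leRHS]real_normK ?num_real//.
by rewrite lerXn2r ?nnegrE.
Qed.

Lemma sqiD f g : sqi f -> sqi g -> sqi (fun x => f x + g x).
Proof.
move=> hf hg; split.
  by apply: measurable_funD; [exact: sqi_meas|exact: sqi_meas].
rewrite (_ : (fun x => (f x + g x) ^+ 2) =
  (fun x => (f x ^+ 2 + g x ^+ 2) + 2 * (f x * g x))); last first.
  by apply/funext => x; ring.
apply: intgD; first by apply: intgD; [case: hf|case: hg].
by apply: intgZ; exact: sqi_mul.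
Qed.

Lemma sqiN f : sqi f -> sqi (fun x => - f x).
Proof.
by move=> /(sqiZ (-1)); congr sqi; apply/funext => x; rewrite mulN1r.
Qed.

Lemma sqiB f g : sqi f -> sqi g -> sqi (fun x => f x - g x).
Proof. by move=> hf /sqiN hg; exact: sqiD. Qed.

Lemma ip_ge0 f : 0 <= ip f f.
Proof. by apply: Rint_ge0 => x; rewrite -expr2 sqr_ge0. Qed.

Lemma ipC f g : ip f g = ip g f.
Proof. by apply: eq_Rintegral => x _; rewrite mulrC. Qed.

Lemma ipDl f g h : sqi f -> sqi g -> sqi h ->
  ip (fun x => f x + g x) h = ip f h + ip g h.
Proof.
move=> hf hg hh; rewrite /ip -RintD; [|exact: sqi_mul|exact: sqi_mul].
by apply: eq_Rintegral => x _; rewrite mulrDl.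
Qed.

Lemma ipZl k f g : sqi f -> sqi g -> ip (fun x => k * f x) g = k * ip f g.
Proof.
move=> hf hg; rewrite /ip -RintZ; last exact: sqi_mul.
by apply: eq_Rintegral => x _; rewrite mulrA.
Qed.

Lemma ipBl f g h : sqi f -> sqi g -> sqi h ->
  ip (fun x => f x - g x) h = ip f h - ip g h.
Proof.
move=> hf hg hh; rewrite /ip -RintB; [|exact: sqi_mul|exact: sqi_mul].
by apply: eq_Rintegral => x _; rewrite mulrBl.
Qed.

Lemma ipBr f g h : sqi f -> sqi g -> sqi h ->
  ip h (fun x => f x - g x) = ip h f - ip h g.
Proof. by move=> hf hg hh; rewrite ipC ipBl// !(ipC h). Qed.

Lemma ipDr f g h : sqi f -> sqi g -> sqi h ->
  ip h (fun x => f x + g x) = ip h f + ip h g.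
Proof. by move=> hf hg hh; rewrite ipC ipDl// !(ipC h). Qed.

Lemma ipZr k f g : sqi f -> sqi g -> ip f (fun x => k * g x) = k * ip f g.
Proof. by move=> hf hg; rewrite ipC ipZl// (ipC g). Qed.

Lemma ip_sqrD t f g : sqi f -> sqi g ->
  ip (fun x => f x + t * g x) (fun x => f x + t * g x) =
  ip f f + 2 * t * ip f g + t ^+ 2 * ip g g.
Proof.
move=> hf hg; have htg := sqiZ t hg.
rewrite ipDl//; last exact: sqiD.
by rewrite !ipDr// !ipZl// !ipZr// (ipC g f); ring.
Qed.

(** The discriminant of a nonnegative quadratic; it serves Cauchy-Schwarz and, in
    [minimizing_sequence], the almost-orthogonality of residuals. *)
Lemma quad_CS (a b c : R) : (forall t, 0 <= a + 2 * t * b + t ^+ 2 * c) ->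
  0 <= a -> 0 <= c -> b ^+ 2 <= a * c.
Proof.
move=> h a0 c0; have [c_eq0|c_neq0] := eqVneq c 0.
  rewrite c_eq0 mulr0; have [->|b0] := eqVneq b 0; first by rewrite expr0n.
  (* For [c = 0] the expression is affine in [t], and this [t] gives it the value -1. *)
  have := h (- (a + 1) / (2 * b)); rewrite c_eq0.
  rewrite (_ : a + _ + _ = -1); first by rewrite ler0N1.
  by field.
have cp : 0 < c by rewrite lt0r c_neq0.
have := h (- b / c).
rewrite (_ : a + _ + _ = (a * c - b ^+ 2) / c); last by field.
by rewrite pmulr_lge0 ?invr_gt0// subr_ge0.
Qed.

Lemma ip_CS f g : sqi f -> sqi g -> ip f g ^+ 2 <= ip f f * ip g g.
Proof.
move=> hf hg; apply: quad_CS; [|exact: ip_ge0|exact: ip_ge0].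
by move=> t; rewrite -ip_sqrD//; exact: ip_ge0.
Qed.

Lemma ip_sqD_le f g : sqi f -> sqi g ->
  ip (fun x => f x + g x) (fun x => f x + g x) <= 2 * ip f f + 2 * ip g g.
Proof.
move=> hf hg.
have := ip_ge0 (fun x => f x + (-1) * g x); rewrite ip_sqrD//.
have := @ip_sqrD 1 f g hf hg.
rewrite (_ : (fun x => f x + 1 * g x) = (fun x => f x + g x)); last first.
  by apply/funext => x; rewrite mul1r.
by move=> ->; nra.
Qed.

Lemma ip_eq0 f : sqi f -> ip f f = 0 -> {ae mu, forall x, f x = 0}.
Proof.
move=> hf f0.
have h : (\int[mu]_x `|(f x ^+ 2)%:E| = 0)%E.
  rewrite (_ : (fun _ => _) = (fun x => (f x ^+ 2)%:E)); last first.
    by apply/funext => x; rewrite gee0_abs// lee_fin sqr_ge0.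
  rewrite RintE; last by case: hf.
  by congr EFin; rewrite -[RHS]f0; apply: eq_Rintegral => x _; rewrite expr2.
have mf2 : measurable_fun setT (fun x => (f x ^+ 2)%:E).
  by case: hf => _ /measurable_int.
have /(ae_eq_integral_abs mu measurableT mf2).1 := h.
by apply: filterS => x /(_ I)/= []/eqP; rewrite sqrf_eq0 => /eqP.
Qed.

Lemma intg_ae_eq f g : measurable_fun setT f -> measurable_fun setT g ->
  {ae mu, forall x, f x = g x} -> intg f -> intg g.
Proof.
move=> mf mg fg hf; apply/integrableP; split; first exact/measurable_EFinP.
have /integrableP[_] := hf; congr (_ < _)%E.
apply: ge0_ae_eq_integral => //.
- by apply: measurableT_comp => //; exact/measurable_EFinP.
- by apply: measurableT_comp => //; exact/measurable_EFinP.
- by apply: filterS fg => x /= ->.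
Qed.

Lemma Rint_ae_eq f g : measurable_fun setT f -> measurable_fun setT g ->
  {ae mu, forall x, f x = g x} -> \int[mu]_x f x = \int[mu]_x g x.
Proof.
move=> mf mg fg; congr fine; apply: ae_eq_integral => //.
- exact/measurable_EFinP.
- exact/measurable_EFinP.
- by apply: filterS fg => x /= ->.
Qed.

Lemma sqi_ae_eq f g : measurable_fun setT f -> measurable_fun setT g ->
  {ae mu, forall x, f x = g x} -> sqi f -> sqi g.
Proof.
move=> mf mg fg [_ hf]; split => //; apply: intg_ae_eq hf.
- exact: measurable_funX.
- exact: measurable_funX.
- by apply: filterS fg => x ->.
Qed.

End SquareIntegrable.

(** * Completeness of L2 with an explicit rate *)

Section SquareIntegrableComplete.
Context d (T : measurableType d) (R : realType).
Variable mu : {measure set T -> \bar R}.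
Implicit Types f g h : T -> R.

Definition dst2 f g := \int[mu]_x ((f x - g x) ^+ 2).

Lemma dst2E f g :
  dst2 f g = ip mu (fun x => f x - g x) (fun x => f x - g x).
Proof. by apply: eq_Rintegral => x _; rewrite expr2. Qed.

Lemma dst2_ge0 f g : 0 <= dst2 f g.
Proof. by rewrite dst2E ip_ge0. Qed.

Lemma dst2C f g : dst2 f g = dst2 g f.
Proof. by apply: eq_Rintegral => x _; rewrite -sqrrN opprB. Qed.

Lemma limn_einf_le (u : (\bar R)^nat) (b : R^nat) (l : R) :
  (forall n, u n <= (b n)%:E)%E -> b n @[n --> \oo] --> l ->
  (limn_einf u <= l%:E)%E.
Proof.
move=> ub bl; rewrite limn_einf_lim.
have bl' : (b n)%:E @[n --> \oo] --> l%:E by apply: cvg_EFin => //; exact: nearW.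
rewrite -(cvg_lim (@ereal_hausdorff R) bl'); apply: lee_lim.
- exact: is_cvg_einfs.
- by apply/cvg_ex; exists l%:E.
- near=> n; apply: le_trans (ub n); rewrite /einfs; apply: ereal_inf_lbound.
  by exists n => /=.
Unshelve. all: by end_near. Qed.

(* The exponents 4 and 16 make the increments along the subsequence 16 ^ k
   summable with room for the factor 4 ^ k. *)
Lemma cvg_pow_bounded (u : R^nat) (M : R) :
  (forall k, 4 ^+ k * (u k.+1 - u k) ^+ 2 <= M) -> cvgn u.
Proof.
(* [M <= (M + 1) ^ 2], so [B] bounds the square root of [M] without taking one. *)
move=> hM; pose B := M + 1.
have M0 : 0 <= M.
  by apply: le_trans (hM 0%N); rewrite expr0 mul1r sqr_ge0.
have hB k : `|u k.+1 - u k| <= B * 2^-1 ^+ k.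
  have : (2 ^+ k * `|u k.+1 - u k|) ^+ 2 <= B ^+ 2.
    rewrite exprMn -exprM mulnC exprM real_normK ?num_real//.
    rewrite (_ : 2 ^+ 2 = 4); last by ring.
    by apply: le_trans (hM k) _; rewrite /B; nra.
  rewrite ler_pXn2r ?nnegrE ?mulr_ge0 ?exprn_ge0 ?addr_ge0// => h.
  by rewrite exprVn ler_pdivlMr ?exprn_gt0// mulrC.
have cs : cvgn (series (telescope u)).
  apply: normed_cvg; apply: (@series_le_cvg _ _ (geometric B 2^-1)).
  - by move=> n; exact: normr_ge0.
  - by move=> n; rewrite /= mulr_ge0 ?exprn_ge0// addr_ge0.
  - by move=> n; exact: hB.
  - by apply: is_cvg_geometric_series; rewrite ger0_norm// invf_lt1// ltr1n.
have -> : u = (fun n => u 0%N + series (telescope u) n).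
  by apply/funext => n; rewrite seriesEnat/= telescope_sumr// addrC subrK.
by apply: is_cvgD => //; exact: is_cvg_cst.
Qed.

Lemma pow16_le (k : nat) (C : R) : 0 <= C ->
  4 ^+ k * (C * ((16 ^ k.+1)%N.+1%:R^-1 + (16 ^ k)%N.+1%:R^-1)) <=
  2 * C * 4^-1 ^+ k.
Proof.
move=> C0.
have h m : (16 ^ m)%N.+1%:R^-1 <= (4^-1 ^+ m) ^+ 2 :> R.
  rewrite -exprM mulnC exprM !exprVn lef_pV2 ?posrE ?ltr0n ?exprn_gt0//.
  by rewrite -!natrX ler_nat leqnSn.
have q0 : 0 <= 4^-1 ^+ k :> R by rewrite exprn_ge0.
have h1 := h k; have h2 := h k.+1.
have e : 4 ^+ k * 4^-1 ^+ k = 1 :> R by rewrite -exprMn mulfV ?expr1n.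
have p0 : 0 <= 4 ^+ k :> R by rewrite exprn_ge0.
apply: (@le_trans _ _ (4 ^+ k * (C * (2 * (4^-1 ^+ k) ^+ 2)))).
  rewrite !ler_wpM2l//; apply: (@le_trans _ _ ((4^-1 ^+ k.+1) ^+ 2 + (4^-1 ^+ k) ^+ 2)).
    exact: lerD.
  rewrite [4^-1 ^+ k.+1]exprS exprMn; move: (4^-1 ^+ k) q0 => q q0.
  by rewrite (_ : 4^-1 ^+ 2 = 16^-1 :> R) ?exprVn -?natrX//; nra.
rewrite le_eqVlt; apply/orP; left; apply/eqP.
transitivity ((4 ^+ k * 4^-1 ^+ k) * (2 * C * 4^-1 ^+ k)); first by ring.
by rewrite e mul1r.
Qed.

(** The series of weighted squared increments has a finite integral, hence a finite sum almost
    everywhere; that sum is the bound [M] of [cvg_pow_bounded] at the point. *)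
Lemma rapid_ae_cvg (F : (T -> R)^nat) (C : R) : 0 <= C ->
  (forall k, sqi mu (F k)) ->
  (forall k, 4 ^+ k * dst2 (F k.+1) (F k) <= C * 4^-1 ^+ k) ->
  {ae mu, forall x, cvgn (F ^~ x)}.
Proof.
move=> C0 hF hd; pose D k x := (4 ^+ k * (F k.+1 x - F k x) ^+ 2)%:E.
have iD k : intg mu (fun x => 4 ^+ k * (F k.+1 x - F k x) ^+ 2).
  by apply: intgZ; have [] := sqiB (hF k.+1) (hF k).
have mD k : measurable_fun setT (D k) by exact: measurable_int (iD k).
have D0 k x : (0 <= D k x)%E by rewrite lee_fin mulr_ge0 ?sqr_ge0 ?exprn_ge0.
have fin : (\int[mu]_x (\sum_(k <oo) D k x) < +oo)%E.
  rewrite integral_nneseries//.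
  apply: (@le_lt_trans _ _ (\sum_(k <oo) (C * 4^-1 ^+ k)%:E)%E).
    apply: lee_nneseries => [k _|k _]; first by move=> _; exact: integral_ge0.
    rewrite /D RintE// lee_fin RintZ//.
    by have [] := sqiB (hF k.+1) (hF k).
  have := @cvg_geometric_series R C 4^-1.
  rewrite ger0_norm// invf_lt1// ltr1n => /(_ isT) cg.
  have -> : (\sum_(k <oo) (C * 4^-1 ^+ k)%:E = (C * (1 - 4^-1)^-1)%:E)%E.
    apply/cvg_lim => //.
    rewrite (_ : (fun n => _) = EFin \o series (geometric C 4^-1)); last first.
      by apply/funext => n; rewrite /= sumEFin.
    by apply: cvg_EFin => //; exact: nearW.
  exact: ltry.
have iS : mu.-integrable setT (fun x => \sum_(k <oo) D k x)%E.
  apply/integrableP; split.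
    apply: ge0_emeasurable_sum => // k x _ _; exact: D0.
  under eq_integral do rewrite gee0_abs ?nneseries_ge0//.
  exact: fin.
apply: filterS (integrable_ae measurableT iS) => x /(_ I) sfin.
apply: (@cvg_pow_bounded _ (fine (\sum_(k <oo) D k x)%E)) => k.
rewrite -lee_fin fineK//.
apply: le_trans (nneseries_lim_ge k.+1 _); last by move=> *; exact: D0.
rewrite big_nat_recr//= -[leLHS]add0e leeD//.
by apply: sume_ge0 => i _; exact: D0.
Qed.

(** Fatou's lemma along the subsequence passes the Cauchy estimate to the limit for every index [n],
    so the rate survives for the whole sequence. *)
Lemma sqi_complete (f : (T -> R)^nat) (C : R) : (forall n, sqi mu (f n)) ->
  (forall m n, dst2 (f m) (f n) <= C * (m.+1%:R^-1 + n.+1%:R^-1)) ->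
  exists2 g, sqi mu g & forall n, dst2 (f n) g <= C * n.+1%:R^-1.
Proof.
move=> hf hC.
have C0 : 0 <= C.
  by have := hC 0%N 0%N; have := dst2_ge0 (f 0%N) (f 0%N); rewrite invr1; lra.
pose F k := f (16 ^ k)%N.
have aeF : {ae mu, forall x, cvgn (F ^~ x)}.
  apply: (@rapid_ae_cvg _ (2 * C)) => [|k|k]; first exact: mulr_ge0.
    exact: hf.
  by apply: le_trans (pow16_le k C0); rewrite ler_wpM2l//; exact: hC.
(* An upper limit is measurable whether or not the sequence converges, and [fine] returns the true
   limit wherever it does. *)
pose g x := fine (limn_esup (fun k => (F k x)%:E)).
have mg : measurable_fun setT g.
  apply: measurableT_comp => //; apply: measurable_fun_limn_esup => k.
  by apply/measurable_EFinP; exact: sqi_meas (hf _).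
have gE : {ae mu, forall x, F ^~ x @ \oo --> g x}.
  apply: filterS aeF => x cx.
  have cx' : (F k x)%:E @[k --> \oo] --> (limn (F ^~ x))%:E.
    by apply: cvg_EFin => //; exact: nearW.
  rewrite /g is_cvg_limn_esupE; last by apply/cvg_ex; eexists; exact: cx'.
  by rewrite (cvg_lim (@ereal_hausdorff R) cx').
have mS n h : measurable_fun setT h ->
    measurable_fun setT (fun x => ((f n x - h x) ^+ 2)%:E).
  move=> mh; apply/measurable_EFinP; apply: measurable_funX.
  by apply: measurable_funB => //; exact: sqi_meas (hf n).
have key n : (\int[mu]_x ((f n x - g x) ^+ 2)%:E <= (C * n.+1%:R^-1)%:E)%E.
  have S0 k x : setT x -> (0 <= ((f n x - F k x) ^+ 2)%:E)%E.
    by rewrite lee_fin sqr_ge0.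
  have h := fatou mu measurableT (fun k => mS n (F k) (sqi_meas (hf _))) S0.
  apply: (@le_trans _ _ (\int[mu]_x limn_einf (fun k => ((f n x - F k x) ^+ 2)%:E))%E).
    rewrite le_eqVlt; apply/orP; left; apply/eqP.
    apply: ge0_ae_eq_integral => //.
    - exact: mS.
    - rewrite (_ : (fun _ => _) =
          (fun x => - limn_esup (fun k => - ((f n x - F k x) ^+ 2)%:E))%E)//.
      apply: measurableT_comp => //; apply: measurable_fun_limn_esup => k.
      by apply: measurableT_comp => //; exact: mS (sqi_meas (hf _)).
    - by move=> x _; rewrite lee_fin sqr_ge0.
    - move=> x _; rewrite limn_einf_lim; apply: lime_ge; first exact: is_cvg_einfs.
      apply: nearW => k; apply: le_ereal_inf_tmp => _ [m _ <-].
      by rewrite lee_fin sqr_ge0.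
    - apply: filterS gE => x gx _.
      have c : ((f n x - F k x) ^+ 2)%:E @[k --> \oo] --> ((f n x - g x) ^+ 2)%:E.
        apply: cvg_EFin; first exact: nearW.
        by apply: cvgM; apply: cvgB => //; exact: cvg_cst.
      rewrite is_cvg_limn_einfE; last by apply/cvg_ex; eexists; exact: c.
      by rewrite (cvg_lim (@ereal_hausdorff R) c).
  apply: le_trans h _.
  apply: (@limn_einf_le _ (fun k => C * (n.+1%:R^-1 + (16 ^ k)%N.+1%:R^-1))).
    move=> k; rewrite RintE; first exact: hC.
    by have [] := sqiB (hf n) (hf (16 ^ k)%N).
  rewrite -[X in C * X]addr0; apply: cvgM; first exact: cvg_cst.
  apply: cvgD; first exact: cvg_cst.
  apply: (@squeeze_cvgr _ _ _ _ (fun=> 0) harmonic).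
  - apply: nearW => k; rewrite invr_ge0 ler0n/= lef_pV2 ?posrE ?ltr0n//.
    by rewrite ler_nat ltnS ltnW// ltn_expl.
  - exact: cvg_cst.
  - exact: cvg_harmonic.
have ig n : intg mu (fun x => (f n x - g x) ^+ 2).
  apply/integrableP; split; first exact: mS.
  under eq_integral do rewrite gee0_abs ?lee_fin ?sqr_ge0//.
  by apply: le_lt_trans (key n) _; exact: ltry.
have sg n : sqi mu (fun x => f n x - g x).
  by split => //; apply: measurable_funB => //; exact: sqi_meas (hf n).
exists g.
  have := sqiB (hf 0%N) (sg 0%N); congr sqi; apply/funext => x.
  by rewrite opprB addrC subrK.
by move=> n; rewrite -lee_fin -RintE.
Qed.

End SquareIntegrableComplete.

(* Abstract form of the projection onto a subspace: [E] is the squared distance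
   of the target to [i], [D] the squared distance between two elements, [b] the
   inner product of the residual with a direction and [n] its squared norm. *)
Section MinimizingSequence.
Context (R : realType) (I : Type) (i0 : I).
Variables (mid : I -> I -> I) (shift : R -> I -> I -> I).
Variables (E n : I -> R) (D b : I -> I -> R).
Hypothesis E_ge0 : forall i, 0 <= E i.
Hypothesis n_ge0 : forall i, 0 <= n i.
Hypothesis parallelogram :
  forall i j, 4 * E (mid i j) + D i j = 2 * E i + 2 * E j.
Hypothesis E_shift :
  forall t i j, E (shift t i j) = E i + 2 * t * b i j + t ^+ 2 * n j.

Lemma minimizing_sequence : exists s : nat -> I,
  (forall k l, D (s k) (s l) <= 2 * (k.+1%:R^-1 + l.+1%:R^-1)) /\
  (forall k j, b (s k) j ^+ 2 <= k.+1%:R^-1 * n j).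
Proof.
have hi : has_inf (range E).
  split; first by exists (E i0), i0.
  by exists 0 => _ [i _ <-].
pose m := inf (range E).
have mE i : m <= E i by apply: ge_inf; [case: hi|exists i].
have hs (k : nat) : exists i, E i < m + k.+1%:R^-1.
  have k0 : 0 < k.+1%:R^-1 :> R by rewrite invr_gt0 ltr0n.
  by have [_ [i _ <-] h] := inf_adherent k0 hi; exists i.
have [s sP] := choice hs.
exists s; split=> [k l|k j].
  (* The midpoint has energy at least [m], while both ends are within [1 / (k + 1)] and
     [1 / (l + 1)] of [m]; little room is left for [D]. *)
  move: (parallelogram (s k) (s l)) (mE (mid (s k) (s l))) (sP k) (sP l).
  move: (E _) (D _ _) (E _) (E _) (_^-1) (_^-1) => *; lra.
apply: (@le_trans _ _ ((E (s k) - m) * n j)).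
  (* No shift goes below [m]: the quadratic with constant term [E (s k) - m] is nonnegative. *)
  apply: quad_CS => // [t|]; last by rewrite subr_ge0.
  by have := mE (shift t (s k) j); rewrite E_shift; lra.
by rewrite ler_wpM2r// lerBlDl ltW.
Qed.

End MinimizingSequence.

(** * Continuity and the product sigma-algebra of the plane *)

Section PlaneMeasurability.
Context {R : realType}.
Local Notation R2 := (R * R)%type.

(** The measurable sets are generated by products, so an open set is exhibited as a countable union:
    of the boxes with rational centre and radius [1 / (n + 1)] that it contains. *)
Lemma open_measurable_plane (U : set R2) : open U ->
  measurable (U : set (plane R)).
Proof.
move=> oU; pose B (p q : rat) (n : nat) : set R2 :=
  ball (ratr p : R) n.+1%:R^-1 `*` ball (ratr q : R) n.+1%:R^-1.
rewrite (_ : U = \bigcup_p \bigcup_q \bigcup_n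
    (if `[< B p q n `<=` U >] then B p q n else set0)); last first.
  apply/seteqP; split => [[x y] Uxy|[x y] [p _ [q _ [n _]]]]; last first.
    by case: asboolP => // h /h.
  have /nbhs_ballP[e /= e0 he] : nbhs (x, y) U by move: oU; rewrite openE; exact.
  have [n ne] : exists n, n.+1%:R^-1 < e / 2.
    have e20 : 0 < e / 2 by rewrite divr_gt0.
    have [n _ hn] := near_infty_natSinv_lt (PosNum e20).
    by exists n; exact: (hn n (leqnn n)).
  have [p pP] : exists p : rat, `|x - ratr p| < n.+1%:R^-1.
    have /rat_in_itvoo[p] : x - n.+1%:R^-1 < x + n.+1%:R^-1 by rewrite ltrD2l gtrN.
    by rewrite in_itv/= -ltr_distlC => xp; exists p.
  have [q qP] : exists p : rat, `|y - ratr p| < n.+1%:R^-1.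
    have /rat_in_itvoo[q] : y - n.+1%:R^-1 < y + n.+1%:R^-1 by rewrite ltrD2l gtrN.
    by rewrite in_itv/= -ltr_distlC => yq; exists q.
  exists p => //; exists q => //; exists n => //.
  case: asboolP => [_|]; first by split; rewrite /ball /= distrC.
  case; move=> [a b] [/=]; rewrite /ball /= => h1 h2.
  apply: he; split => /=; rewrite /ball /=.
    rewrite -(subrK (ratr p) x) -addrA (le_lt_trans (ler_normD _ _))//.
    by rewrite (splitr e) ltrD// (lt_trans _ ne).
  rewrite -(subrK (ratr q) y) -addrA (le_lt_trans (ler_normD _ _))//.
  by rewrite (splitr e) ltrD// (lt_trans _ ne).
apply: bigcupT_measurable_rat => p; apply: bigcupT_measurable_rat => q.
apply: bigcupT_measurable => n; case: asboolP => // _.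
by apply: measurableX; exact: measurable_ball.
Qed.

Lemma continuous_measurable_plane (f : R2 -> R) : continuous f ->
  measurable_fun setT (f : plane R -> R).
Proof.
move=> /continuousP cf.
apply: (measurability _ (RGenOpens.measurableE R)).
move=> _ [_ [a [b ->] <-]]; rewrite setTI; apply: open_measurable_plane.
exact/cf/interval_open.
Qed.

End PlaneMeasurability.

(** * Integration by parts in the plane *)

Section PlaneIntegration.
Context {R : realType}.
Local Notation R2 := (R * R)%type.
Local Notation mu := (@leb2 R).
Local Notation leb := (@lebesgue_measure R).
Implicit Types f g F : R2 -> R.

Lemma fubini12 f : intg mu f ->
  (\int[mu]_z (f z)%:E = \int[leb]_x \int[leb]_y (f (x, y))%:E)%E.
Proof. by move=> hf; rewrite -(integral12_prod_meas1 hf). Qed.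

Lemma fubini21 f : intg mu f ->
  (\int[mu]_z (f z)%:E = \int[leb]_y \int[leb]_x (f (x, y))%:E)%E.
Proof. by move=> hf; rewrite -(integral21_prod_meas1 hf). Qed.

Lemma deriv_zero_far (f : R -> R) (N x : R) : (forall t, N <= `|t| -> f t = 0) ->
  N < `|x| -> derive1 f x = 0.
Proof.
move=> f0 Nx; rewrite derive1E (_ : 0 = 'D_1 (cst 0 : R -> R) x); last first.
  by rewrite derive_cst.
apply: near_eq_derive; near=> t; apply: f0.
near: t; have := @norm_continuous R R x; move/cvgr_gt => /(_ _ Nx).
by apply: filterS => t /ltW.
Unshelve. all: by end_near. Qed.

Lemma integral_deriv0 (f : R -> R) (N : R) : (forall x, derivable f x 1) ->
  continuous (derive1 f) -> (forall x, N <= `|x| -> f x = 0) ->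
  (\int[leb]_x (derive1 f x)%:E = 0)%E.
Proof.
(* [M] is positive, so that [[- M, M]] is an interval, and exceeds [N], so that [f] vanishes at its
   ends and the derivative outside. *)
move=> df cf f0; pose M := `|N| + 1.
have M0 : 0 < M by rewrite ltr_wpDl.
have NM : N < M by rewrite (le_lt_trans (ler_norm N))// ltrDl.
rewrite (_ : (fun x => (derive1 f x)%:E) =
    (fun x => (derive1 f x)%:E) \_ `[- M, M]); last first.
  apply/funext => x; rewrite patchE; case: ifPn => //.
  rewrite notin_setE/= in_itv/= => /negP; rewrite -ler_norml -ltNge => Mx.
  by rewrite (@deriv_zero_far f N)// (lt_trans NM).
rewrite -integral_mkcond (@continuous_FTC2 _ (derive1 f) f).
- by rewrite !f0 ?normrN ?gtr0_norm ?ltW// subee.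
- by rewrite gtrN.
- exact: continuous_subspaceT.
- have cc x : {for x, continuous f}.
    by apply: differentiable_continuous; exact/derivable1_diffP.
  split.
  + by move=> x _.
  + by apply: cvg_at_right_filter; exact: cc.
  + by apply: cvg_at_left_filter; exact: cc.
- by [].
Qed.

(** The difference quotients agree as functions, so derivability and the derivative transfer to the
    slice together. *)
Lemma slice0E f (x y : R) :
  (fun h => h^-1 *: (f (h *: e_ 0 + (x, y)) - f (x, y))) =
  (fun h => h^-1 *: (f (h *: 1 + x, y) - f (x, y))).
Proof.
apply/funext => h; congr (_ *: (f _ - _)); rewrite /e_ eqxx.
by congr pair; rewrite /= scaler0 add0r.
Qed.

Lemma slice1E f (x y : R) :
  (fun h => h^-1 *: (f (h *: e_ 1 + (x, y)) - f (x, y))) =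
  (fun h => h^-1 *: (f (x, h *: 1 + y) - f (x, y))).
Proof.
apply/funext => h; congr (_ *: (f _ - _)); rewrite /e_ /=.
by congr pair; rewrite /= scaler0 add0r.
Qed.

Lemma derivable_slice0 f x y :
  derivable f (x, y) (e_ 0) <-> derivable (fun t => f (t, y)) x 1.
Proof. by rewrite /derivable slice0E. Qed.

Lemma derivable_slice1 f x y :
  derivable f (x, y) (e_ 1) <-> derivable (fun t => f (x, t)) y 1.
Proof. by rewrite /derivable slice1E. Qed.

Lemma partial_slice0 f x y : partial 0 f (x, y) = derive1 (fun t => f (t, y)) x.
Proof. by rewrite derive1E /partial /derive slice0E. Qed.

Lemma partial_slice1 f x y : partial 1 f (x, y) = derive1 (fun t => f (x, t)) y.
Proof. by rewrite derive1E /partial /derive slice1E. Qed.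

(** A form of bounded support that products and derivatives preserve at once; [test_bsupp] and
    [bsupp_test] relate it to compact support. *)
Definition bsupp f := exists N : R, forall x, N <= `|x| -> f x = 0.

Lemma normR2_ge (x y : R) : `|x| <= `|(x, y)| /\ `|y| <= `|(x, y)|.
Proof. by rewrite prod_normE/= !le_max !lexx orbT. Qed.

Lemma compact_square (M : R) : compact [set x : R2 | `|x| <= M].
Proof.
rewrite (_ : [set _ | _] = `[- M, M] `*` `[- M, M]).
  by apply: compact_setX; exact: segment_compact.
apply/seteqP; split => [[x y]|[x y]] /=; rewrite !in_itv/= -!ler_norml.
  by move=> h; have [h1 h2] := normR2_ge x y; rewrite !(le_trans _ h).
by move=> [h1 h2]; rewrite prod_normE ge_max/= h1 h2.
Qed.

Lemma bsupp_bounded f : continuous f -> bsupp f ->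
  exists2 M, 0 <= M & forall x, `|f x| <= M.
Proof.
move=> cf [N hN].
have /compact_bounded[M [_ hM]] : compact (f @` [set x | `|x| <= N]).
  apply: continuous_compact; first exact: continuous_subspaceT.
  exact: compact_square.
exists (`|M| + 1) => [|x]; first by rewrite addr_ge0.
have [xN|Nx] := leP `|x| N; last by rewrite (hN _ (ltW Nx)) normr0 addr_ge0.
apply: (hM (`|M| + 1)); last by exists x.
by rewrite (le_lt_trans (ler_norm M))// ltrDl.
Qed.

(* An integrable weight, used to turn local into global square integrability. *)
Definition kap (x : R2) : R := ((1 + x.1 ^+ 2) * (1 + x.2 ^+ 2))^-1.

Lemma kap_den_ge1 (x : R2) : 1 <= (1 + x.1 ^+ 2) * (1 + x.2 ^+ 2).
Proof. by have := sqr_ge0 x.1; have := sqr_ge0 x.2; nra. Qed.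

Lemma kap_gt0 x : 0 < kap x.
Proof. by rewrite invr_gt0 (lt_le_trans ltr01)// kap_den_ge1. Qed.

Lemma continuous_kap : continuous kap.
Proof.
move=> x; apply: cvgV; first by rewrite gt_eqF// (lt_le_trans ltr01)// kap_den_ge1.
apply: cvgM; apply: cvgD; try exact: cvg_cst.
  by apply: cvgM; exact: cvg_fst.
by apply: cvgM; exact: cvg_snd.
Qed.

Lemma integral_oneDsqrV :
  (\int[leb]_x ((1 + x ^+ 2)^-1)%:E = pi%:E)%E.
Proof.
rewrite (@ge0_symfun_integralT _ (fun x : R => (1 + x ^+ 2)^-1)).
- rewrite -set_itvcy.
  rewrite (@integral0y_oneDsqr R) -EFinM; congr EFin.
  by rewrite mulrCA divff ?mulr1.
- by move=> x; rewrite invr_ge0 addr_ge0// sqr_ge0.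
- exact: continuous_oneDsqrV.
- by move=> x /=; rewrite sqrrN.
Qed.

Lemma measurable_oneDsqrV : measurable_fun [set: measurableTypeR R]
  (fun x : R => ((1 + x ^+ 2)^-1)%:E).
Proof.
apply/measurable_EFinP.
apply: (@continuous_measurable_fun R (fun x => (1 + x ^+ 2)^-1)).
exact: continuous_oneDsqrV.
Qed.

Lemma intg_kap : intg mu kap.
Proof.
apply/integrableP; split.
  apply/measurable_EFinP; exact: (continuous_measurable_plane continuous_kap).
under eq_integral do rewrite gee0_abs ?lee_fin ?ltW ?kap_gt0//.
rewrite fubini_tonelli1//; last 2 first.
- by apply/measurable_EFinP; exact: (continuous_measurable_plane continuous_kap).
- by move=> x; rewrite lee_fin ltW ?kap_gt0.
rewrite /fubini_F /kap/=.
under eq_integral => x _.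
  under eq_integral do rewrite invfM EFinM.
  rewrite ge0_integralZl//; last 3 first.
  - exact: measurable_oneDsqrV.
  - by move=> y _; rewrite lee_fin invr_ge0 addr_ge0// sqr_ge0.
  - by rewrite lee_fin invr_ge0 addr_ge0// sqr_ge0.
  rewrite integral_oneDsqrV; over.
rewrite ge0_integralZr//; last 3 first.
- exact: measurable_oneDsqrV.
- by move=> y _; rewrite lee_fin invr_ge0 addr_ge0// sqr_ge0.
- by rewrite lee_fin pi_ge0.
by rewrite integral_oneDsqrV -EFinM ltry.
Qed.

Lemma bsuppM f g : bsupp f -> bsupp (fun x => f x * g x).
Proof. by move=> [N hN]; exists N => x /hN ->; rewrite mul0r. Qed.

(** Dividing by [kap] leaves [f] continuous with bounded support, hence bounded, so a multiple of
    [kap] dominates [f]. *)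
Lemma bsupp_intg f : continuous f -> bsupp f -> intg mu f.
Proof.
move=> cf bf; pose g x := f x * ((1 + x.1 ^+ 2) * (1 + x.2 ^+ 2)).
have [M M0 hM] : exists2 M, 0 <= M & forall x, `|g x| <= M.
  apply: bsupp_bounded; last exact: bsuppM.
  move=> x; apply: cvgM; first exact: cf.
  apply: cvgM; apply: cvgD; try exact: cvg_cst.
    by apply: cvgM; exact: cvg_fst.
  by apply: cvgM; exact: cvg_snd.
apply: (@intg_le _ _ _ mu f (fun x => M * kap x)).
- exact: continuous_measurable_plane.
- move=> x; rewrite (_ : f x = g x * kap x); last first.
    by rewrite /g /kap mulfK// gt_eqF// (lt_le_trans ltr01)// kap_den_ge1.
  by rewrite normrM (gtr0_norm (kap_gt0 x)) ler_wpM2r// ltW// kap_gt0.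
- apply: intgZ; exact: intg_kap.
Qed.

Lemma bsupp_sqi f : continuous f -> bsupp f -> sqi mu f.
Proof.
move=> cf bf; split; first exact: continuous_measurable_plane.
apply: bsupp_intg; first by move=> x; apply: cvgM; exact: cf.
by rewrite (_ : (fun x => _) = (fun x => f x * f x))//; exact: bsuppM.
Qed.

Lemma bsupp_partial j f : bsupp f -> bsupp (partial j f).
Proof.
(* A derivative sees a neighbourhood of [x], which needs the norm of [x] strictly above [N]. *)
move=> [N hN]; exists (N + 1) => x hx.
rewrite /partial (_ : 0 = 'D_(e_ j) (cst 0 : R2 -> R) x); last first.
  by rewrite derive_cst.
apply: near_eq_derive; near=> t; apply: hN.
near: t; have := @norm_continuous R _ x; move/cvgr_gt => /(_ N).
have Nx : N < `|x| by rewrite (lt_le_trans _ hx)// ltrDl.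
by move=> /(_ Nx); apply: filterS => t /ltW.
Unshelve. all: by end_near. Qed.

(** Fubini in the order that integrates first along [e_ j]; every slice then contributes 0. *)
Lemma integral_partial0 (j : 'I_2) F : (forall x, derivable F x (e_ j)) ->
  continuous (partial j F) -> bsupp F ->
  (\int[mu]_x (partial j F x)%:E = 0)%E.
Proof.
move=> dF cF bF.
have iF : intg mu (partial j F) by apply: bsupp_intg => //; exact: bsupp_partial.
case: bF => N hN.
have [j0|j1] : j = 0 \/ j = 1.
  by case: j {dF cF iF} => [[|[|//]] ?]; [left|right]; exact/val_inj.
- rewrite fubini21//; apply: integral0_eq => y _; rewrite j0 in dF cF iF *.
  under eq_integral do rewrite partial_slice0.
  apply: (@integral_deriv0 _ N).
  + by move=> x; apply/derivable_slice0; exact: dF.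
  + rewrite (_ : derive1 _ = fun x => partial 0 F (x, y)); last first.
      by apply/funext => x; rewrite partial_slice0.
    move=> x; apply: (@continuous_comp _ _ _ (fun x => (x, y)) (partial 0 F)).
      by apply: (@cvg_pair _ _ _ _ (nbhs x) (nbhs (y : R))); [exact: cvg_id|exact: cvg_cst].
    exact: cF.
  + by move=> x Nx; apply: hN; rewrite (le_trans Nx)//; have [] := normR2_ge x y.
- rewrite fubini12//; apply: integral0_eq => x _; rewrite j1 in dF cF iF *.
  under eq_integral do rewrite partial_slice1.
  apply: (@integral_deriv0 _ N).
  + by move=> y; apply/derivable_slice1; exact: dF.
  + rewrite (_ : derive1 _ = fun y => partial 1 F (x, y)); last first.
      by apply/funext => y; rewrite partial_slice1.
    move=> y; apply: (@continuous_comp _ _ _ (fun y => (x, y)) (partial 1 F)).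
      by apply: (@cvg_pair _ _ _ _ (nbhs (x : R)) (nbhs y)); [exact: cvg_cst|exact: cvg_id].
    exact: cF.
  + by move=> y Ny; apply: hN; rewrite (le_trans Ny)//; have [] := normR2_ge x y.
Qed.

Definition C1 f := continuous f /\
  forall j, (forall x, derivable f x (e_ j)) /\ continuous (partial j f).

Lemma partialM j f g x : derivable f x (e_ j) -> derivable g x (e_ j) ->
  partial j (fun x => f x * g x) x = partial j f x * g x + f x * partial j g x.
Proof.
move=> df dg; rewrite /partial (deriveM df dg) addrC; congr (_ + _).
by rewrite mulrC.
Qed.

Lemma ibp j f g : C1 f -> C1 g -> bsupp g ->
  \int[mu]_x (f x * partial j g x) = - \int[mu]_x (partial j f x * g x).
Proof.
move=> [cf f1] [cg g1] bg; have [df cf'] := f1 j; have [dg cg'] := g1 j.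
have bC (a b : R2 -> R) : bsupp b -> bsupp (fun x => a x * b x).
  by move=> [N hN]; exists N => x /hN ->; rewrite mulr0.
have cM (a b : R2 -> R) : continuous a -> continuous b ->
  continuous (fun x => a x * b x).
  by move=> ca cb x; apply: cvgM; [exact: ca|exact: cb].
have i1 : intg mu (fun x => f x * partial j g x).
  by apply: bsupp_intg; [exact: cM|apply: bC; exact: bsupp_partial].
have i2 : intg mu (fun x => partial j f x * g x).
  by apply: bsupp_intg; [exact: cM|exact: bC].
apply/eqP; rewrite -addr_eq0 addrC -RintD//; apply/eqP.
have pE : partial j (fun x => f x * g x) =
    (fun x => partial j f x * g x + f x * partial j g x).
  by apply/funext => x; rewrite partialM.
have := @integral_partial0 j (fun x => f x * g x).
rewrite pE => h; rewrite /Rintegral h//.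
- by move=> x; exact: (derivableM (df x) (dg x)).
- by move=> x; apply: cvgD; apply: cM.
- exact: bC.
Qed.

End PlaneIntegration.

(** * A smooth cut-off profile *)

Section Bump.
Context {R : realType}.
Implicit Types (t : R) (k : nat).

(** The powers of [1 / t] close the family of flat functions under differentiation: [bump k] has
    derivative [bump k.+2 - k * bump k.+1]. *)
Definition bump k t : R := if 0 < t then t ^- k * expR (- t^-1) else 0.

Lemma bump_ge0 k t : 0 <= bump k t.
Proof.
rewrite /bump; case: ifPn => // t0.
by rewrite mulr_ge0 ?expR_ge0// invr_ge0 exprn_ge0// ltW.
Qed.

(** A single term of the exponential series at [1 / t] beats the power [t ^- k]. *)
Lemma bump_le k m t : (k <= m.+1)%N -> 0 < t ->
  bump k t <= m.+1`!%:R * t ^+ (m.+1 - k).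
Proof.
move=> km t0; rewrite /bump t0 expRN.
have ti : 0 <= t^-1 by rewrite invr_ge0 ltW.
have h : t^-1 ^+ m.+1 <= m.+1`!%:R * expR t^-1.
  rewrite mulrC -ler_pdivrMr ?ltr0n ?fact_gt0//.
  by apply: le_trans (expR_ge1Dxn m ti); rewrite lerDr.
have -> : t ^- k = t^-1 ^+ m.+1 * t ^+ (m.+1 - k).
  rewrite -{1}(subnKC km) exprD -mulrA -exprMn mulVf ?gt_eqF//.
  by rewrite expr1n mulr1 exprVn.
rewrite ler_pdivrMr ?expR_gt0// mulrAC ler_wpM2r//.
by rewrite exprn_ge0// ltW.
Qed.

Lemma bump_mul k t : bump k t = bump k.+1 t * t.
Proof.
rewrite /bump; case: ifPn => t0; last by rewrite mul0r.
rewrite mulrAC; congr (_ * _); rewrite exprS invfM mulrAC mulVf ?mul1r//.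
by rewrite gt_eqF.
Qed.

Lemma bump0_le1 t : bump 0 t <= 1.
Proof.
rewrite /bump; case: ifPn => // t0; rewrite expr0 invr1 mul1r -expR0 ler_expR.
by rewrite oppr_le0 invr_ge0 ltW.
Qed.

Lemma bump2_le2 t : bump 2 t <= 2.
Proof.
have [t0|t0] := ltP 0 t; last by rewrite /bump ltNge t0.
by have := @bump_le 2 1 t isT t0; rewrite subnn expr0 mulr1.
Qed.

Lemma bump_cvg0 k : {for 0, continuous (bump k)}.
Proof.
rewrite /prop_for /continuous_at {2}/bump ltxx.
apply: (@squeeze_cvgr _ _ _ _ (fun=> 0) (fun t => k.+1`!%:R * `|t|)).
- apply: nearW => t; rewrite bump_ge0 /=.
  have [t0|t0] := ltP 0 t.
    have := @bump_le k k t (leqnSn k) t0.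
    by rewrite subSnn expr1 gtr0_norm.
  by rewrite /bump ltNge t0/= mulr_ge0.
- exact: cvg_cst.
- have : (k.+1`!%:R * `|t|) @[t --> (0 : R)] --> k.+1`!%:R * `|0 : R|.
    by apply: cvgM; [exact: cvg_cst|exact: norm_continuous].
  by rewrite normr0 mulr0.
Qed.

Lemma is_derive_bump k t :
  is_derive t 1 (bump k) (bump k.+2 t - k%:R * bump k.+1 t).
Proof.
have [t0|t0|<-] := ltgtP 0 t.
- have t_neq0 : t != 0 by rewrite gt_eqF.
  have dV : is_derive t 1 (fun u : R => u^-1) (- t ^- 2 *: 1) by exact: is_deriveV.
  have d1 := is_deriveX k dV.
  have d2 : is_derive t 1 (expR \o (fun u : R => - u^-1))
     (expR (- t^-1) * - (- t ^- 2 *: 1)).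
    by apply: is_derive1_comp; exact: is_deriveN.
  have d : is_derive t 1 (fun u : R => u ^- k * expR (- u^-1))
      (bump k.+2 t - k%:R * bump k.+1 t).
    rewrite (_ : (fun u => _) = (fun u : R => u^-1) ^+ k * (expR \o (fun u : R => - u^-1))).
      apply: (is_derive_eq (is_deriveM d1 d2)).
      rewrite /bump t0 /GRing.scale/= exprfctE -!exprVn.
      by case: k {d1} => [|k]; rewrite /= ?exprS; ring.
    by apply/funext => u; rewrite mulrfctE exprfctE/= exprVn.
  apply: near_eq_is_derive d; near=> u.
  by rewrite /bump ifT//; near: u; exact: lt_nbhsr.
- have d : is_derive t 1 (cst 0 : R -> R) (bump k.+2 t - k%:R * bump k.+1 t).
    by rewrite /bump !ltNge !(ltW t0)/= mulr0 subr0; exact: is_derive_cst.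
  apply: near_eq_is_derive d; near=> u.
  by rewrite /bump ifF//; apply/negbTE; rewrite -leNgt ltW//; near: u; exact: lt_nbhsl.
(* At 0 the slope function of [bump k] is [bump k.+1], by [bump_mul], and it is continuous there
   with value 0. *)
- apply/is_derive1_caratheodory; exists (bump k.+1); split.
  + by move=> z; rewrite {2}/bump ltxx !subr0; exact: bump_mul.
  + exact: bump_cvg0.
  + by rewrite /bump ltxx mulr0 subr0.
Unshelve. all: by end_near. Qed.

Lemma continuous_bump k : continuous (bump k).
Proof.
move=> t; apply: differentiable_continuous; apply/derivable1_diffP.
by have [] := is_derive_bump k t.
Qed.

End Bump.

(** * Symbolic differentiation of explicit kernels *)

Section Expressions.
Context {R : realType}.
Local Notation R2 := (R * R)%type.
Implicit Types (x v : R2) (f : R2 -> R).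

(** Restricting to a line gives access to the one-variable chain rule. *)
Lemma is_derive_line f x v (l : R) :
  is_derive x v f l <-> is_derive (0 : R) 1 (fun t => f (t *: v + x)) l.
Proof.
have e : (fun h : R => h^-1 *: (f (h *: v + x) - f x)) =
    (fun h => h^-1 *: (f ((h *: 1 + 0) *: v + x) - f (0 *: v + x))).
  by apply/funext => h; rewrite addr0 [h%:A]mulr1 scale0r add0r.
by split=> -[d1 d2]; split; move: d1 d2; rewrite /derivable /derive -e.
Qed.

Lemma is_derive_comp_dir (g : R -> R) f x v (a b : R) :
  is_derive (f x) 1 g a -> is_derive x v f b ->
  is_derive x v (g \o f) (a * b).
Proof.
move=> dg /is_derive_line df; apply/is_derive_line.
apply: (@is_derive1_comp _ g (fun t => f (t *: v + x))) => //.
by rewrite scale0r add0r.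
Qed.

Lemma is_derive_affine (a b t : R) : is_derive t 1 (fun u => u * a + b) a.
Proof.
rewrite (_ : (fun u => _) = a \*: id + cst b); last first.
  by apply/funext => u; rewrite addrfctE /= mulrC.
have := is_deriveD (is_deriveZ a (is_derive_id t 1)) (is_derive_cst b t 1).
by move=> d; apply: (is_derive_eq d); rewrite addr0 [_%:A]mulr1.
Qed.

Variables (c : R2) (s rho : R).
Hypothesis s_gt0 : 0 < s.

Definition quadr x := (x.1 - c.1) ^+ 2 + (x.2 - c.2) ^+ 2.

(* Syntax of a class of smooth functions closed under partial derivatives:
   [Inv] is 1 / (s + |x - c|^2) and [Bmp k] is bump k (1 - |x - c|^2 / rho). *)
Inductive expr := Cst of R | Co of 'I_2 | Add of expr & expr
  | Mul of expr & expr | Inv | Bmp of nat.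

Fixpoint eval (e : expr) : R2 -> R :=
  match e with
  | Cst k => cst k
  | Co j => fun x => if j == 0 then x.1 - c.1 else x.2 - c.2
  | Add a b => fun x => eval a x + eval b x
  | Mul a b => fun x => eval a x * eval b x
  | Inv => fun x => (s + quadr x)^-1
  | Bmp k => fun x => bump k (1 - quadr x / rho)
  end.

Fixpoint dif (j : 'I_2) (e : expr) : expr :=
  match e with
  | Cst _ => Cst 0
  | Co i => Cst (if i == j then 1 else 0)
  | Add a b => Add (dif j a) (dif j b)
  | Mul a b => Add (Mul (dif j a) b) (Mul a (dif j b))
  | Inv => Mul (Cst (- 2)) (Mul (Co j) (Mul Inv Inv))
  | Bmp k => Mul (Mul (Cst (- 2 / rho)) (Co j))
                 (Add (Bmp k.+2) (Mul (Cst (- k%:R)) (Bmp k.+1)))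
  end.

Lemma quadr_ge0 x : 0 <= quadr x.
Proof. by rewrite addr_ge0// sqr_ge0. Qed.

Lemma ord2P (j : 'I_2) : j = 0 \/ j = 1.
Proof. by case: j => [[|[|//]] ?]; [left|right]; exact/val_inj. Qed.

Lemma is_derive_co i j x :
  is_derive x (e_ j) (eval (Co i)) (if i == j then 1 else 0).
Proof.
apply/is_derive_line.
have [->|->] := ord2P i; have [->|->] := ord2P j; rewrite /= /e_ /=.
- rewrite (_ : (fun t : R => _) = (fun t => t * 1 + (x.1 - c.1))).
    exact: is_derive_affine.
  by apply/funext => t; rewrite /= addrA.
- rewrite (_ : (fun t : R => _) = (fun t => t * 0 + (x.1 - c.1))).
    exact: is_derive_affine.
  by apply/funext => t; rewrite /= addrA.
- rewrite (_ : (fun t : R => _) = (fun t => t * 0 + (x.2 - c.2))).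
    exact: is_derive_affine.
  by apply/funext => t; rewrite /= addrA.
- rewrite (_ : (fun t : R => _) = (fun t => t * 1 + (x.2 - c.2))).
    exact: is_derive_affine.
  by apply/funext => t; rewrite /= addrA.
Qed.

Lemma is_derive_quadr j x :
  is_derive x (e_ j) quadr (2 * eval (Co j) x).
Proof.
have h i := is_derive_co i j x.
have := is_deriveD (is_deriveM (h 0) (h 0)) (is_deriveM (h 1) (h 1)).
rewrite (_ : _ + _ = quadr); last by apply/funext => y; rewrite /quadr !expr2.
move=> d; apply: (is_derive_eq d); rewrite /GRing.scale/=.
by have [->|->] := ord2P j; rewrite /=; ring.
Qed.

Lemma is_derive_eval e j x : is_derive x (e_ j) (eval e) (eval (dif j e) x).
Proof.
elim: e => [k|i|a iha b ihb|a iha b ihb||k].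
- exact: is_derive_cst.
- exact: is_derive_co.
- exact: is_deriveD.
- have d := is_deriveM iha ihb; apply: (is_derive_eq d).
  by rewrite /= /GRing.scale/=; ring.
- have q0 : s + quadr x != 0 by rewrite gt_eqF// ltr_wpDr// quadr_ge0.
  have d : is_derive x (e_ j) (fun x => s + quadr x) (2 * eval (Co j) x).
    have := is_deriveD (is_derive_cst s x (e_ j)) (is_derive_quadr j x).
    by rewrite add0r.
  have d1 : is_derive (s + quadr x) 1 (fun u : R => u^-1)
      (- (s + quadr x) ^- 2 *: 1) by exact: is_deriveV.
  have d2 := is_derive_comp_dir d1 d; apply: (is_derive_eq d2).
  by rewrite /= /GRing.scale /=; field.
- have d : is_derive x (e_ j) (fun x => 1 - quadr x / rho)
      (- 2 / rho * eval (Co j) x).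
    have dq : is_derive x (e_ j) (rho^-1 \*: quadr) _ :=
      is_deriveZ rho^-1 (is_derive_quadr j x).
    have := is_deriveB (is_derive_cst (1 : R) x (e_ j)) dq.
    rewrite (_ : _ - _ = (fun x => 1 - quadr x / rho)); last first.
      by apply/funext => y; rewrite /= [_ / rho]mulrC.
    by move=> d; apply: (is_derive_eq d); rewrite /GRing.scale/=; ring.
  have d2 := is_derive_comp_dir (is_derive_bump k _) d; apply: (is_derive_eq d2).
  by rewrite /=; ring.
Qed.

Lemma continuous_eval e : continuous (eval e).
Proof.
have cco i : continuous (eval (Co i)).
  have [->|->] := ord2P i => x.
    by apply: (@cvgB _ _ _ _ _ fst); [exact: cvg_fst|exact: cvg_cst].
  by apply: (@cvgB _ _ _ _ _ snd); [exact: cvg_snd|exact: cvg_cst].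
have cq : continuous quadr.
  move=> x; apply: cvgD; rewrite /=.
    by apply: cvgM; exact: (cco 0).
  by apply: cvgM; exact: (cco 1).
elim: e => [k|i|a iha b ihb|a iha b ihb||k] x.
- exact: cvg_cst.
- exact: cco.
- by apply: cvgD; [exact: iha|exact: ihb].
- by apply: cvgM; [exact: iha|exact: ihb].
- apply: cvgV; first by rewrite gt_eqF// ltr_wpDr// quadr_ge0.
  by apply: cvgD; [exact: cvg_cst|exact: cq].
- apply: (@continuous_comp _ _ _ (fun x => 1 - quadr x / rho) (bump k)).
    by apply: cvgB; [exact: cvg_cst|apply: cvgM; [exact: cq|exact: cvg_cst]].
  exact: continuous_bump.
Qed.

Lemma derivable_eval e j x : derivable (eval e) x (e_ j).
Proof. by have [] := is_derive_eval e j x. Qed.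

Lemma partial_eval e j : partial j (eval e) = eval (dif j e).
Proof. by apply/funext => x; have [_] := is_derive_eval e j x. Qed.

Lemma smooth_eval e : smooth (eval e).
Proof.
move=> r; have -> : foldr partial (eval e) r = eval (foldr dif e r).
  by elim: r => //= j r ->; rewrite partial_eval.
by split; [exact: continuous_eval|move=> j x; exact: derivable_eval].
Qed.

(** Symmetry of second derivatives by induction on the syntax: sums and products inherit it, and for
    [Inv] and [Bmp] both orders evaluate to the same polynomial in the atoms. *)
Lemma dif_comm e x : eval (dif 0 (dif 1 e)) x = eval (dif 1 (dif 0 e)) x.
Proof.
elim: e => [k|i|a iha b ihb|a iha b ihb||k] //=.
- by rewrite iha ihb.
- by rewrite iha ihb; ring.
- ring.
- ring.
Qed.

End Expressions.

(** * Test functions and the integral of the Jacobian *)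

Section TestFunctions.
Context {R : realType}.
Local Notation R2 := (R * R)%type.
Local Notation mu := (@leb2 R).
Implicit Types f g h : R2 -> R.

Lemma smooth_partial f j : smooth f -> smooth (partial j f).
Proof. by move=> sf r; have := sf (rcons r j); rewrite foldr_rcons. Qed.

Lemma smooth_continuous f : smooth f -> continuous f.
Proof. by move=> /(_ [::])[]. Qed.

Lemma smooth_derivable f j x : smooth f -> derivable f x (e_ j).
Proof. by move=> /(_ [::])[_]; exact. Qed.

Lemma smooth_C1 f : smooth f -> C1 f.
Proof.
move=> sf; split; first exact: smooth_continuous.
move=> j; split; first by move=> x; exact: smooth_derivable.
exact/smooth_continuous/smooth_partial.
Qed.

Lemma is_derive_lin (t : R) f g (j : 'I_2) x : derivable f x (e_ j) -> derivable g x (e_ j) ->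
  is_derive x (e_ j) (fun x => f x + t * g x)
    (partial j f x + t * partial j g x).
Proof.
move=> /derivableP df /derivableP dg.
exact: (is_deriveD df (is_deriveZ t dg)).
Qed.

Lemma smooth_partial_lin (t : R) f g j : smooth f -> smooth g ->
  partial j (fun x => f x + t * g x) =
  (fun x => partial j f x + t * partial j g x).
Proof.
move=> sf sg; apply/funext => x.
have := is_derive_lin t (@smooth_derivable f j x sf) (@smooth_derivable g j x sg).
by case.
Qed.

Lemma smooth_lin (t : R) f g : smooth f -> smooth g ->
  smooth (fun x => f x + t * g x).
Proof.
move=> sf sg r.
have -> : foldr partial (fun x => f x + t * g x) r =
    (fun x => foldr partial f r x + t * foldr partial g r x).
  elim: r => //= j r ->; apply/funext => x.
  have [_ df] := sf r; have [_ dg] := sg r.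
  by have [_] := @is_derive_lin t _ _ j x (df j x) (dg j x).
have [cf df] := sf r; have [cg dg] := sg r; split.
  move=> x; apply: cvgD; first exact: cf.
  by apply: cvgM; [exact: cvg_cst|exact: cg].
by move=> j x; have [] := @is_derive_lin t _ _ j x (df j x) (dg j x).
Qed.

Lemma test_smooth f : test_function f -> smooth f. Proof. by case. Qed.

Lemma test_bsupp f : test_function f -> bsupp f.
Proof.
move=> [_ /compact_bounded[M [_ hM]]]; exists (`|M| + 2) => x hx.
apply: contrapT => /eqP fx.
have := hM (`|M| + 1); rewrite (le_lt_trans (ler_norm M)) ?ltrDl// => /(_ isT x).
rewrite /= => /(_ (@subset_closure _ [set x | f x != 0] x fx)) => h.
by have := le_trans hx h; rewrite lerD2l; lra.
Qed.

Lemma bsupp_test f : smooth f -> bsupp f -> test_function f.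
Proof.
move=> sf [N hN]; split => //.
have cl : closed [set x : R2 | `|x| <= N].
  exact (@compact_closed R2 _ (@norm_hausdorff _ R2) (@compact_square R N)).
have cs : closure [set x | f x != 0] `<=` [set x : R2 | `|x| <= N].
  rewrite [X in _ `<=` X](closure_id _).1//; apply: (@closureS R2) => x /= fx.
  by rewrite leNgt; apply: contraNN fx => Nx; rewrite hN// ltW.
exact (@subclosed_compact R2 _ _ (@closed_closure _ _) (@compact_square R N) cs).
Qed.

(* Test functions whose mixed second derivatives agree: asking for it avoids
   Schwarz's theorem, and explicit kernels satisfy it by inspection. *)
Definition nice f := test_function f /\
  forall x, partial 0 (partial 1 f) x = partial 1 (partial 0 f) x.

Lemma nice_smooth f : nice f -> smooth f. Proof. by case=> /test_smooth. Qed.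

Lemma nice_bsupp f : nice f -> bsupp f. Proof. by case=> /test_bsupp. Qed.

Lemma nice_lin (t : R) f g : nice f -> nice g -> nice (fun x => f x + t * g x).
Proof.
move=> [tf nf] [tg ng]; have sf := test_smooth tf; have sg := test_smooth tg.
split.
  apply: bsupp_test; first exact: smooth_lin.
  have [[N hN] [M hM]] := (test_bsupp tf, test_bsupp tg).
  exists (Num.max N M) => x; rewrite ge_max => /andP[Nx Mx].
  by rewrite hN// hM// mulr0 addr0.
move=> x; rewrite (smooth_partial_lin t 1 sf sg) (smooth_partial_lin t 0 sf sg).
rewrite (smooth_partial_lin t 0 (smooth_partial 1 sf) (smooth_partial 1 sg)).
rewrite (smooth_partial_lin t 1 (smooth_partial 0 sf) (smooth_partial 0 sg)).
by rewrite nf ng.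
Qed.

Lemma nice0 : nice (fun=> 0).
Proof.
have p0 j : partial j (fun=> 0 : R) = (fun=> 0).
  by apply/funext => x; rewrite /partial derive_cst.
split; last by move=> x; rewrite !p0.
apply: bsupp_test; last by exists 0.
move=> r; have -> : foldr partial (fun=> 0) r = (fun=> 0 : R).
  by elim: r => //= j r ->; rewrite p0.
by split; [move=> x; exact: cvg_cst|move=> j x; exact: derivable_cst].
Qed.

Lemma sqi_partial_test f j : test_function f -> sqi mu (partial j f).
Proof.
move=> tf; apply: bsupp_sqi.
  exact/smooth_continuous/smooth_partial/test_smooth.
exact/bsupp_partial/test_bsupp.
Qed.

Lemma sqi_nice f j : nice f -> sqi mu (partial j f).
Proof. by case=> tf _; exact: sqi_partial_test. Qed.

(** Moving the derivative off [g] turns both sides into minus the integral of [g] times a mixed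
    second derivative of [f]. *)
Lemma nice_jacobian f g : nice f -> nice g ->
  ip mu (partial 0 f) (partial 1 g) = ip mu (partial 1 f) (partial 0 g).
Proof.
move=> nf ng; have [sf sg] := (nice_smooth nf, nice_smooth ng).
have cg := smooth_C1 sg; have bg := nice_bsupp ng.
rewrite /ip (ibp 1 (smooth_C1 (smooth_partial 0 sf)) cg bg).
rewrite (ibp 0 (smooth_C1 (smooth_partial 1 sf)) cg bg).
have -> // : partial 1 (partial 0 f) = partial 0 (partial 1 f).
by apply/funext => x; rewrite nf.2.
Qed.

End TestFunctions.

(** * The truncated radial test field *)

Section KernelTest.
Context {R : realType}.
Local Notation R2 := (R * R)%type.
Local Notation mu := (@leb2 R).
Variables (c : R2) (s rho : R).
Hypotheses (s_gt0 : 0 < s) (rho_gt0 : 0 < rho).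

(* A cut-off of (x - c) / (s + |x - c|^2), half the gradient of
   log (s + |x - c|^2), whose divergence is 2 s / (s + |x - c|^2)^2. *)
Definition kerf (j : 'I_2) : R2 -> R :=
  eval c s rho (Mul (Bmp 0) (Mul (Co j) Inv)).

(** The norm of the plane is the maximum norm, which the Euclidean one dominates;
    [(rho + 1) ^ 2 >= rho] avoids a square root. *)
Lemma quadr_ge_rho x : `|c| + rho + 1 <= `|x| -> rho <= quadr c x.
Proof.
move=> hx.
have h1 : rho + 1 <= `|x - c|.
  have := lerB_normD x (- c); rewrite normrN; lra.
have h2 : (rho + 1) ^+ 2 <= quadr c x.
  apply: (@le_trans _ _ (`|x - c| ^+ 2)).
    by rewrite ler_pXn2r ?nnegrE// addr_ge0 ?ltW.
  rewrite prod_normE/= /quadr maxEle; case: ifP => _;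
    rewrite real_normK ?num_real// ?lerDl ?lerDr sqr_ge0//.
by nra.
Qed.

Lemma nice_kerf j : nice (kerf j).
Proof.
split; last by move=> x; rewrite !partial_eval//; exact: dif_comm.
apply: bsupp_test; first exact: smooth_eval.
exists (`|c| + rho + 1) => x /quadr_ge_rho h.
rewrite /kerf/= /bump ifF ?mul0r//; apply/negbTE.
by rewrite -leNgt subr_le0 ler_pdivlMr// mul1r.
Qed.

(** [kern_main] is the cut-off times the divergence of the untruncated field; [kern_err], which is
    subtracted, comes from differentiating the cut-off. *)
Definition kern_main x := bump 0 (1 - quadr c x / rho) * (2 * s * (s + quadr c x)^-1 ^+ 2).
Definition kern_err x :=
  2 / rho * bump 2 (1 - quadr c x / rho) * (quadr c x * (s + quadr c x)^-1).

Lemma div_kerf x :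
  partial 0 (kerf 0) x + partial 1 (kerf 1) x = kern_main x - kern_err x.
Proof.
rewrite /kerf !partial_eval//= /kern_main /kern_err.
have q0 : s + quadr c x != 0 by rewrite gt_eqF// ltr_wpDr// quadr_ge0.
have e : (s + quadr c x)^-1 * quadr c x = 1 - s * (s + quadr c x)^-1.
  by field.
have qE : quadr c x = (x.1 - c.1) * (x.1 - c.1) + (x.2 - c.2) * (x.2 - c.2).
  by rewrite /quadr !expr2.
(* With reciprocals and bumps as atoms, [i * q = 1 - s * i] turns [2 * i - 2 * i * (i * q)] into
   [2 * s * i ^ 2]. *)
move: e qE; move: (quadr c x) (bump 0 _) (bump 1 _) (bump 2 _) (_^-1) => q b0 b1 b2 i e qE.
transitivity (- (2 / rho) * b2 * (q * i) + b0 * (2 * i - 2 * i * (i * q))).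
  by rewrite qE; ring.
by rewrite e; ring.
Qed.

(** The field is a radial function times [x - c]; the cut-off depends on [quadr] alone for this
    reason. *)
Lemma curl_kerf x : partial 1 (kerf 0) x = partial 0 (kerf 1) x.
Proof. by rewrite /kerf !partial_eval//=; ring. Qed.

End KernelTest.

Lemma Rint_dominated d (T : measurableType d) (R : realType)
    (mu : {measure set T -> \bar R}) (f_ : (T -> R)^nat) (f g : T -> R) :
  (forall n, measurable_fun setT (f_ n)) -> measurable_fun setT f ->
  {ae mu, forall x, f_ n x @[n --> \oo] --> f x} ->
  intg mu g -> (forall n x, `|f_ n x| <= g x) ->
  \int[mu]_x f_ n x @[n --> \oo] --> \int[mu]_x f x.
Proof.
move=> mf_ mf ff ig fg.
have fgE : {ae mu, forall x n, setT x -> (`|(f_ n x)%:E| <= (EFin \o g) x)%E}.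
  by apply: nearW => x n _; rewrite lee_fin.
have ffE : {ae mu, forall x, setT x -> (f_ n x)%:E @[n --> \oo] --> (f x)%:E}.
  apply: filterS ff => x fx _; apply: cvg_EFin => //; exact: nearW.
have [i1 _ c] := dominated_convergence measurableT
  (fun n => (measurable_EFinP _ _).2 (mf_ n)) ((measurable_EFinP _ _).2 mf)
  ffE ig fgE.
apply: fine_cvg; rewrite -RintE//; exact: c.
Qed.

(** * Removing the cut-off from the test field *)

Section KernelOrthogonality.
Context {R : realType}.
Local Notation R2 := (R * R)%type.
Local Notation mu := (@leb2 R).
Implicit Types (x c : R2) (h : R2 -> R).

(** In the plane this decay is in L2 but not in L1; times an L2 function it becomes an integrable
    majorant. *)
Definition dec c x : R := (1 + quadr c x)^-1.

Lemma quadr0E x : quadr 0 x = x.1 ^+ 2 + x.2 ^+ 2.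
Proof. by rewrite /quadr !subr0. Qed.

Lemma dec_gt0 c x : 0 < dec c x.
Proof. by rewrite invr_gt0 ltr_wpDr// quadr_ge0. Qed.

(** Peetre's inequality: recentring the decay costs a factor that depends on [c] only. *)
Lemma dec_peetre c x : 1 + quadr 0 x <= 2 * (1 + quadr 0 c) * (1 + quadr c x).
Proof.
rewrite !quadr0E /quadr.
have h (a b : R) : a ^+ 2 <= 2 * b ^+ 2 + 2 * (a - b) ^+ 2.
  by have := sqr_ge0 (a - b - b); nra.
have := h x.1 c.1; have := h x.2 c.2.
move: (sqr_ge0 c.1) (sqr_ge0 c.2) (sqr_ge0 (x.1 - c.1)) (sqr_ge0 (x.2 - c.2)).
move: (c.1 ^+ 2) (c.2 ^+ 2) ((x.1 - c.1) ^+ 2) ((x.2 - c.2) ^+ 2) (x.1 ^+ 2) (x.2 ^+ 2).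
by move=> *; nra.
Qed.

Lemma dec_le c x : dec c x <= 2 * (1 + quadr 0 c) * dec 0 x.
Proof.
rewrite /dec ler_pdivlMr ?ltr_wpDr ?quadr_ge0//.
by rewrite mulrC ler_pdivrMr ?ltr_wpDr ?quadr_ge0// dec_peetre.
Qed.

Lemma continuous_quadr c : continuous (quadr c).
Proof.
move=> x; apply: cvgD.
  apply: (@cvgM _ _ _ _ (fun x => x.1 - c.1) (fun x => x.1 - c.1));
    by apply: (@cvgB _ _ _ _ _ fst); [exact: cvg_fst|exact: cvg_cst].
apply: (@cvgM _ _ _ _ (fun x => x.2 - c.2) (fun x => x.2 - c.2));
  by apply: (@cvgB _ _ _ _ _ snd); [exact: cvg_snd|exact: cvg_cst].
Qed.

Lemma continuous_quadrV c (s : R) : 0 < s -> continuous (fun x => (s + quadr c x)^-1).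
Proof.
move=> s0 x; apply: cvgV; first by rewrite gt_eqF// ltr_wpDr// quadr_ge0.
by apply: cvgD; [exact: cvg_cst|exact: continuous_quadr].
Qed.

Lemma sqi_dec c : sqi mu (dec c).
Proof.
have md e : measurable_fun setT (dec e : plane R -> R).
  by apply: continuous_measurable_plane; exact: continuous_quadrV.
apply: (@sqi_le _ _ _ mu _ (fun x => 2 * (1 + quadr 0 c) * dec 0 x)) => //.
  apply: sqiZ; split=> //; apply: (@intg_le _ _ _ mu _ kap); last exact: intg_kap.
    exact: measurable_funX.
  move=> x; rewrite ger0_norm ?sqr_ge0// /dec /kap exprVn lef_pV2 ?posrE.
  - rewrite quadr0E; have := sqr_ge0 x.1; have := sqr_ge0 x.2; nra.
  - by rewrite exprn_gt0// ltr_wpDr// quadr_ge0.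
  - by rewrite (lt_le_trans ltr01)// kap_den_ge1.
move=> x; rewrite !ger0_norm ?dec_le ?(ltW (dec_gt0 _ _))//.
apply: mulr_ge0; last by rewrite ltW// dec_gt0.
by rewrite mulr_ge0// addr_ge0// quadr_ge0.
Qed.

Lemma kern_main_le c (s rho : R) x : 0 < s ->
  `|kern_main c s rho x| <= 2 * (1 + s) / s * dec c x.
Proof.
move=> s0; rewrite /kern_main /dec.
have q0 := quadr_ge0 c x; move: (quadr c x) q0 => q q0.
have b0 := bump_ge0 0 (1 - q / rho); have b1 := bump0_le1 (1 - q / rho).
have sq : 0 < s + q by rewrite ltr_wpDr.
have q1 : 0 < 1 + q by rewrite ltr_wpDr.
have ss := ltW s0; have qq := ltW q1.
have m0 : 0 <= 2 * s * (s + q)^-1 ^+ 2 by rewrite mulr_ge0 ?sqr_ge0// mulr_ge0.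
rewrite ger0_norm; last exact: mulr_ge0.
apply: (@le_trans _ _ (2 * s * (s + q)^-1 ^+ 2)); first by rewrite ler_piMl.
rewrite -subr_ge0.
rewrite (_ : _ - _ = 2 * ((1 + s) * (s + q) ^+ 2 - s * s * (1 + q)) /
    (s * (1 + q) * (s + q) ^+ 2)); last by field; rewrite !gt_eqF.
apply: mulr_ge0; last by rewrite invr_ge0 mulr_ge0 ?sqr_ge0// mulr_ge0.
by nra.
Qed.

(** The bump lives where [quadr c x < rho]. There [1 + quadr c x <= 2 * rho], so the crude bound
    [4 / rho] is at most [8 * dec c x], uniformly in [rho]. *)
Lemma kern_err_le c (s rho : R) x : 0 < s -> 1 <= rho ->
  `|kern_err c s rho x| <= 8 * dec c x.
Proof.
move=> s0 r1; rewrite /kern_err /dec.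
have r0 : 0 < rho by rewrite (lt_le_trans ltr01).
have q0 := quadr_ge0 c x; move: (quadr c x) q0 => q q0.
have b0 := bump_ge0 2 (1 - q / rho); have b1 := bump2_le2 (1 - q / rho).
have sq : 0 < s + q by rewrite ltr_wpDr.
have q1 : 0 < 1 + q by rewrite ltr_wpDr.
have i1 : q * (s + q)^-1 <= 1 by rewrite ler_pdivrMr// mul1r lerDr ltW.
have i0 : 0 <= q * (s + q)^-1 by rewrite mulr_ge0// invr_ge0 ltW.
have ri : 0 <= 2 / rho by rewrite divr_ge0// ltW.
have m0 : 0 <= 2 / rho * bump 2 (1 - q / rho) by exact: mulr_ge0.
have d0 : 0 <= 8 * (1 + q)^-1 by rewrite mulr_ge0// invr_ge0 ltW.
rewrite ger0_norm; last exact: mulr_ge0.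
have [qr|qr] := leP rho q.
  rewrite /bump ifF ?mulr0 ?mul0r//.
  by apply/negbTE; rewrite -leNgt subr_le0 ler_pdivlMr// mul1r.
apply: (@le_trans _ _ (2 / rho * 2 * 1)).
  by apply: ler_pM => //; rewrite ler_wpM2l.
rewrite mulr1 mulrAC ler_pdivrMr// mulrAC ler_pdivlMr//; lra.
Qed.

Lemma quadrV_le c (s : R) x : 0 < s ->
  (s + quadr c x)^-1 <= (1 + s) / s * dec c x.
Proof.
move=> s0; have q0 := quadr_ge0 c x; rewrite /dec.
move: (quadr c x) q0 => q q0.
have sq : 0 < s + q by rewrite ltr_wpDr.
have q1 : 0 < 1 + q by rewrite ltr_wpDr.
rewrite ler_pdivlMr// mulrC ler_pdivrMr// mulrAC ler_pdivlMr//; nra.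
Qed.

Lemma sqi_quadrV2 c (s : R) : 0 < s ->
  sqi mu (fun x => (s + quadr c x)^-1 ^+ 2).
Proof.
move=> s0; have cV := @continuous_quadrV c s s0.
apply: (@sqi_le _ _ _ mu _ (fun x => s^-1 * ((1 + s) / s) * dec c x)).
- apply: continuous_measurable_plane => x.
  by rewrite (_ : (fun x => _) = (fun x => (s + quadr c x)^-1 * (s + quadr c x)^-1))//;
    apply: cvgM; exact: cV.
- by apply: sqiZ; exact: sqi_dec.
- move=> x; have q0 := quadr_ge0 c x.
  have i0 : 0 <= (s + quadr c x)^-1 by rewrite invr_ge0 addr_ge0// ltW.
  have d0 := ltW (dec_gt0 c x).
  have k0 : 0 <= s^-1 by rewrite invr_ge0 ltW.
  have k1 : 0 <= (1 + s) / s by rewrite mulr_ge0// addr_ge0// ltW.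
  rewrite ger0_norm ?sqr_ge0// ger0_norm; last by apply: mulr_ge0 => //; apply: mulr_ge0.
  rewrite -mulrA expr2 ler_pM ?quadrV_le//.
  by rewrite lef_pV2 ?posrE ?lerDl// ltr_wpDr.
Qed.

(** [expR (- 1)] is [bump 0 1], the value to which the cut-off flattens out; the error carries a
    factor [1 / rho]. *)
Lemma kern_limit c (s : R) x :
  kern_main c s n.+1%:R x - kern_err c s n.+1%:R x @[n --> \oo] -->
  expR (- 1) * (2 * s) * (s + quadr c x)^-1 ^+ 2.
Proof.
have h : (n.+1%:R : R)^-1 @[n --> \oo] --> (0 : R) by exact: cvg_harmonic.
have hb k : bump k (1 - quadr c x / n.+1%:R) @[n --> \oo] --> bump k (1 : R).
  rewrite -[X in _ --> bump k X](subr0 1) -[X in 1 - X](mulr0 (quadr c x)).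
  apply: continuous_cvg; first exact: continuous_bump.
  by apply: cvgB; [exact: cvg_cst|apply: cvgM => //; exact: cvg_cst].
have -> : expR (- 1) * (2 * s) * (s + quadr c x)^-1 ^+ 2 =
    bump 0 1 * (2 * s * (s + quadr c x)^-1 ^+ 2) -
    2 * 0 * bump 2 1 * (quadr c x * (s + quadr c x)^-1).
  by rewrite /bump ltr01 expr0 !invr1; ring.
apply: cvgB; first by apply: cvgM; [exact: hb|exact: cvg_cst].
apply: cvgM; last exact: cvg_cst.
by apply: cvgM; [apply: cvgM => //; exact: cvg_cst|exact: hb].
Qed.

Section Orthogonality.
Variables h1 h2 : R2 -> R.
Hypotheses (sh1 : sqi mu h1) (sh2 : sqi mu h2).
Hypothesis orth_grad : forall phi, nice phi ->
  ip mu h1 (partial 0 phi) + ip mu h2 (partial 1 phi) = 0.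
Hypothesis orth_rot : forall phi, nice phi ->
  ip mu h1 (partial 1 phi) - ip mu h2 (partial 0 phi) = 0.

(** Test [orth_grad] with the first component of the field, [orth_rot] with the second, and add:
    [h2] meets the curl, which is 0, and [h1] the divergence. The two hypotheses are the weak
    Cauchy-Riemann equations for [h1 - i h2]. *)
Lemma orth_kernel_cutoff c (s rho : R) : 0 < s -> 0 < rho ->
  \int[mu]_x (h1 x * (kern_main c s rho x - kern_err c s rho x)) = 0.
Proof.
move=> s0 r0; have n0 := nice_kerf c s0 r0 0; have n1 := nice_kerf c s0 r0 1.
rewrite (_ : (fun x => _) = (fun x => h1 x * (partial 0 (kerf c s rho 0) x +
   partial 1 (kerf c s rho 1) x))); last first.
  by apply/funext => x; rewrite div_kerf.
rewrite -/(ip mu h1 (fun x => partial 0 _ x + partial 1 _ x)) ipDr//; last 2 first.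
- exact: sqi_nice.
- exact: sqi_nice.
have <- : ip mu h2 (partial 0 (kerf c s rho 1)) =
    ip mu h1 (partial 1 (kerf c s rho 1)).
  by apply/esym/subr0_eq/orth_rot.
have <- : partial 1 (kerf c s rho 0) = partial 0 (kerf c s rho 1).
  by apply/funext => x; exact: curl_kerf.
exact: orth_grad.
Qed.

Lemma orth_kernel c (s : R) : 0 < s ->
  \int[mu]_x (h1 x * (s + quadr c x)^-1 ^+ 2) = 0.
Proof.
(* The constants of [kern_main_le] and [kern_err_le], added. *)
move=> s0; pose C := 2 * (1 + s) / s + 8.
pose F (n : nat) x := h1 x * (kern_main c s n.+1%:R x - kern_err c s n.+1%:R x).
have mh1 := sqi_meas sh1.
have ck (f g : R2 -> R) : continuous f -> continuous g -> continuous (fun x => f x * g x).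
  by move=> cf cg x; apply: cvgM; [exact: cf|exact: cg].
have cb k (n : nat) : continuous (fun x => bump k (1 - quadr c x / n.+1%:R)).
  move=> x; apply: (@continuous_comp _ _ _ (fun x => 1 - quadr c x / n.+1%:R) (bump k)).
    apply: cvgB; first exact: cvg_cst.
    by apply: cvgM; [exact: continuous_quadr|exact: cvg_cst].
  exact: continuous_bump.
have cV := @continuous_quadrV c s s0.
have cV2 : continuous (fun x => (s + quadr c x)^-1 ^+ 2) by exact: ck.
have mF n : measurable_fun setT (F n : plane R -> R).
  have c1 : continuous (kern_main c s n.+1%:R).
    by apply: (ck); [exact: cb|apply: (ck) => // y; exact: cvg_cst].
  have c2 : continuous (kern_err c s n.+1%:R).
    apply: (ck); first by apply: (ck); [move=> y; exact: cvg_cst|exact: cb].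
    by apply: (ck) => //; exact: continuous_quadr.
  apply: measurable_funM => //; apply: continuous_measurable_plane => x.
  by apply: cvgB; [exact: c1|exact: c2].
pose K := expR (- 1) * (2 * s).
have mf : measurable_fun setT ((fun x => h1 x * (K * (s + quadr c x)^-1 ^+ 2)) : plane R -> R).
  apply: measurable_funM => //; apply: continuous_measurable_plane.
  by apply: (ck) => // y; exact: cvg_cst.
have := @Rint_dominated _ _ _ mu F _ (fun x => C * `|h1 x * dec c x|) mF mf.
have -> : (fun n => \int[mu]_x F n x) = (fun=> 0).
  by apply/funext => n; rewrite orth_kernel_cutoff// ltr0n.
move=> dct.
have : (fun=> 0 : R) @ \oo --> \int[mu]_x (h1 x * (K * (s + quadr c x)^-1 ^+ 2)).
  apply: dct.
  - apply: nearW => x; apply: cvgM; first exact: cvg_cst.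
    exact: kern_limit.
  - by apply: intgZ; apply: integrable_norm; apply: sqi_mul => //; exact: sqi_dec.
  - move=> n x; rewrite /F normrM normrM mulrCA ler_wpM2l// (gtr0_norm (dec_gt0 _ _)).
    rewrite (le_trans (ler_normB _ _))// /C mulrDl lerD//.
      exact: kern_main_le.
    by apply: kern_err_le => //; rewrite ler1n.
move=> /(cvg_unique (@Rhausdorff R) (cvg_cst 0)) /esym.
under eq_Rintegral do rewrite mulrCA.
rewrite RintZ; last by apply: sqi_mul => //; exact: sqi_quadrV2.
move=> /eqP; rewrite mulf_eq0 => /orP[|/eqP//].
by rewrite gt_eqF// !mulr_gt0// expR_gt0.
Qed.

End Orthogonality.
End KernelOrthogonality.

(** * Functions with vanishing integral over rectangles *)

Section PiSystem.
Context d (X : measurableType d) d' (T : measurableType d') (R : realType).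
Variables (mu : {measure set X -> \bar R}) (phi : X -> T).
Hypothesis mphi : measurable_fun setT phi.

(** The sets over whose preimage [f] integrates to 0 form a Dynkin system, complements being covered
    by the vanishing total integral. With [phi] a projection or the identity, one statement treats
    each coordinate and then the plane. *)
Lemma integral_preimage_eq0 (G : set (set T)) (f : X -> \bar R) :
  mu.-integrable setT f -> @measurable _ T = <<s G >> -> setI_closed G ->
  (\int[mu]_x f x = 0)%E ->
  (forall E, G E -> \int[mu]_(x in phi @^-1` E) f x = 0)%E ->
  (forall E, measurable E -> \int[mu]_(x in phi @^-1` E) f x = 0)%E.
Proof.
move=> fi GE GI fT fG E; rewrite {1}GE.
have mp S : measurable S -> measurable (phi @^-1` S).
  by move=> mS; rewrite -[X in measurable X]setTI; exact: mphi.
apply: (@dynkin_induction _ T G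
  (fun E => (\int[mu]_(x in phi @^-1` E) f x = 0)%E) GE GI) => //.
- move=> S mS fS; rewrite preimage_setC.
  have := @integral_setU _ _ _ mu (phi @^-1` S) (~` (phi @^-1` S)) f.
  rewrite setUv fT fS add0e => <- //.
  + exact: mp.
  + by apply: measurableC; exact: mp.
  + exact: measurable_int fi.
  + by apply/disj_setPS => x [].
- move=> F mF tF fF; rewrite preimage_bigcup integral_bigcup.
  + by rewrite eseries0// => i _ _; exact: fF.
  + apply/trivIsetP => i j _ _ ij; rewrite -preimage_setI.
    by move/trivIsetP : tF => -> //; rewrite preimage_set0.
  + by move=> k; exact: mp.
  + apply: integrableS fi => //; apply: bigcup_measurable => k _; exact: mp.
Qed.

End PiSystem.

Section RectanglesDetermine.
Context {R : realType}.
Local Notation R2 := (R * R)%type.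
Local Notation mu := (@leb2 R).
Implicit Types f : R2 -> \bar R.

Lemma rect_integral_eq0 f : mu.-integrable setT f ->
  (forall I J, (I = setT \/ ocitv I) -> (J = setT \/ ocitv J) ->
     \int[mu]_(x in I `*` J) f x = 0)%E ->
  {ae mu, forall x, f x = 0%E}.
Proof.
move=> fi fIJ.
have cG : setI_closed (@ocitv R) by exact: ocitvI.
have mG : @measurable _ (measurableTypeR R) = <<s @ocitv R >> by [].
have mI I : I = setT \/ ocitv I -> measurable (I : set (measurableTypeR R)).
  by move=> [->//|oI]; apply: sub_sigma_algebra.
(* One side is freed at a time; restricting the integrand absorbs the other side. *)
have s1 (A J : set (measurableTypeR R)) : (J = setT \/ ocitv J) -> measurable A ->
    (\int[mu]_(x in A `*` J) f x = 0)%E.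
  move=> hJ mA.
  have mTJ : measurable (setT `*` J : set (plane R)) by apply: measurableX => //; exact: mI.
  have key (B : set (measurableTypeR R)) : (\int[mu]_(x in B `*` J) f x =
      \int[mu]_(x in fst @^-1` B) (f \_ (setT `*` J)) x)%E.
    rewrite -integral_mkcondr; congr (integral _ _ _).
    by apply/seteqP; split => -[x y] [/=] => [|? []].
  have i1 : mu.-integrable setT (f \_ (setT `*` J)).
    by apply/(integrable_mkcond _ mTJ); apply: integrableS fi.
  rewrite key; apply: (integral_preimage_eq0 measurable_fst i1 mG cG) => //.
    by rewrite -integral_mkcond; apply: fIJ => //; left.
  by move=> I oI; rewrite -key; apply: fIJ => //; right.
have s2 (A B : set (measurableTypeR R)) : measurable A -> measurable B ->
    (\int[mu]_(x in A `*` B) f x = 0)%E.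
  move=> mA mB.
  have mAT : measurable (A `*` setT : set (plane R)) by exact: measurableX.
  have key (C : set (measurableTypeR R)) : (\int[mu]_(x in A `*` C) f x =
      \int[mu]_(x in snd @^-1` C) (f \_ (A `*` setT)) x)%E.
    rewrite -integral_mkcondr; congr (integral _ _ _).
    by apply/seteqP; split => -[x y] [/=] => [|? []].
  have i1 : mu.-integrable setT (f \_ (A `*` setT)).
    by apply/(integrable_mkcond _ mAT); apply: integrableS fi.
  rewrite key; apply: (integral_preimage_eq0 measurable_snd i1 mG cG) => //.
    by rewrite -integral_mkcond; apply: s1 => //; left.
  by move=> J oJ; rewrite -key; apply: s1 => //; right.
have s3 (E : set (plane R)) : measurable E -> (\int[mu]_(x in E) f x = 0)%E.
  pose G := [set A `*` B | A in @measurable _ (measurableTypeR R)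
                         & B in @measurable _ (measurableTypeR R)].
  have mGE : @measurable _ (plane R) = <<s G >> by exact: measurable_prod_measurableType.
  have GI : setI_closed G.
    move=> _ _ [A1 mA1 [A2 mA2 <-]] [B1 mB1 [B2 mB2 <-]].
    exists (A1 `&` B1); first exact: measurableI.
    exists (A2 `&` B2); first exact: measurableI.
    by rewrite setXI.
  apply: (integral_preimage_eq0 (@measurable_id _ (plane R) setT) fi mGE GI).
    by have := s2 setT setT measurableT measurableT; rewrite setXTT.
  by move=> _ [A mA [B mB <-]]; exact: s2.
have := @integral_ae_eq _ _ _ mu setT measurableT (cst 0%E) f fi.
move=> /(_ (measurable_cst _)) h.
have /h : forall E, E `<=` setT -> measurable E ->
    (\int[mu]_(x in E) f x = \int[mu]_(x in E) cst 0 x)%E.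
  by move=> E _ mE; rewrite s3// integral0.
by apply: filterS => x /(_ I).
Qed.

End RectanglesDetermine.

(** * Scaling and translation of Lebesgue measure *)

Section AffineChange.
Context {R : realType}.
Local Notation R2 := (R * R)%type.
Local Notation mu := (@leb2 R).
Local Notation leb := (@lebesgue_measure R).
Local Open Scope ereal_scope.

(** By uniqueness of Lebesgue measure: [n] times the push-forward under [n * (t - x)] gives
    half-open intervals their length. *)
Lemma lebesgue_affine (n x : R) (G : R -> \bar R) : (0 < n)%R ->
  measurable_fun [set: measurableTypeR R] G -> (forall t, 0 <= G t) ->
  \int[leb]_t (n%:E * G (n * (t - x))%R) = \int[leb]_u G u.
Proof.
move=> n0 mG G0.
pose phi (t : R) : measurableTypeR R := (n * (t - x))%R.
have mphi : measurable_fun setT (phi : measurableTypeR R -> measurableTypeR R).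
  apply: measurable_funM; first exact: measurable_cst.
  by apply: measurable_funB => //; exact: measurable_cst.
pose k := NngNum (ltW n0).
have E A : measurable A -> leb A = mscale k (pushforward leb phi) A.
  apply: lebesgue_measure_unique => _ [[a b]] _ <-.
  change (leb `]a, b] = n%:E * leb (phi @^-1` `]a, b])).
  rewrite (_ : phi @^-1` _ = `](a / n + x)%R, (b / n + x)%R]%classic); last first.
    apply/seteqP; split => t /=; rewrite !in_itv/= /phi.
      by rewrite -ltrBrDr -lerBlDr !(ltr_pdivrMr, ler_pdivlMr)// ![(_ * n)%R]mulrC.
    by rewrite -ltrBrDr -lerBlDr !(ltr_pdivrMr, ler_pdivlMr)// ![(_ * n)%R]mulrC.
  rewrite !lebesgue_measure_itv/= !lte_fin ltrD2r ltr_pM2r ?invr_gt0//.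
  case: ifPn => _; last by rewrite mule0.
  rewrite -!EFinB -EFinM; congr EFin; field; rewrite gt_eqF//.
rewrite [RHS](eq_measure_integral _ (fun A mA _ => E mphi A mA)) ge0_integral_mscale//.
rewrite ge0_integral_pushforward//.
rewrite preimage_setT ge0_integralZl//.
- exact: (measurableT_comp mG mphi).
- by rewrite lee_fin ltW.
Qed.

Lemma leb2_affine (n : R) (z : R2) (F : R2 -> \bar R) : (0 < n)%R ->
  measurable_fun setT (F : plane R -> \bar R) -> (forall w, 0 <= F w) ->
  \int[mu]_c ((n ^+ 2)%:E * F (n * (c.1 - z.1), n * (c.2 - z.2))%R) =
  \int[mu]_w F w.
Proof.
move=> n0 mF F0.
have mq (j : R2 -> R) (m : R) : measurable_fun setT (j : plane R -> R) ->
    measurable_fun setT ((fun c => n * (j c - m))%R : plane R -> R).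
  move=> mj; apply: measurable_funM; first exact: measurable_cst.
  by apply: measurable_funB => //; exact: measurable_cst.
rewrite fubini_tonelli1//; last 2 first.
- apply: emeasurable_funM; first exact: measurable_cst.
  apply: (measurableT_comp mF); apply/measurable_fun_pairP; split.
    exact: (mq fst z.1 measurable_fst).
  exact: (mq snd z.2 measurable_snd).
- by move=> c; rewrite mule_ge0// lee_fin sqr_ge0.
rewrite fubini_tonelli1// /fubini_F.
rewrite -(@lebesgue_affine n z.1 (fun u => \int[leb]_v F (u, v))) //; last 2 first.
- exact: measurable_fun_fubini_tonelli_F.
- by move=> u; exact: integral_ge0.
apply: eq_integral => c1 _.
rewrite -(@lebesgue_affine n z.2 (fun v => F (n * (c1 - z.1), v)%R)) //; last first.
  exact: measurableT_comp mF (pair1_measurable _).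
rewrite -ge0_integralZl//; last 3 first.
- apply: emeasurable_funM; first exact: measurable_cst.
  apply: (measurableT_comp mF); apply/measurable_fun_pairP; split.
    exact: measurable_cst.
  apply: measurable_funM; first exact: measurable_cst.
  by apply: measurable_funB => //; exact: measurable_cst.
- by move=> t _; rewrite mule_ge0// lee_fin ltW.
- by rewrite lee_fin ltW.
by apply: eq_integral => c2 _; rewrite muleA -EFinM -expr2.
Qed.

End AffineChange.

Lemma intg_prod d1 d2 (T1 : measurableType d1) (T2 : measurableType d2)
    (R : realType) (m1 : {sigma_finite_measure set T1 -> \bar R})
    (m2 : {sigma_finite_measure set T2 -> \bar R}) (a : T1 -> R) (b : T2 -> R) :
  intg m1 a -> intg m2 b -> intg (m1 \x m2)%E (fun z => a z.1 * b z.2).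
Proof.
move=> ia ib; have ma := intg_meas ia; have mb := intg_meas ib.
have mab : measurable_fun setT (fun z : T1 * T2 => a z.1 * b z.2).
  by apply: measurable_funM; [exact: measurableT_comp|exact: measurableT_comp].
apply/integrable12ltyP; first exact/measurable_EFinP.
have mna : measurable_fun setT (fun x => `|a x|%:E).
  by apply/measurable_EFinP; exact: measurableT_comp.
have mnb : measurable_fun setT (fun x => `|b x|%:E).
  by apply/measurable_EFinP; exact: measurableT_comp.
under eq_integral => x _.
  under eq_integral do rewrite /= normrM EFinM.
  rewrite ge0_integralZl//; over.
rewrite ge0_integralZr//; last exact: integral_ge0.
have /integrableP[_ fa] := ia; have /integrableP[_ fb] := ib.
rewrite lte_mul_pinfty//; first exact: integral_ge0.
by rewrite ge0_fin_numE//; exact: integral_ge0.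
Qed.

(** * An approximate identity averaged over rectangles *)

Section ApproximateIdentity.
Context {R : realType}.
Local Notation R2 := (R * R)%type.
Local Notation mu := (@leb2 R).
Local Notation leb := (@lebesgue_measure R).
Implicit Types (c z w : R2).

(* The divergence above with s = n^-2, rescaled: an approximate identity up to
   the constant factor [nu]. *)
Definition psi (n : R) c z : R := n ^+ 2 * (1 + n ^+ 2 * quadr c z)^-1 ^+ 2.

Lemma psi_ge0 n c z : 0 <= psi n c z.
Proof. by rewrite mulr_ge0 ?sqr_ge0. Qed.

Lemma psi_den n c z : 1 <= 1 + n ^+ 2 * quadr c z.
Proof. by rewrite lerDl mulr_ge0 ?sqr_ge0 ?quadr_ge0. Qed.

Lemma psi_leX n c z : psi n c z <= n ^+ 2.
Proof.
have h := psi_den n c z.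
by rewrite /psi ler_piMr ?sqr_ge0// exprVn invf_le1 ?exprn_ege1// exprn_gt0// (lt_le_trans ltr01).
Qed.

Lemma psi_quadr_le1 n c z : quadr c z * psi n c z <= 1.
Proof.
have h := psi_den n c z; rewrite /psi mulrA (mulrC (quadr c z)) exprVn.
rewrite ler_pdivrMr ?exprn_gt0 ?(lt_le_trans ltr01)// mul1r.
by move: h; rewrite lerDl; move: (_ * quadr c z) => t t0; nra.
Qed.

(** [quadr c z * psi n c z <= 1] bounds [(1 + quadr c z) * psi n c z] by [psi n c z + 1]; Peetre's
    inequality then recentres the decay at 0 with a factor free of [n]. *)
Lemma psi_decay n c z :
  psi n c z <= 2 * (1 + quadr 0 c) * dec 0 z * (psi n c z + 1).
Proof.
have p0 := psi_ge0 n c z; have p1 := psi_quadr_le1 n c z.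
have d0 : 0 < 1 + quadr 0 z by rewrite ltr_wpDr// quadr_ge0.
rewrite mulrAC /dec ler_pdivlMr//.
apply: (@le_trans _ _ (psi n c z * (2 * (1 + quadr 0 c) * (1 + quadr c z)))).
  by rewrite ler_wpM2l// dec_peetre.
have k0 : 0 <= 2 * (1 + quadr 0 c) by rewrite mulr_ge0// addr_ge0// quadr_ge0.
by rewrite mulrCA ler_wpM2l// mulrDr mulr1 mulrC [_ * psi _ _ _]mulrC lerD2l mulrC.
Qed.

Lemma psi_scale (n : R) c z : 0 < n ->
  psi n c z = n ^- 2 * (n ^- 2 + quadr c z)^-1 ^+ 2.
Proof.
move=> n0; rewrite /psi; field.
have q0 := quadr_ge0 c z.
by rewrite !gt_eqF//= ltr_wpDr// mulr_ge0// sqr_ge0.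
Qed.

Section Rectangle.
Variables (a1 b1 a2 b2 : R).

Definition chi c : R := \1_(`]a1, b1] : set R) c.1 * \1_(`]a2, b2] : set R) c.2.

Lemma chi01 c : chi c = 0 \/
  [/\ chi c = 1, a1 < c.1, c.1 <= b1, a2 < c.2 & c.2 <= b2].
Proof.
rewrite /chi !indicE !mem_setE !in_itv/=.
case: (boolP (a1 < c.1 <= b1)) => [/andP[? ?]|_]; last by left; rewrite mul0r.
by case: (boolP (a2 < c.2 <= b2)) => [/andP[? ?]|_];
  [right; rewrite mulr1|left; rewrite mulr0].
Qed.

Lemma chi_ge0 c : 0 <= chi c.
Proof. by case: (chi01 c) => [->//|[->]]. Qed.

Lemma chi_le1 c : chi c <= 1.
Proof. by case: (chi01 c) => [->//|[->]]. Qed.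

Let M := a1 ^+ 2 + b1 ^+ 2 + (a2 ^+ 2 + b2 ^+ 2).

Lemma chi_quadr c : chi c = 0 \/ (chi c = 1 /\ quadr 0 c <= M).
Proof.
case: (chi01 c) => [|[-> h1 h2 h3 h4]]; [by left|right; split=> //].
rewrite quadr0E /M.
have key (a x b : R) : a < x -> x <= b -> x ^+ 2 <= a ^+ 2 + b ^+ 2.
  by move=> ax xb; have [x0|x0] := leP 0 x; nra.
by rewrite lerD// key.
Qed.

Lemma measurable_chi : measurable_fun setT (chi : plane R -> R).
Proof. by apply: measurable_funM; apply: measurableT_comp. Qed.

Lemma intg_dec2 : intg mu (fun w => dec 0 w ^+ 2).
Proof. by have [] := @sqi_dec R 0. Qed.

Lemma M_ge0 : 0 <= M.
Proof. by rewrite !addr_ge0 ?sqr_ge0. Qed.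

Lemma intg_chi : intg mu chi.
Proof.
apply: (@intg_le _ _ _ mu _ (fun w => (1 + M) ^+ 2 * dec 0 w ^+ 2)).
- exact: measurable_chi.
- move=> w; rewrite (ger0_norm (chi_ge0 w)) -exprMn.
  case: (chi_quadr w) => [->|[-> h]]; first exact: sqr_ge0.
  have Md : 0 <= (1 + M) * dec 0 w.
    by rewrite mulr_ge0 ?(ltW (dec_gt0 _ _))// addr_ge0// M_ge0.
  rewrite -[leLHS](expr1n R 2) ler_pXn2r ?nnegrE//.
  by rewrite /dec ler_pdivlMr ?mul1r ?lerD2l// ltr_wpDr// quadr_ge0.
- apply: intgZ; exact: intg_dec2.
Qed.

Lemma measurable_psi (n : R) :
  measurable_fun setT (fun cz : plane R * plane R => psi n cz.1 cz.2).
Proof.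
rewrite (_ : (fun _ => _) = (fun t : R => n ^+ 2 * (1 + n ^+ 2 * `|t|)^-1 ^+ 2) \o
    (fun cz : plane R * plane R => quadr cz.1 cz.2)); last first.
  by apply/funext => cz /=; rewrite ger0_norm ?quadr_ge0.
apply: measurableT_comp.
  apply: continuous_measurable_fun => t.
  have c1 : {for t, continuous (fun t : R => (1 + n ^+ 2 * `|t|)^-1)}.
    apply: cvgV; first by rewrite gt_eqF// ltr_wpDr// mulr_ge0// sqr_ge0.
    apply: cvgD; first exact: cvg_cst.
    by apply: cvgM; [exact: cvg_cst|exact: norm_continuous].
  by apply: cvgM; [exact: cvg_cst|apply: cvgM].
apply: measurable_funD; apply: measurable_funX; apply: measurable_funB.
- exact: (measurableT_comp measurable_fst measurable_snd).
- exact: (measurableT_comp measurable_fst measurable_fst).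
- exact: (measurableT_comp measurable_snd measurable_snd).
- exact: (measurableT_comp measurable_snd measurable_fst).
Qed.

Lemma measurable_psi1 (n : R) z : measurable_fun setT (psi n ^~ z : plane R -> R).
Proof. exact: (measurableT_comp (measurable_psi n) (pair2_measurable z)). Qed.

Lemma intg_chi_psi (n : R) z : intg mu (fun c => chi c * psi n c z).
Proof.
apply: (@intg_le _ _ _ mu _ (fun c => n ^+ 2 * chi c)).
- by apply: measurable_funM; [exact: measurable_chi|exact: measurable_psi1].
- move=> c; rewrite ger0_norm; last by apply: mulr_ge0; [exact: chi_ge0|exact: psi_ge0].
  by rewrite mulrC ler_wpM2r ?chi_ge0 ?psi_leX.
- exact: (intgZ (n ^+ 2) intg_chi).
Qed.

(** A smoothed indicator of the rectangle as a function of [z]. The average runs over the centres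
    because orthogonality is known for each centre. *)
Definition mollif (n : R) z : R := \int[mu]_c (chi c * psi n c z).

Lemma measurable_mollif_integrand (n : R) z : measurable_fun setT
  ((fun w => chi (z.1 + w.1 / n, z.2 + w.2 / n) * dec 0 w ^+ 2) : plane R -> R).
Proof.
have mq (j : R2 -> R) (m : R) : measurable_fun setT (j : plane R -> R) ->
    measurable_fun setT ((fun w => m + j w / n) : plane R -> R).
  move=> mj; apply: measurable_funD; first exact: measurable_cst.
  by apply: measurable_funM => //; exact: measurable_cst.
apply: measurable_funM.
  apply: (measurableT_comp measurable_chi); apply/measurable_fun_pairP; split.
    exact: (mq fst z.1 measurable_fst).
  exact: (mq snd z.2 measurable_snd).
by apply: measurable_funX; exact: sqi_meas (sqi_dec 0).
Qed.

Lemma mollif_integrand_ge0 (n : R) z w :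
  0 <= chi (z.1 + w.1 / n, z.2 + w.2 / n) * dec 0 w ^+ 2.
Proof. by apply: mulr_ge0; [exact: chi_ge0|exact: sqr_ge0]. Qed.

Lemma mollif_integrand_le (n : R) z w :
  chi (z.1 + w.1 / n, z.2 + w.2 / n) * dec 0 w ^+ 2 <= dec 0 w ^+ 2.
Proof. by rewrite ler_piMl ?sqr_ge0 ?chi_le1. Qed.

Lemma mollifE (n : R) z : 0 < n ->
  mollif n z = \int[mu]_w (chi (z.1 + w.1 / n, z.2 + w.2 / n) * dec 0 w ^+ 2).
Proof.
move=> n0; congr fine; rewrite -(@leb2_affine R n z (fun w =>
  (chi (z.1 + w.1 / n, z.2 + w.2 / n) * dec 0 w ^+ 2)%:E)) //.
- apply: eq_integral => c _; rewrite -EFinM; congr EFin; rewrite mulrCA /=.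
  have e (u v : R) : v + n * (u - v) / n = u by rewrite mulrC mulKf ?gt_eqF// addrC subrK.
  rewrite !e -surjective_pairing; congr (_ * (_ * _ ^+ 2)).
  by rewrite /dec; congr (_^-1); rewrite quadr0E /quadr /=; ring.
- by apply/measurable_EFinP; exact: measurable_mollif_integrand.
- by move=> w; rewrite lee_fin mollif_integrand_ge0.
Qed.

Definition nu : R := \int[mu]_w (dec 0 w ^+ 2).

Lemma mollif_ge0 (n : R) z : 0 <= mollif n z.
Proof. by apply: Rint_ge0 => c; apply: mulr_ge0; [exact: chi_ge0|exact: psi_ge0]. Qed.

Lemma mollif_le_nu (n : R) z : 0 < n -> mollif n z <= nu.
Proof.
move=> n0; rewrite mollifE//; apply: Rint_le.
- apply: (intg_le _ _ intg_dec2); first exact: measurable_mollif_integrand.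
  by move=> w; rewrite ger0_norm ?mollif_integrand_ge0// mollif_integrand_le.
- exact: intg_dec2.
- by move=> w; exact: mollif_integrand_le.
Qed.

(** Averaging [psi_decay] over the rectangle replaces the unbounded [psi] by the mass [nu]: an L2
    majorant independent of [n]. *)
Lemma mollif_le (n : R) z : 0 < n ->
  `|mollif n z| <= 2 * (1 + M) * (nu + \int[mu]_c chi c) * dec 0 z.
Proof.
move=> n0; rewrite ger0_norm ?mollif_ge0//.
have k0 : 0 <= 2 * (1 + M) * dec 0 z.
  by rewrite mulr_ge0 ?(ltW (dec_gt0 _ _))// mulr_ge0// addr_ge0// M_ge0.
apply: (@le_trans _ _ (2 * (1 + M) * dec 0 z * (mollif n z + \int[mu]_c chi c))).
  rewrite /mollif -RintD ?intg_chi_psi ?intg_chi// -RintZ; last first.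
    by apply: intgD; [exact: intg_chi_psi|exact: intg_chi].
  apply: Rint_le; first exact: intg_chi_psi.
    by apply/intgZ/intgD; [exact: intg_chi_psi|exact: intg_chi].
  move=> c; case: (chi_quadr c) => [->|[-> cM]]; first by rewrite !mul0r addr0 mulr0.
  rewrite !mul1r; apply: le_trans (psi_decay n c z) _.
  rewrite ler_wpM2r ?addr_ge0 ?psi_ge0// ler_wpM2r ?(ltW (dec_gt0 _ _))//.
  by rewrite ler_wpM2l// lerD2l.
by rewrite [leRHS]mulrAC ler_wpM2l// lerD2r mollif_le_nu.
Qed.

(** Off its endpoints the indicator is locally constant, so the sequence is eventually constant. *)
Lemma indic_cvg (a b t u : R) : t != a -> t != b ->
  (\1_(`]a, b] : set R) (t + u / n.+1%:R) : R) @[n --> \oo] -->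
  (\1_(`]a, b] : set R) t : R).
Proof.
move=> ta tb.
have c : t + u / n.+1%:R @[n --> \oo] --> t.
  rewrite -[X in _ --> X]addr0 -[X in t + X](mulr0 u).
  apply: cvgD; first exact: cvg_cst.
  by apply: cvgM; [exact: cvg_cst|exact: cvg_harmonic].
apply: cvg_near_cst.
have near_t (P : set R) : nbhs t P -> \forall n \near \oo, P (t + u / n.+1%:R).
  by move=> nP; exact: c nP.
rewrite !indicE mem_setE in_itv/=.
have [at_|at_] : a < t \/ t < a by apply/orP; rewrite -neq_lt eq_sym.
- have [bt|bt] : t < b \/ b < t by apply/orP; rewrite -neq_lt.
  + near=> n; rewrite indicE mem_setE in_itv/= at_ (ltW bt).
    have -> : a < t + u / n.+1%:R.
      by near: n; apply: (near_t [set x | a < x]); exact: lt_nbhsr.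
    have -> // : t + u / n.+1%:R <= b.
    by apply: ltW; near: n; apply: (near_t [set x | x < b]); exact: lt_nbhsl.
  + near=> n; rewrite indicE mem_setE in_itv/= (leNgt t b) bt andbF.
    have bn : b < t + u / n.+1%:R.
      by near: n; apply: (near_t [set x | b < x]); exact: lt_nbhsr.
    by rewrite leNgt bn andbF.
- near=> n; rewrite indicE mem_setE in_itv/= (ltNge a t) (ltW at_).
  have bn : t + u / n.+1%:R < a.
    by near: n; apply: (near_t [set x | x < a]); exact: lt_nbhsl.
  by rewrite ltNge (ltW bn).
Unshelve. all: by end_near. Qed.

Lemma mollif_cvg z : z.1 != a1 -> z.1 != b1 -> z.2 != a2 -> z.2 != b2 ->
  mollif n.+1%:R z @[n --> \oo] --> chi z * nu.
Proof.
move=> h1 h2 h3 h4; rewrite /nu -RintZ; last exact: intg_dec2.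
under eq_fun do rewrite mollifE ?ltr0n//.
apply: (@Rint_dominated _ _ _ mu _ _ (fun w => dec 0 w ^+ 2)).
- by move=> n; exact: measurable_mollif_integrand.
- apply: measurable_funM; first exact: measurable_cst.
  by apply: measurable_funX; exact: sqi_meas (sqi_dec 0).
- apply: nearW => w; apply: cvgM; last exact: cvg_cst.
  by apply: cvgM; exact: indic_cvg.
- exact: intg_dec2.
- move=> n w; rewrite ger0_norm ?mollif_integrand_ge0//.
  exact: mollif_integrand_le.
Qed.

End Rectangle.
End ApproximateIdentity.

Section AlmostEverywhere.
Context d (T : measurableType d) (R : realType).
Variable mu : {measure set T -> \bar R}.
Implicit Types P Q : T -> Prop.

Lemma ae_imp P Q : (forall x, P x -> Q x) ->
  {ae mu, forall x, P x} -> {ae mu, forall x, Q x}.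
Proof. by move=> PQ; apply: filterS. Qed.

Lemma ae_and P Q : {ae mu, forall x, P x} -> {ae mu, forall x, Q x} ->
  {ae mu, forall x, P x /\ Q x}.
Proof. by move=> hP hQ; apply: filterS2 hP hQ => x ? ?; split. Qed.

End AlmostEverywhere.

Lemma sqi_chi (R : realType) (a1 b1 a2 b2 : R) : sqi (@leb2 R) (chi a1 b1 a2 b2).
Proof.
split; first exact: measurable_chi.
rewrite (_ : (fun x => _) = chi a1 b1 a2 b2); first exact: intg_chi.
by apply/funext => c; case: (chi01 a1 b1 a2 b2 c) => [->|[-> _ _ _ _]]; rewrite ?expr0n ?expr1n.
Qed.

Section SigmaFinite.
Context (R : realType).
Local Notation leb := (@lebesgue_measure R).

Lemma sigma_finite_leb2 : sigma_finite setT (@leb2 R).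
Proof.
exists (fun n : nat => `[- n%:R, n%:R] `*` `[- n%:R, n%:R]).
  apply/esym/seteqP; split => // -[x y] _.
  have : `|x| + `|y| < (Num.truncn (`|x| + `|y|)).+1%:R.
    by rewrite -truncn_lt_nat// addr_ge0.
  move=> xy; exists (Num.truncn (`|x| + `|y|)).+1 => //.
  split; rewrite /= in_itv/= -ler_norml (le_trans _ (ltW xy))//.
    by rewrite lerDl.
  by rewrite lerDr.
move=> n; split; first exact: measurableX.
have fn : (leb `[(- n%:R)%R, (n%:R : R)%R]%classic < +oo)%E.
  by rewrite lebesgue_measure_itv/=; case: ifPn => _; rewrite -?EFinB ltry.
rewrite /leb2 product_measure1E// lte_mul_pinfty//.
by rewrite ge0_fin_numE//; exact: fn.
Qed.

(** Attaches sigma-finiteness to [leb2], for Fubini on pairs made of a centre and a variable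
    point. *)
Definition leb2_sf : {sigma_finite_measure set (plane R) -> \bar R} :=
  HB.pack_for {sigma_finite_measure set (plane R) -> \bar R} (@leb2 R)
    (Measure.class ((leb \x leb)%E : {measure set (plane R) -> \bar R}))
    (@Measure_isSigmaFinite.Build _ _ _ (@leb2 R) sigma_finite_leb2).

End SigmaFinite.

(** * Vanishing of the orthogonal fields *)

Section OrthogonalVanish.
Context {R : realType}.
Local Notation R2 := (R * R)%type.
Local Notation mu := (@leb2 R).
Local Notation leb := (@lebesgue_measure R).
Implicit Types (c z w : R2).

(** Were it 0, the everywhere positive [dec 0] would vanish almost everywhere and the plane would be
    a null set. *)
Lemma nu_gt0 : 0 < (nu : R).
Proof.
have n0 : 0 <= (nu : R) by apply: Rint_ge0 => w; exact: sqr_ge0.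
rewrite lt0r n0 andbT; apply/eqP => e.
have e' : ip mu (dec 0 : R2 -> R) (dec 0) = 0.
  by rewrite -[RHS]e; apply: eq_Rintegral => x _; rewrite expr2.
have := ip_eq0 (sqi_dec (0 : R2)) e'.
move=> [N [mN N0 sN]].
have : mu setT = 0%E.
  apply/eqP; rewrite eq_le measure_ge0 andbT -N0 le_measure ?inE//.
  by apply: subset_trans sN => x _ /= dx; have := dec_gt0 0 x; rewrite dx ltxx.
rewrite /leb2 -setXTT product_measure1E//.
have lT : @lebesgue_measure R setT = +oo%E by rewrite -set_itvNyy lebesgue_measure_itv.
by rewrite [X in (X * X)%E]lT mulyy.
Qed.

Lemma ae_fst_neq (a : R) : {ae mu, forall z : R2, z.1 != a}.
Proof.
exists ([set a] `*` setT); split.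
- by apply: measurableX.
- by rewrite /leb2 product_measure1E//= lebesgue_measure_set1 mul0e.
- by move=> z /= /negP; rewrite negbK => /eqP.
Qed.

Lemma ae_snd_neq (a : R) : {ae mu, forall z : R2, z.2 != a}.
Proof.
exists (setT `*` [set a]); split.
- by apply: measurableX.
- by rewrite /leb2 product_measure1E//= lebesgue_measure_set1 mule0.
- by move=> z /= /negP; rewrite negbK => /eqP.
Qed.

Variable h : R2 -> R.
Hypothesis sh : sqi mu h.
Hypothesis orth : forall c (s : R), 0 < s ->
  \int[mu]_x (h x * (s + quadr c x)^-1 ^+ 2) = 0.

Lemma orth_psi (n : R) c : 0 < n -> \int[mu]_z (h z * psi n c z) = 0.
Proof.
move=> n0; have s0 : 0 < n ^- 2 by rewrite invr_gt0 exprn_gt0.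
under eq_Rintegral do rewrite psi_scale// mulrCA.
rewrite RintZ; last by apply: sqi_mul => //; exact: sqi_quadrV2.
by rewrite orth// mulr0.
Qed.

Section Rect.
Variables (a1 b1 a2 b2 : R).
Let chi := chi a1 b1 a2 b2.
Let mollif := mollif a1 b1 a2 b2.
Let M := a1 ^+ 2 + b1 ^+ 2 + (a2 ^+ 2 + b2 ^+ 2).

(** Exchange the integrals over the centre and over [z]; for a fixed centre [orth_psi] gives 0. *)
Lemma orth_mollif (n : R) : 0 < n -> \int[mu]_z (h z * mollif n z) = 0.
Proof.
move=> n0; pose mus := @leb2_sf R.
pose F (cz : plane R * plane R) : R := chi cz.1 * psi n cz.1 cz.2 * h cz.2.
(* From [psi_decay] and [psi <= n ^ 2]; integrability for one [n] is at stake, so [K] may grow with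
   [n]. *)
pose K := 2 * (1 + M) * (n ^+ 2 + 1).
have mF : measurable_fun setT F.
  apply: measurable_funM; last exact: (measurableT_comp (sqi_meas sh) measurable_snd).
  apply: measurable_funM; last exact: measurable_psi.
  exact: (measurableT_comp (measurable_chi _ _ _ _) measurable_fst).
have iF : intg (mus \x mus)%E F.
  apply: (@intg_le _ _ _ (mus \x mus)%E F (fun cz : plane R * plane R =>
    chi cz.1 * (K * `|h cz.2 * dec 0 cz.2|))) => //.
    move=> [c z]; have chi0 : 0 <= chi c by exact: chi_ge0.
    rewrite /F/= normrM (ger0_norm (mulr_ge0 chi0 (psi_ge0 n c z))).
    rewrite [`|h z * dec 0 z|]normrM (gtr0_norm (dec_gt0 0 z)) -mulrA.
    have [->|[-> cM]] : chi c = 0 \/ chi c = 1 /\ quadr 0 c <= M by exact: chi_quadr.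
      by rewrite !mul0r.
    rewrite !mul1r mulrC [leRHS]mulrCA ler_wpM2l//.
    apply: le_trans (psi_decay n c z) _.
    rewrite mulrAC ler_wpM2r ?(ltW (dec_gt0 _ _))// /K.
    apply: ler_pM.
    - by rewrite mulr_ge0// addr_ge0// quadr_ge0.
    - by rewrite addr_ge0// psi_ge0.
    - by rewrite ler_wpM2l// lerD2l.
    - by rewrite lerD2r psi_leX.
  apply: (@intg_prod _ _ _ _ _ mus mus chi (fun z => K * `|h z * dec 0 z|)).
    exact: intg_chi.
  by apply: intgZ; apply: integrable_norm; apply: sqi_mul => //; exact: sqi_dec.
have e1 := integral12_prod_meas1 iF; have e2 := integral21_prod_meas1 iF.
suff e : (\int[mu]_z (h z * mollif n z)%:E = 0)%E by rewrite /Rintegral e.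
transitivity (\int[(mus \x mus)%E]_z (EFin \o F) z)%E.
  rewrite -e2 /fubini_G; apply: eq_integral => z _ /=.
  transitivity (\int[mus]_c (h z * (chi c * psi n c z))%:E)%E.
    rewrite RintE; last by apply: intgZ; exact: intg_chi_psi.
    by rewrite RintZ//; exact: intg_chi_psi.
  by apply: eq_integral => c _; rewrite /F/= mulrC.
rewrite -e1 /fubini_F; apply: integral0_eq => c _ /=.
transitivity (\int[mus]_z (chi c * (h z * psi n c z))%:E)%E.
  by apply: eq_integral => z _; rewrite /F/= -mulrA (mulrC (h z)).
have ih : intg mu (fun z => h z * psi n c z).
  rewrite (_ : (fun z => _) = (fun z => n ^- 2 * (h z * (n ^- 2 + quadr c z)^-1 ^+ 2))).
    by apply: intgZ; apply: sqi_mul => //; apply: sqi_quadrV2; rewrite invr_gt0 exprn_gt0.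
  by apply/funext => z; rewrite psi_scale// mulrCA.
by rewrite RintE; [rewrite RintZ// orth_psi// mulr0|exact: intgZ].
Qed.

Lemma orth_chi : \int[mu]_z (h z * chi z) = 0.
Proof.
have mh := sqi_meas sh.
have mchi : measurable_fun setT (chi : plane R -> R) by exact: measurable_chi.
have mmol n : measurable_fun setT (mollif n : plane R -> R).
  have m : measurable_fun setT (fun cz : plane R * plane R => (chi cz.1 * psi n cz.1 cz.2)%:E).
    apply/measurable_EFinP; apply: measurable_funM; last exact: measurable_psi.
    exact: (measurableT_comp mchi measurable_fst).
  have m0 (cz : plane R * plane R) : (0 <= (chi cz.1 * psi n cz.1 cz.2)%:E)%E.
    by rewrite lee_fin; apply: mulr_ge0; [exact: chi_ge0|exact: psi_ge0].
  have mG := @measurable_fun_fubini_tonelli_G _ _ _ _ _ (@leb2_sf R) _ m m0.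
  exact: (measurableT_comp (@fine_measurable R setT measurableT) mG).
pose C := 2 * (1 + M) * (nu + \int[mu]_c chi c).
have := @Rint_dominated _ _ _ mu (fun n z => h z * mollif n.+1%:R z)
  (fun z => h z * (chi z * nu)) (fun z => C * `|h z * dec 0 z|).
have -> : (fun n => \int[mu]_z (h z * mollif n.+1%:R z)) = (fun=> 0).
  by apply/funext => n; rewrite orth_mollif// ltr0n.
move=> dct.
have : (fun=> 0 : R) @ \oo --> \int[mu]_z (h z * (chi z * nu)).
  apply: dct.
  - by move=> n; exact: measurable_funM.
  - by apply: measurable_funM => //; apply: measurable_funM => //; exact: measurable_cst.
  - have := ae_and (ae_and (ae_fst_neq a1) (ae_fst_neq b1))
      (ae_and (ae_snd_neq a2) (ae_snd_neq b2)).
    apply: ae_imp => z [[h1 h2] [h3 h4]].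
    by apply: cvgM; [exact: cvg_cst|exact: mollif_cvg].
  - by apply: intgZ; apply: integrable_norm; apply: sqi_mul => //; exact: sqi_dec.
  - move=> n z; rewrite !normrM mulrCA ler_wpM2l//.
    by rewrite (gtr0_norm (dec_gt0 _ _)); apply: mollif_le; rewrite ltr0n.
move=> /(cvg_unique (@Rhausdorff R) (cvg_cst 0)) /esym.
under eq_Rintegral do rewrite mulrA mulrC.
rewrite RintZ.
  by move=> /eqP; rewrite mulf_eq0 gt_eqF ?nu_gt0//= => /eqP.
by apply: sqi_mul => //; exact: sqi_chi.
Qed.

End Rect.

Lemma orth_zero : {ae mu, forall x, h x = 0}.
Proof.
pose A (n : nat) : set R := `](- n%:R), n%:R]%classic.
pose f n z := h z * chi (- n%:R) n%:R (- n%:R) n%:R z.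
have oA n I : (I = setT \/ ocitv I) -> exists a b, I `&` A n = `]a, b]%classic.
  move=> [->|oI]; first by exists (- n%:R), n%:R; rewrite setTI.
  have [[a b] _ <-] : ocitv (I `&` A n).
    by apply: ocitvI => //; exact: is_ocitv.
  by exists a, b.
have fn n : {ae mu, forall z, (f n z)%:E = 0%E}.
  apply: rect_integral_eq0; first by apply: sqi_mul => //; exact: sqi_chi.
  move=> I J /(oA n)[a1 [b1 E1]] /(oA n)[a2 [b2 E2]].
  transitivity (\int[mu]_z (h z * chi a1 b1 a2 b2 z)%:E)%E.
    rewrite integral_mkcond; apply: eq_integral => -[x y] _.
    rewrite patchE in_setX/= /f /chi/= -E1 -E2 !indicI/=.
    rewrite /A !indicE; case: (x \in I) => /=; last by rewrite !mul0r mulr0.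
    by case: (y \in J) => /=; rewrite ?mul1r// mul0r !mulr0.
  rewrite RintE ?orth_chi//; by apply: sqi_mul => //; exact: sqi_chi.
have /ae_foralln fa := fn.
apply: ae_imp fa => -[x y] fz.
pose n := (Num.truncn (`|x| + `|y|)).+1.
have hn : `|x| + `|y| < n%:R by rewrite /n -truncn_lt_nat// addr_ge0.
have := fz n; rewrite /f /chi/= !indicE !mem_setE !in_itv/=.
have -> : - n%:R < x <= n%:R.
  have : `|x| < n%:R by rewrite (le_lt_trans _ hn)// lerDl.
  by rewrite ltr_norml => /andP[-> /ltW].
have -> : - n%:R < y <= n%:R.
  have : `|y| < n%:R by rewrite (le_lt_trans _ hn)// lerDr.
  by rewrite ltr_norml => /andP[-> /ltW].
by rewrite !mulr1 => -[].
Qed.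

End OrthogonalVanish.

(** * Convergence in L2 *)

Section L2Convergence.
Context d (T : measurableType d) (R : realType).
Variable mu : {measure set T -> \bar R}.
Implicit Types (f g : T -> R).

(** The rate is part of the notion: [sqi_complete] delivers it, sums and multiples keep it, and
    [potential] feeds it back into [sqi_complete]. *)
Definition L2cvg (f_ : (T -> R)^nat) f :=
  exists C : R, forall n, dst2 mu (f_ n) f <= C * n.+1%:R^-1.

Lemma dst2D_le f1 f2 g1 g2 : sqi mu f1 -> sqi mu f2 -> sqi mu g1 -> sqi mu g2 ->
  dst2 mu (fun x => f1 x + f2 x) (fun x => g1 x + g2 x) <=
  2 * dst2 mu f1 g1 + 2 * dst2 mu f2 g2.
Proof.
move=> h1 h2 h3 h4; rewrite !dst2E.
have := ip_sqD_le (sqiB h1 h3) (sqiB h2 h4).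
rewrite (_ : (fun x => f1 x - g1 x + _) = (fun x => f1 x + f2 x - (g1 x + g2 x)))//.
by apply/funext => x; ring.
Qed.

Lemma dst2Z k f g : sqi mu f -> sqi mu g ->
  dst2 mu (fun x => k * f x) (fun x => k * g x) = k ^+ 2 * dst2 mu f g.
Proof.
move=> hf hg; rewrite /dst2 -RintZ; last by have [] := sqiB hf hg.
by apply: eq_Rintegral => x _; ring.
Qed.

Lemma L2cvgD (f_ g_ : (T -> R)^nat) f g : (forall n, sqi mu (f_ n)) -> (forall n, sqi mu (g_ n)) ->
  sqi mu f -> sqi mu g -> L2cvg f_ f -> L2cvg g_ g ->
  L2cvg (fun n x => f_ n x + g_ n x) (fun x => f x + g x).
Proof.
move=> hf_ hg_ hf hg [C hC] [D hD]; exists (2 * C + 2 * D) => n.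
apply: le_trans (dst2D_le (hf_ n) (hg_ n) hf hg) _.
by rewrite [leRHS]mulrDl -(mulrA 2 C) -(mulrA 2 D) lerD// ler_wpM2l.
Qed.

Lemma L2cvgZ k (f_ : (T -> R)^nat) f : (forall n, sqi mu (f_ n)) -> sqi mu f -> L2cvg f_ f ->
  L2cvg (fun n x => k * f_ n x) (fun x => k * f x).
Proof.
move=> hf_ hf [C hC]; exists (k ^+ 2 * C) => n.
by rewrite dst2Z// -mulrA ler_wpM2l// sqr_ge0.
Qed.

Lemma L2cvgB (f_ g_ : (T -> R)^nat) f g : (forall n, sqi mu (f_ n)) -> (forall n, sqi mu (g_ n)) ->
  sqi mu f -> sqi mu g -> L2cvg f_ f -> L2cvg g_ g ->
  L2cvg (fun n x => f_ n x - g_ n x) (fun x => f x - g x).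
Proof.
move=> hf_ hg_ hf hg cf cg.
have := L2cvgD hf_ (fun n => sqiZ (-1) (hg_ n)) hf (sqiZ (-1) hg) cf (L2cvgZ (-1) hg_ hg cg).
congr L2cvg; first by apply/funext => n; apply/funext => x; rewrite mulN1r.
by apply/funext => x; rewrite mulN1r.
Qed.

Lemma L2cvg_ae (f_ : (T -> R)^nat) f g : (forall n, measurable_fun setT (f_ n)) ->
  measurable_fun setT f -> measurable_fun setT g ->
  {ae mu, forall x, f x = g x} -> L2cvg f_ f -> L2cvg f_ g.
Proof.
move=> mf_ mf mg fg [C hC]; exists C => n; apply: le_trans (hC n).
rewrite le_eqVlt; apply/orP; left; apply/eqP; apply: Rint_ae_eq.
- by apply: measurable_funX; exact: measurable_funB.
- by apply: measurable_funX; exact: measurable_funB.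
- by apply: ae_imp fg => x ->.
Qed.

Lemma ip_cvg (f_ : (T -> R)^nat) f g : (forall n, sqi mu (f_ n)) -> sqi mu f -> sqi mu g ->
  L2cvg f_ f -> ip mu (f_ n) g @[n --> \oo] --> ip mu f g.
Proof.
move=> hf_ hf hg [C hC].
have h n : (ip mu (f_ n) g - ip mu f g) ^+ 2 <= C * ip mu g g * n.+1%:R^-1.
  rewrite -ipBl//; apply: le_trans (ip_CS (sqiB (hf_ n) hf) hg) _.
  by rewrite -dst2E mulrAC ler_wpM2r ?ip_ge0.
have c0 : (ip mu (f_ n) g - ip mu f g) ^+ 2 @[n --> \oo] --> (0 : R).
  apply: (@squeeze_cvgr _ _ _ _ (fun=> 0) (fun n => C * ip mu g g * n.+1%:R^-1)).
  - by apply: nearW => n; rewrite sqr_ge0 h.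
  - exact: cvg_cst.
  - rewrite -[X in _ --> X](mulr0 (C * ip mu g g)).
    by apply: cvgM; [exact: cvg_cst|exact: cvg_harmonic].
have : Num.sqrt ((ip mu (f_ n) g - ip mu f g) ^+ 2) @[n --> \oo] --> Num.sqrt (0 : R).
  by apply: continuous_cvg => //; exact: sqrt_continuous.
rewrite sqrtr0; under eq_fun do rewrite sqrtr_sqr.
by move=> /norm_cvg0P/subr_cvg0.
Qed.

Lemma ip_sq_cvg (f_ : (T -> R)^nat) f : (forall n, sqi mu (f_ n)) -> sqi mu f ->
  L2cvg f_ f -> ip mu (f_ n) (f_ n) @[n --> \oo] --> ip mu f f.
Proof.
move=> hf_ hf cf; have c1 := ip_cvg hf_ hf hf cf; case: cf => C hC.
have e n : ip mu (f_ n) (f_ n) = dst2 mu (f_ n) f + 2 * ip mu (f_ n) f - ip mu f f.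
  rewrite dst2E ipBl ?ipBr//; last exact: sqiB.
  by rewrite (ipC mu f (f_ n)); ring.
under eq_fun do rewrite e.
have l : 0 + 2 * ip mu f f - ip mu f f = ip mu f f by ring.
suff h : dst2 mu (f_ n) f + 2 * ip mu (f_ n) f - ip mu f f @[n --> \oo] -->
  0 + 2 * ip mu f f - ip mu f f by rewrite l in h.
apply: cvgB; last exact: cvg_cst.
apply: cvgD; last exact: (cvgM (cvg_cst (2 : R)) c1).
apply: (@squeeze_cvgr _ _ _ _ (fun=> 0) (fun n => C * n.+1%:R^-1)).
- by apply: nearW => n; rewrite dst2_ge0 hC.
- exact: cvg_cst.
- rewrite -[X in _ --> X](mulr0 C).
  by apply: cvgM; [exact: cvg_cst|exact: cvg_harmonic].
Qed.

Lemma ip_parallelogram f g : sqi mu f -> sqi mu g ->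
  4 * ip mu (fun x => 2^-1 * (f x + g x)) (fun x => 2^-1 * (f x + g x)) + dst2 mu f g =
  2 * ip mu f f + 2 * ip mu g g.
Proof.
move=> hf hg; have hD := sqiD hf hg; rewrite ipZl ?ipZr//; last exact: sqiZ.
have e1 := @ip_sqrD _ _ _ mu 1 f g hf hg; have e2 := @ip_sqrD _ _ _ mu (-1) f g hf hg.
rewrite dst2E.
rewrite (_ : (fun x => f x + 1 * g x) = (fun x => f x + g x)) in e1; last first.
  by apply/funext => x; rewrite mul1r.
rewrite (_ : (fun x => f x + -1 * g x) = (fun x => f x - g x)) in e2; last first.
  by apply/funext => x; rewrite mulN1r.
by rewrite e1 e2; field.
Qed.

Lemma dst2_shift h f g : dst2 mu (fun x => h x - f x) (fun x => h x - g x) = dst2 mu f g.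
Proof. by apply: eq_Rintegral => x _; ring. Qed.

End L2Convergence.

Section NiceOrthogonal.
Context {R : realType}.
Local Notation R2 := (R * R)%type.
Local Notation mu := (@leb2 R).

(** The system is invariant under [(h1, h2) |-> (h2, - h1)], so the result for the first component
    yields the second: a Liouville theorem for L2 solutions of the Cauchy-Riemann equations. *)
Lemma orth_nice_zero (h1 h2 : R2 -> R) : sqi mu h1 -> sqi mu h2 ->
  (forall phi, nice phi ->
     ip mu h1 (partial 0 phi) + ip mu h2 (partial 1 phi) = 0) ->
  (forall phi, nice phi ->
     ip mu h1 (partial 1 phi) - ip mu h2 (partial 0 phi) = 0) ->
  {ae mu, forall x, h1 x = 0} /\ {ae mu, forall x, h2 x = 0}.
Proof.
move=> s1 s2 o1 o2; split.
  by apply: (orth_zero s1) => c s; exact: orth_kernel o1 o2 c s.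
have s1' := sqiZ (-1) s1.
have o1' phi : nice phi -> ip mu h2 (partial 0 phi) +
    ip mu (fun x => -1 * h1 x) (partial 1 phi) = 0.
  move=> nphi; rewrite ipZl//; last exact: sqi_nice.
  by rewrite mulN1r -(subr0_eq (o2 _ nphi)) subrr.
have o2' phi : nice phi -> ip mu h2 (partial 1 phi) -
    ip mu (fun x => -1 * h1 x) (partial 0 phi) = 0.
  move=> nphi; rewrite ipZl//; last exact: sqi_nice.
  by rewrite mulN1r opprK addrC o1.
by apply: (orth_zero s2) => c s; exact: (orth_kernel s2 o1' o2').
Qed.

End NiceOrthogonal.

(** * Conformal and anticonformal parts of test gradients *)

Section Beurling.
Context {R : realType}.
Local Notation R2 := (R * R)%type.
Local Notation mu := (@leb2 R).
Implicit Types f g : R2 -> R.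

(* Real and imaginary parts of the derivatives of f + i g with respect to z
   and to the conjugate of z. *)
Definition dz1 f g x : R := 2^-1 * (partial 0 f x + partial 1 g x).
Definition dz2 f g x : R := 2^-1 * (partial 0 g x - partial 1 f x).
Definition db1 f g x : R := 2^-1 * (partial 0 f x - partial 1 g x).
Definition db2 f g x : R := 2^-1 * (partial 1 f x + partial 0 g x).

Definition lin (t : R) f g x : R := f x + t * g x.

(** What the four operators share, so that the Hilbert-space computations are done once. *)
Definition dlinear (D : (R2 -> R) -> (R2 -> R) -> R2 -> R) :=
  (forall f g, nice f -> nice g -> sqi mu (D f g)) /\
  forall t f g f' g', nice f -> nice g -> nice f' -> nice g' ->
    D (lin t f f') (lin t g g') = lin t (D f g) (D f' g').

Lemma dlinearP : [/\ dlinear dz1, dlinear dz2, dlinear db1 & dlinear db2].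
Proof.
have pl (t : R) f g j : nice f -> nice g ->
    partial j (lin t f g) = lin t (partial j f) (partial j g).
  by move=> nf ng; rewrite /lin smooth_partial_lin//; exact: nice_smooth.
split; split=> *.
- by apply: sqiZ; apply: sqiD; exact: sqi_nice.
- by rewrite /dz1 !pl//; apply/funext => x; rewrite /lin; ring.
- by apply: sqiZ; apply: sqiB; exact: sqi_nice.
- by rewrite /dz2 !pl//; apply/funext => x; rewrite /lin; ring.
- by apply: sqiZ; apply: sqiB; exact: sqi_nice.
- by rewrite /db1 !pl//; apply/funext => x; rewrite /lin; ring.
- by apply: sqiZ; apply: sqiD; exact: sqi_nice.
- by rewrite /db2 !pl//; apply/funext => x; rewrite /lin; ring.
Qed.

Lemma ip_half f g : sqi mu f -> sqi mu g ->
  ip mu (fun x => 2^-1 * (f x + g x)) (fun x => 2^-1 * (f x + g x)) =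
    4^-1 * (ip mu f f + 2 * ip mu f g + ip mu g g) /\
  ip mu (fun x => 2^-1 * (f x - g x)) (fun x => 2^-1 * (f x - g x)) =
    4^-1 * (ip mu f f - 2 * ip mu f g + ip mu g g).
Proof.
move=> hf hg; have hD := sqiD hf hg; have hB := sqiB hf hg.
have hD2 := sqiZ 2^-1 hD; have hB2 := sqiZ 2^-1 hB.
have e1 := @ip_sqrD _ _ _ mu 1 f g hf hg; have e2 := @ip_sqrD _ _ _ mu (-1) f g hf hg.
rewrite (_ : (fun x => f x + 1 * g x) = (fun x => f x + g x)) in e1; last first.
  by apply/funext => x; rewrite mul1r.
rewrite (_ : (fun x => f x + -1 * g x) = (fun x => f x - g x)) in e2; last first.
  by apply/funext => x; rewrite mulN1r.
by split; rewrite ipZl// ipZr// ?e1 ?e2; field.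
Qed.

(** Pointwise the two sums of squares differ by the Jacobian of [(f, g)]. *)
Lemma beurling_isometry f g : nice f -> nice g ->
  ip mu (dz1 f g) (dz1 f g) + ip mu (dz2 f g) (dz2 f g) =
  ip mu (db1 f g) (db1 f g) + ip mu (db2 f g) (db2 f g).
Proof.
move=> nf ng; have J := nice_jacobian nf ng.
have s0f := sqi_nice 0 nf; have s1f := sqi_nice 1 nf.
have s0g := sqi_nice 0 ng; have s1g := sqi_nice 1 ng.
have [e1 e2] := ip_half s0f s1g; have [_ e3] := ip_half s0g s1f.
have [e4 _] := ip_half s1f s0g.
have h1 : ip mu (dz1 f g) (dz1 f g) = _ := e1.
have h2 : ip mu (db1 f g) (db1 f g) = _ := e2.
have h3 : ip mu (dz2 f g) (dz2 f g) = _ := e3.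
have h4 : ip mu (db2 f g) (db2 f g) = _ := e4.
have alg (x1 x2 x3 x4 aa dd bb cc ad bc bc' : R) :
    x1 = 4^-1 * (aa + 2 * ad + dd) -> x2 = 4^-1 * (aa - 2 * ad + dd) ->
    x3 = 4^-1 * (cc - 2 * bc' + bb) -> x4 = 4^-1 * (bb + 2 * bc + cc) ->
    ad = bc -> bc' = bc -> x1 + x3 = x2 + x4.
  by move=> -> -> -> -> -> ->; ring.
exact: alg h1 h2 h3 h4 J (ipC mu _ _).
Qed.

(** [minimizing_sequence] works over a type with total operations, hence pairs packed with proofs;
    midpoints, differences and shifts all come from [lin_pair]. *)
Definition niceP := {fg : (R2 -> R) * (R2 -> R) | nice fg.1 /\ nice fg.2}.

Definition lin_pair (t : R) (u v : niceP) : niceP :=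
  exist _ (lin t (sval u).1 (sval v).1, lin t (sval u).2 (sval v).2)
    (conj (nice_lin t (proj1 (svalP u)) (proj1 (svalP v)))
          (nice_lin t (proj2 (svalP u)) (proj2 (svalP v)))).

Definition zero_pair : niceP := exist _ (fun=> 0, fun=> 0) (conj nice0 nice0).

Definition mid_pair (u v : niceP) : niceP :=
  lin_pair 2^-1 zero_pair (lin_pair 1 u v).

Definition app (D : (R2 -> R) -> (R2 -> R) -> R2 -> R) (u : niceP) : R2 -> R :=
  D (sval u).1 (sval u).2.

Lemma sqi_app D u : dlinear D -> sqi mu (app D u).
Proof. by move=> [h _]; case: (svalP u) => *; exact: h. Qed.

Lemma app_lin D t u v : dlinear D -> app D (lin_pair t u v) = lin t (app D u) (app D v).
Proof. by move=> [_ h]; case: (svalP u) => *; case: (svalP v) => *; exact: h. Qed.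

Lemma app0 D : dlinear D -> app D zero_pair = fun=> 0.
Proof.
move=> hD; have := app_lin (-1) zero_pair zero_pair hD.
have -> : app D (lin_pair (-1) zero_pair zero_pair) = app D zero_pair.
  by rewrite /app /=; congr D; apply/funext => x; rewrite /lin mulr0 addr0.
by move=> ->; apply/funext => x; rewrite /lin mulN1r subrr.
Qed.

Lemma app_mid D u v : dlinear D ->
  app D (mid_pair u v) = fun x => 2^-1 * (app D u x + app D v x).
Proof.
move=> hD; rewrite /mid_pair !app_lin// app0//.
by apply/funext => x; rewrite /lin add0r mul1r.
Qed.

Lemma beurling_isometry_dst u v :
  dst2 mu (app dz1 u) (app dz1 v) + dst2 mu (app dz2 u) (app dz2 v) =
  dst2 mu (app db1 u) (app db1 v) + dst2 mu (app db2 u) (app db2 v).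
Proof.
have [d1 d2 d3 d4] := dlinearP; pose w := lin_pair (-1) u v.
have [n1 n2] := svalP w; have := beurling_isometry n1 n2.
have key D : dlinear D -> ip mu (D (sval w).1 (sval w).2) (D (sval w).1 (sval w).2) =
    dst2 mu (app D u) (app D v).
  move=> hD; rewrite -/(app D w) /w app_lin// dst2E.
  by rewrite (_ : lin _ _ _ = fun x => app D u x - app D v x)//;
    apply/funext => x; rewrite /lin mulN1r.
by rewrite !key.
Qed.

Section Approximation.
Variables p q : R2 -> R.
Hypotheses (sp : sqi mu p) (sq : sqi mu q).

Let res D r u x := r x - app D u x.
Let en u := ip mu (res dz1 p u) (res dz1 p u) + ip mu (res dz2 q u) (res dz2 q u).
Let dd u v := dst2 mu (app dz1 u) (app dz1 v) + dst2 mu (app dz2 u) (app dz2 v).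
(** The minus sign arises because a shift of [u] by [t v] subtracts from the residual. *)
Let bb u v := - (ip mu (res dz1 p u) (app dz1 v) + ip mu (res dz2 q u) (app dz2 v)).
Let nn v := ip mu (app dz1 v) (app dz1 v) + ip mu (app dz2 v) (app dz2 v).

Let sqi_res D r u : dlinear D -> sqi mu r -> sqi mu (res D r u).
Proof. by move=> hD hr; apply: sqiB => //; exact: sqi_app. Qed.

Let res_parallelogram F r u v : dlinear F -> sqi mu r ->
  4 * ip mu (res F r (mid_pair u v)) (res F r (mid_pair u v)) +
    dst2 mu (app F u) (app F v) =
  2 * ip mu (res F r u) (res F r u) + 2 * ip mu (res F r v) (res F r v).
Proof.
move=> hF hr; rewrite -ip_parallelogram; [|exact: sqi_res|exact: sqi_res].
rewrite /res dst2_shift app_mid//.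
rewrite (_ : (fun x => r x - _) = (fun x => 2^-1 * (r x - app F u x + (r x - app F v x))))//.
by apply/funext => x; field.
Qed.

Let res_shift F r t u v : dlinear F -> sqi mu r ->
  ip mu (res F r (lin_pair t u v)) (res F r (lin_pair t u v)) =
  ip mu (res F r u) (res F r u) + 2 * t * - ip mu (res F r u) (app F v) +
  t ^+ 2 * ip mu (app F v) (app F v).
Proof.
move=> hF hr; rewrite mulrN -mulNr -mulrN -[t ^+ 2]sqrrN -ip_sqrD; last 2 first.
- exact: sqi_res.
- exact: sqi_app.
rewrite /res app_lin// (_ : (fun x => r x - lin _ _ _ x) =
  (fun x => r x - app F u x + - t * app F v x))//.
by apply/funext => x; rewrite /lin; ring.
Qed.

Let approximating : exists s : nat -> niceP,
  (forall k l, dd (s k) (s l) <= 2 * (k.+1%:R^-1 + l.+1%:R^-1)) /\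
  (forall k j, bb (s k) j ^+ 2 <= k.+1%:R^-1 * nn j).
Proof.
have [d1 d2 d3 d4] := dlinearP.
apply: (@minimizing_sequence _ _ zero_pair mid_pair lin_pair en nn dd bb).
- by move=> u; rewrite addr_ge0// ip_ge0.
- by move=> u; rewrite addr_ge0// ip_ge0.
- move=> u v.
  have alg (e1 e2 k1 k2 u1 u2 v1 v2 : R) : 4 * e1 + k1 = 2 * u1 + 2 * v1 ->
      4 * e2 + k2 = 2 * u2 + 2 * v2 ->
      4 * (e1 + e2) + (k1 + k2) = 2 * (u1 + u2) + 2 * (v1 + v2) by lra.
  have h1 := res_parallelogram u v d1 sp; have h2 := res_parallelogram u v d2 sq.
  exact: alg h1 h2.
- move=> t u v.
  have h1 := res_shift t u v d1 sp; have h2 := res_shift t u v d2 sq.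
  have alg (e1 e2 k1 k2 u1 u2 v1 v2 : R) : e1 = u1 + 2 * t * - k1 + t ^+ 2 * v1 ->
      e2 = u2 + 2 * t * - k2 + t ^+ 2 * v2 ->
      e1 + e2 = u1 + u2 + 2 * t * - (k1 + k2) + t ^+ 2 * (v1 + v2).
    by move=> -> ->; ring.
  exact: alg h1 h2.
Qed.

Let limit_orth (s : nat -> niceP) P Q :
  (forall k j, bb (s k) j ^+ 2 <= k.+1%:R^-1 * nn j) ->
  sqi mu P -> sqi mu Q ->
  L2cvg mu (fun k => app dz1 (s k)) P -> L2cvg mu (fun k => app dz2 (s k)) Q ->
  forall v, ip mu (fun x => p x - P x) (app dz1 v) +
    ip mu (fun x => q x - Q x) (app dz2 v) = 0.
Proof.
move=> sb sP sQ [C1 cP] [C2 cQ] v; have [d1 d2 _ _] := dlinearP.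
have r1 : L2cvg mu (fun k => res dz1 p (s k)) (fun x => p x - P x).
  by exists C1 => k; rewrite dst2_shift.
have r2 : L2cvg mu (fun k => res dz2 q (s k)) (fun x => q x - Q x).
  by exists C2 => k; rewrite dst2_shift.
have i1 := ip_cvg (fun k => sqi_res (s k) d1 sp) (sqiB sp sP) (sqi_app v d1) r1.
have i2 := ip_cvg (fun k => sqi_res (s k) d2 sq) (sqiB sq sQ) (sqi_app v d2) r2.
pose X k := ip mu (res dz1 p (s k)) (app dz1 v) + ip mu (res dz2 q (s k)) (app dz2 v).
set L := _ + _.
have i : X @ \oo --> L by apply: cvgD; [exact: i1|exact: i2].
have ii : (fun k => X k * X k) @ \oo --> L * L by apply: cvgM; exact: i.
have z : (fun k => X k * X k) @ \oo --> (0 : R).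
  apply: (@squeeze_cvgr _ _ _ _ (fun=> 0) (fun k => k.+1%:R^-1 * nn v)).
  - apply: nearW => k; rewrite -expr2 sqr_ge0 /=.
    by have := sb k v; rewrite /bb sqrrN.
  - exact: cvg_cst.
  - by rewrite -[X in _ --> X](mul0r (nn v)); apply: cvgM; [exact: cvg_harmonic|exact: cvg_cst].
have : L * L = 0 by apply: (cvg_unique (@Rhausdorff R) ii z).
by move/eqP; rewrite mulf_eq0 orbb => /eqP.
Qed.

Let limit_eq (s : nat -> niceP) P Q :
  (forall k j, bb (s k) j ^+ 2 <= k.+1%:R^-1 * nn j) ->
  sqi mu P -> sqi mu Q ->
  L2cvg mu (fun k => app dz1 (s k)) P -> L2cvg mu (fun k => app dz2 (s k)) Q ->
  {ae mu, forall x, P x = p x} /\ {ae mu, forall x, Q x = q x}.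
Proof.
move=> sb sP sQ cP cQ; have o := limit_orth sb sP sQ cP cQ.
have s1 := sqiB sp sP; have s2 := sqiB sq sQ.
have p0 j : partial j (fun=> 0 : R) = (fun=> 0) :> (R2 -> R).
  by apply/funext => x; rewrite /partial derive_cst.
have half0 (x y : R) : 2^-1 * x + 2^-1 * y = 0 -> x + y = 0.
  by rewrite -mulrDr => /eqP; rewrite mulf_eq0 invr_eq0 pnatr_eq0/= => /eqP.
have s2N := sqiZ (-1) s2.
(* The pairs [(phi, 0)] and [(0, phi)] yield the two equations up to a factor 1/2; the sign on
   [q - Q] is that of [partial 1 f] in [dz2]. *)
have [||h1 h2] := @orth_nice_zero _ (fun x => p x - P x) (fun x => -1 * (q x - Q x)) s1 s2N.
- move=> phi nphi; have := o (exist _ (phi, fun=> 0) (conj nphi nice0)).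
  rewrite (_ : app dz1 _ = fun x => 2^-1 * partial 0 phi x); last first.
    by apply/funext => x; rewrite /app /dz1 /= p0 addr0.
  rewrite (_ : app dz2 _ = fun x => 2^-1 * (-1 * partial 1 phi x)); last first.
    by apply/funext => x; rewrite /app /dz2 /= p0 sub0r mulN1r.
  have t0 := sqi_nice 0 nphi; have t1 := sqi_nice 1 nphi; have t1N := sqiZ (-1) t1.
  rewrite (ipZr _ s1 t0) (ipZr _ s2 t1N) => /half0.
  by rewrite (ipZr _ s2 t1) (ipZl _ s2 t1).
- move=> phi nphi; have := o (exist _ (fun=> 0, phi) (conj nice0 nphi)).
  rewrite (_ : app dz1 _ = fun x => 2^-1 * partial 1 phi x); last first.
    by apply/funext => x; rewrite /app /dz1 /= p0 add0r.
  rewrite (_ : app dz2 _ = fun x => 2^-1 * partial 0 phi x); last first.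
    by apply/funext => x; rewrite /app /dz2 /= p0 subr0.
  have t0 := sqi_nice 0 nphi; have t1 := sqi_nice 1 nphi.
  rewrite (ipZr _ s1 t1) (ipZr _ s2 t0) => /half0.
  by rewrite (ipZl _ s2 t0) mulN1r opprK.
split; first by apply: ae_imp h1 => x /eqP; rewrite subr_eq0 => /eqP.
by apply: ae_imp h2 => x /eqP; rewrite mulf_eq0 oppr_eq0 oner_eq0/= subr_eq0 => /eqP.
Qed.

Lemma beurling : exists (f g : nat -> R2 -> R) (a b : R2 -> R),
  [/\ (forall k, nice (f k)) /\ (forall k, nice (g k)),
      sqi mu a /\ sqi mu b,
      ip mu p p + ip mu q q = ip mu a a + ip mu b b,
      L2cvg mu (fun k => dz1 (f k) (g k)) p /\ L2cvg mu (fun k => dz2 (f k) (g k)) q &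
      L2cvg mu (fun k => db1 (f k) (g k)) a /\ L2cvg mu (fun k => db2 (f k) (g k)) b].
Proof.
have [d1 d2 d3 d4] := dlinearP.
have [s [sD sb]] := approximating.
have c1 k l : dst2 mu (app dz1 (s k)) (app dz1 (s l)) <= 2 * (k.+1%:R^-1 + l.+1%:R^-1).
  by apply: le_trans (sD k l); rewrite lerDl dst2_ge0.
have c2 k l : dst2 mu (app dz2 (s k)) (app dz2 (s l)) <= 2 * (k.+1%:R^-1 + l.+1%:R^-1).
  by apply: le_trans (sD k l); rewrite lerDr dst2_ge0.
(* By the isometry [dd] is also the squared distance of the anticonformal parts, which are thus
   Cauchy at the same rate. *)
have c3 k l : dst2 mu (app db1 (s k)) (app db1 (s l)) <= 2 * (k.+1%:R^-1 + l.+1%:R^-1).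
  by apply: le_trans (sD k l); rewrite /dd beurling_isometry_dst lerDl dst2_ge0.
have c4 k l : dst2 mu (app db2 (s k)) (app db2 (s l)) <= 2 * (k.+1%:R^-1 + l.+1%:R^-1).
  by apply: le_trans (sD k l); rewrite /dd beurling_isometry_dst lerDr dst2_ge0.
have [P sP hP] := sqi_complete (fun k => sqi_app (s k) d1) c1.
have [Q sQ hQ] := sqi_complete (fun k => sqi_app (s k) d2) c2.
have [a sa ha] := sqi_complete (fun k => sqi_app (s k) d3) c3.
have [b sb' hb] := sqi_complete (fun k => sqi_app (s k) d4) c4.
have lP : L2cvg mu (fun k => app dz1 (s k)) P by exists 2.
have lQ : L2cvg mu (fun k => app dz2 (s k)) Q by exists 2.
have la : L2cvg mu (fun k => app db1 (s k)) a by exists 2.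
have lb : L2cvg mu (fun k => app db2 (s k)) b by exists 2.
have [Pp Qq] := limit_eq sb sP sQ lP lQ.
have mD F k : dlinear F -> measurable_fun setT (app F (s k) : plane R -> R).
  by move=> hF; exact: sqi_meas (sqi_app _ hF).
have lp : L2cvg mu (fun k => app dz1 (s k)) p.
  exact: (L2cvg_ae (fun k => mD dz1 k d1) (sqi_meas sP) (sqi_meas sp) Pp lP).
have lq : L2cvg mu (fun k => app dz2 (s k)) q.
  exact: (L2cvg_ae (fun k => mD dz2 k d2) (sqi_meas sQ) (sqi_meas sq) Qq lQ).
exists (fun k => (sval (s k)).1), (fun k => (sval (s k)).2), a, b.
split; [by split=> k; case: (svalP (s k))|by split| |by split|by split].
pose X F k := ip mu (app F (s k)) (app F (s k)).
have i1 : (fun k => X dz1 k + X dz2 k) @ \oo --> ip mu p p + ip mu q q.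
  apply: cvgD; first exact: (ip_sq_cvg (fun k => sqi_app (s k) d1) sp lp).
  exact: (ip_sq_cvg (fun k => sqi_app (s k) d2) sq lq).
have i2 : (fun k => X db1 k + X db2 k) @ \oo --> ip mu a a + ip mu b b.
  apply: cvgD; first exact: (ip_sq_cvg (fun k => sqi_app (s k) d3) sa la).
  exact: (ip_sq_cvg (fun k => sqi_app (s k) d4) sb' lb).
apply: (cvg_unique (@Rhausdorff R) i1).
rewrite (_ : (fun k => X dz1 k + X dz2 k) = (fun k => X db1 k + X db2 k))//.
apply/funext => k; have [n1 n2] := svalP (s k).
exact: beurling_isometry n1 n2.
Qed.

End Approximation.
End Beurling.

(** * The isometry for curl-free L2 fields *)

Section GradientIsometry.
Context {R : realType}.
Local Notation R2 := (R * R)%type.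
Local Notation mu := (@leb2 R).
Implicit Types f g p q a b h : R2 -> R.

Lemma beurling_gradient p q : sqi mu p -> sqi mu q ->
  exists (f g : nat -> R2 -> R) (a b : R2 -> R),
  [/\ (forall k, nice (f k)) /\ (forall k, nice (g k)),
      sqi mu a /\ sqi mu b,
      ip mu p p + ip mu q q = ip mu a a + ip mu b b,
      L2cvg mu (fun k => partial 0 (f k)) (fun x => p x + a x) /\
      L2cvg mu (fun k => partial 1 (f k)) (fun x => b x - q x) &
      L2cvg mu (fun k => partial 0 (g k)) (fun x => b x + q x) /\
      L2cvg mu (fun k => partial 1 (g k)) (fun x => p x - a x)].
Proof.
move=> sp sq; have [f [g [a [b [[nf ng] [sa sb] e [cp cq] [ca cb]]]]]] := beurling sp sq.
have [[d1 _] [d2 _] [d3 _] [d4 _]] := @dlinearP R.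
have s1 k := d1 _ _ (nf k) (ng k); have s2 k := d2 _ _ (nf k) (ng k).
have s3 k := d3 _ _ (nf k) (ng k); have s4 k := d4 _ _ (nf k) (ng k).
have half (x y : R) : 2^-1 * (x + y) + 2^-1 * (x - y) = x by field.
have half' (x y : R) : 2^-1 * (x + y) - 2^-1 * (y - x) = x by field.
have half2 (x y : R) : 2^-1 * (x + y) + 2^-1 * (y - x) = y by field.
have half3 (x y : R) : 2^-1 * (x + y) - 2^-1 * (x - y) = y by field.
have e1 : (fun k => partial 0 (f k)) = (fun k x => dz1 (f k) (g k) x + db1 (f k) (g k) x).
  by apply/funext => k; apply/funext => x; rewrite half.
have e2 : (fun k => partial 1 (f k)) = (fun k x => db2 (f k) (g k) x - dz2 (f k) (g k) x).
  by apply/funext => k; apply/funext => x; rewrite half'.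
have e3 : (fun k => partial 0 (g k)) = (fun k x => db2 (f k) (g k) x + dz2 (f k) (g k) x).
  by apply/funext => k; apply/funext => x; rewrite half2.
have e4 : (fun k => partial 1 (g k)) = (fun k x => dz1 (f k) (g k) x - db1 (f k) (g k) x).
  by apply/funext => k; apply/funext => x; rewrite half3.
exists f, g, a, b; rewrite e1 e2 e3 e4; split; [by split|by split|exact: e|split|split].
- exact: L2cvgD s1 s3 sp sa cp ca.
- exact: L2cvgB s4 s2 sb sq cb cq.
- exact: L2cvgD s4 s2 sb sq cb cq.
- exact: L2cvgB s1 s3 sp sa cp ca.
Qed.

Definition curl_free (h0 h1 : R2 -> R) := forall phi, nice phi ->
  ip mu h0 (partial 1 phi) = ip mu h1 (partial 0 phi).

Lemma curl_free_limit (f : nat -> R2 -> R) h0 h1 : (forall k, nice (f k)) ->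
  sqi mu h0 -> sqi mu h1 -> L2cvg mu (fun k => partial 0 (f k)) h0 ->
  L2cvg mu (fun k => partial 1 (f k)) h1 -> curl_free h0 h1.
Proof.
move=> nf s0 s1 c0 c1 phi nphi.
have i0 := ip_cvg (fun k => sqi_nice 0 (nf k)) s0 (sqi_nice 1 nphi) c0.
have i1 := ip_cvg (fun k => sqi_nice 1 (nf k)) s1 (sqi_nice 0 nphi) c1.
have e : (fun k => ip mu (partial 0 (f k)) (partial 1 phi)) =
    (fun k => ip mu (partial 1 (f k)) (partial 0 phi)).
  by apply/funext => k; exact: (nice_jacobian (nf k) nphi).
rewrite e in i0; exact: (cvg_unique (@Rhausdorff R) i0 i1).
Qed.

Lemma gradient_isometry p q a b : sqi mu p -> sqi mu q -> sqi mu a -> sqi mu b ->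
  curl_free (fun x => p x + a x) (fun x => b x - q x) ->
  curl_free (fun x => b x + q x) (fun x => p x - a x) ->
  ip mu p p + ip mu q q = ip mu a a + ip mu b b.
Proof.
move=> sp sq sa sb cf cg.
have [f [g [a' [b' [[nf ng] [sa' sb'] -> [c1 c2] [c3 c4]]]]]] := beurling_gradient sp sq.
have cf' := curl_free_limit nf (sqiD sp sa') (sqiB sb' sq) c1 c2.
have cg' := curl_free_limit ng (sqiD sb' sq) (sqiB sp sa') c3 c4.
(* Subtraction cancels [p] and [q]: for the difference of the two choices, the first row leaves the
   rotated equation of [orth_nice_zero] and the second row the gradient equation. *)
have alg1 (xp xa xb xq xa' xb' : R) : xp + xa = xb - xq -> xp + xa' = xb' - xq ->
  xa - xa' - (xb - xb') = 0 by lra.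
have alg2 (xb xq xp xa xb' xa' : R) : xb + xq = xp - xa -> xb' + xq = xp - xa' ->
  xa - xa' + (xb - xb') = 0 by lra.
have [||h1 h2] := @orth_nice_zero _ (fun x => a x - a' x) (fun x => b x - b' x)
  (sqiB sa sa') (sqiB sb sb').
- move=> phi nphi; have t0 := sqi_nice 0 nphi; have t1 := sqi_nice 1 nphi.
  have := cg phi nphi; have := cg' phi nphi.
  rewrite (ipDl sb sq t1) (ipBl sp sa t0) (ipDl sb' sq t1) (ipBl sp sa' t0).
  rewrite (ipBl sa sa' t0) (ipBl sb sb' t1) => e' e; exact: alg2 e e'.
- move=> phi nphi; have t0 := sqi_nice 0 nphi; have t1 := sqi_nice 1 nphi.
  have := cf phi nphi; have := cf' phi nphi.
  rewrite (ipDl sp sa t1) (ipBl sb sq t0) (ipDl sp sa' t1) (ipBl sb' sq t0).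
  rewrite (ipBl sa sa' t1) (ipBl sb sb' t0) => e' e; exact: alg1 e e'.
have ma := sqi_meas sa; have mb := sqi_meas sb.
have ma' := sqi_meas sa'; have mb' := sqi_meas sb'.
congr (_ + _); apply: Rint_ae_eq; try exact: measurable_funM.
  by apply: ae_imp h1 => x /subr0_eq ->.
by apply: ae_imp h2 => x /subr0_eq ->.
Qed.

End GradientIsometry.

(** * Estimates along lines *)

Section OneDimensional.
Context {R : realType}.
Local Notation leb := (@lebesgue_measure R).
Implicit Types (F g : R -> R) (x s t : R).

(** An indicator factor, rather than a smaller domain, keeps every integral over the whole line,
    where [sqi] and [ip] live. *)
Definition ind s x : R -> R := \1_(`[s, x] : set R).

Lemma ind_le1 s x t : ind s x t <= 1.
Proof. by rewrite /ind indicE lern1 leq_b1. Qed.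

Lemma ind_sqr s x t : ind s x t ^+ 2 = ind s x t.
Proof. by rewrite /ind indicE -natrX; case: (_ \in _). Qed.

Lemma ind_idem s x t : ind s x t * ind s x t = ind s x t.
Proof. by rewrite -expr2 ind_sqr. Qed.

Lemma intg_ind_mul s x g : continuous g -> intg leb (fun t => ind s x t * g t).
Proof.
move=> cg.
have h : leb.-integrable `[s, x] (EFin \o g).
  apply: continuous_compact_integrable; first exact: segment_compact.
  exact: continuous_subspaceT.
have h2 : leb.-integrable setT ((EFin \o g) \_ `[s, x]).
  by have [/(_ h)] := @integrable_mkcond _ _ _ leb `[s, x] (EFin \o g) (measurable_itv _).
rewrite /intg (_ : EFin \o _ = (EFin \o g) \_ `[s, x])//.
apply/funext => t; rewrite patchE /= /ind indicE.
by case: (_ \in _); rewrite ?mul1r ?mul0r.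
Qed.

Lemma Rint_ind_mul s x g : \int[leb]_t (ind s x t * g t) = \int[leb]_(t in `[s, x]) g t.
Proof.
rewrite [RHS]Rintegral_mkcond; apply: eq_Rintegral => t _.
by rewrite patchE /ind indicE; case: (_ \in _); rewrite ?mul1r ?mul0r.
Qed.

Lemma sqi_ind_mul s x g : continuous g -> sqi leb (fun t => ind s x t * g t).
Proof.
move=> cg; split; first by have /intg_meas := @intg_ind_mul s x g cg.
rewrite (_ : (fun t => _) = (fun t => ind s x t * (g t * g t))).
  by apply: intg_ind_mul => t; apply: cvgM; exact: cg.
by apply/funext => t; rewrite exprMn ind_sqr expr2.
Qed.

Lemma Rint_ind s x : s <= x -> \int[leb]_t ind s x t = x - s.
Proof.
move=> sx; rewrite (_ : (fun t => _) = (fun t => ind s x t * 1)); last first.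
  by apply/funext => t; rewrite mulr1.
rewrite Rint_ind_mul /Rintegral integral_cst//= mul1e lebesgue_measure_itv/= lte_fin.
move: sx; rewrite le_eqVlt => /predU1P[->|sx]; first by rewrite ltxx subrr.
by rewrite sx -EFinB.
Qed.

Lemma sqi_ind s x : sqi leb (ind s x).
Proof.
have -> : ind s x = (fun t => ind s x t * 1) by apply/funext => t; rewrite mulr1.
by apply: sqi_ind_mul => t; exact: cvg_cst.
Qed.

Lemma mean_square s x g : s <= x -> continuous g ->
  (\int[leb]_t (ind s x t * g t)) ^+ 2 <=
  (x - s) * \int[leb]_t (ind s x t * g t ^+ 2).
Proof.
move=> sx cg; have := ip_CS (sqi_ind s x) (@sqi_ind_mul s x g cg).
rewrite (_ : ip leb _ _ = \int[leb]_t (ind s x t * g t)); last first.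
  by apply: eq_Rintegral => t _; rewrite mulrA ind_idem.
rewrite (_ : ip leb (ind s x) (ind s x) = x - s); last first.
  by rewrite -Rint_ind//; apply: eq_Rintegral => t _; rewrite ind_idem.
rewrite (_ : ip leb _ _ = \int[leb]_t (ind s x t * g t ^+ 2))//.
by apply: eq_Rintegral => t _; rewrite -expr2 exprMn ind_sqr.
Qed.

(** The fundamental theorem of calculus, then Cauchy-Schwarz against the indicator of the
    interval. *)
Lemma increment_sqr_le F x s : (forall t, derivable F t 1) -> continuous (derive1 F) ->
  sqi leb (derive1 F) ->
  (F x - F s) ^+ 2 <= `|x - s| * ip leb (derive1 F) (derive1 F).
Proof.
move=> dF cF sF.
wlog sx : x s / s < x.
  move=> h; have [xs|xs|->] := ltgtP s x; first exact: h.
    by rewrite -sqrrN opprB distrC; exact: h.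
  by rewrite !subrr expr0n normr0 mul0r.
have <- : \int[leb]_t (ind s x t * derive1 F t) = F x - F s.
  rewrite Rint_ind_mul /Rintegral (continuous_FTC2 sx (f := derive1 F) (F := F))//.
  - exact: continuous_subspaceT.
  - have cc t : {for t, continuous F}.
      by apply: differentiable_continuous; exact/derivable1_diffP.
    split; first by move=> t _.
      by apply: cvg_at_right_filter; exact: cc.
    by apply: cvg_at_left_filter; exact: cc.
apply: le_trans (mean_square (ltW sx) cF) _.
rewrite gtr0_norm ?subr_gt0// ler_wpM2l ?subr_ge0 ?(ltW sx)//.
have c2 : continuous (fun t => derive1 F t ^+ 2) by move=> t; apply: cvgM; exact: cF.
apply: Rint_le; first exact: intg_ind_mul.
  exact: sqi_mul.
by move=> t; rewrite -expr2 ler_piMl ?sqr_ge0 ?ind_le1.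
Qed.

Lemma sqi_bounded_support g (N : R) : continuous g ->
  (forall t, N <= `|t| -> g t = 0) -> sqi leb g.
Proof.
move=> cg g0; have -> : g = (fun t => ind (- `|N|) `|N| t * g t).
  apply/funext => t; rewrite /ind indicE mem_setE in_itv/= -ler_norml.
  case: leP => [_|Nt]; first by rewrite mul1r.
  by rewrite mul0r g0// (le_trans (ler_norm N))// ltW.
exact: sqi_ind_mul.
Qed.

End OneDimensional.

Section ProductIntegral.
Context d1 d2 (T1 : measurableType d1) (T2 : measurableType d2) (R : realType).
Variables (m1 : {sigma_finite_measure set T1 -> \bar R})
  (m2 : {sigma_finite_measure set T2 -> \bar R}).

Lemma Rint_prod (a : T1 -> R) (b : T2 -> R) : intg m1 a -> intg m2 b ->
  \int[(m1 \x m2)%E]_z (a z.1 * b z.2) = \int[m1]_x a x * \int[m2]_y b y.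
Proof.
move=> ia ib; have iab := intg_prod ia ib.
have e : fubini_F m2 (fun z => (a z.1 * b z.2)%:E) = (fun x => (\int[m2]_y b y * a x)%:E).
  apply/funext => x; rewrite /fubini_F /= mulrC -RintZ// -RintE//; exact: intgZ.
have := integral12_prod_meas1 iab; rewrite e => h.
by rewrite mulrC -RintZ// /Rintegral h.
Qed.

End ProductIntegral.

(** * A weighted Poincare inequality *)

Section WeightedPoincare.
Context {R : realType}.
Local Notation R2 := (R * R)%type.
Local Notation mu := (@leb2 R).
Local Notation leb := (@lebesgue_measure R).
Implicit Types f g : R2 -> R.

Lemma continuous_slice0 g y : continuous g -> continuous (fun t => g (t, y)).
Proof.
move=> cg t; apply: (@continuous_comp _ _ _ (fun t : R => (t, y)) g); last exact: cg.
by apply: (@cvg_pair _ _ _ _ (nbhs t) (nbhs (y : R))); [exact: cvg_id|exact: cvg_cst].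
Qed.

Lemma continuous_slice1 g x : continuous g -> continuous (fun t => g (x, t)).
Proof.
move=> cg t; apply: (@continuous_comp _ _ _ (fun t : R => (x, t)) g); last exact: cg.
by apply: (@cvg_pair _ _ _ _ (nbhs (x : R)) (nbhs t)); [exact: cvg_cst|exact: cvg_id].
Qed.

Section Slices.
Variable g : R2 -> R.
Hypotheses (cg : continuous g) (bg : bsupp g).

Definition energy0 y := ip leb (fun t => g (t, y)) (fun t => g (t, y)).
Definition energy1 x := ip leb (fun t => g (x, t)) (fun t => g (x, t)).

Lemma sqi_slice0 y : sqi leb (fun t => g (t, y)).
Proof.
case: bg => N hN; apply: (@sqi_bounded_support _ _ N).
  exact: continuous_slice0.
by move=> t Nt; apply: hN; rewrite (le_trans Nt)//; have [] := normR2_ge t y.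
Qed.

Lemma sqi_slice1 x : sqi leb (fun t => g (x, t)).
Proof.
case: bg => N hN; apply: (@sqi_bounded_support _ _ N).
  exact: continuous_slice1.
by move=> t Nt; apply: hN; rewrite (le_trans Nt)//; have [] := normR2_ge x t.
Qed.

Let ig : intg mu (fun z => g z * g z).
Proof. by have s := bsupp_sqi cg bg; exact: sqi_mul. Qed.

Let energy0E : (\int[leb]_y (energy0 y)%:E = \int[mu]_z (g z * g z)%:E)%E.
Proof.
rewrite (fubini21 ig); apply: eq_integral => y _; rewrite RintE//.
by have s := sqi_slice0 y; exact: sqi_mul.
Qed.

Let energy1E : (\int[leb]_x (energy1 x)%:E = \int[mu]_z (g z * g z)%:E)%E.
Proof.
rewrite (fubini12 ig); apply: eq_integral => x _; rewrite RintE//.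
by have s := sqi_slice1 x; exact: sqi_mul.
Qed.

Let total_lty : (\int[mu]_z (g z * g z)%:E < +oo)%E.
Proof. by rewrite RintE// ltry. Qed.

Lemma energy0P : intg leb energy0 /\ \int[leb]_y energy0 y = ip mu g g.
Proof.
split; last by rewrite /ip /Rintegral energy0E.
apply/integrableP; split.
  have mG := @measurable_fubini_G _ _ _ _ _ leb leb _ ig.
  apply: eq_measurable_fun mG => y _; rewrite /fubini_G /= RintE//.
  by have s := sqi_slice0 y; exact: sqi_mul.
rewrite (_ : (fun y => _) = (fun y => (energy0 y)%:E)) ?energy0E ?total_lty//.
by apply/funext => y /=; rewrite ger0_norm// ip_ge0.
Qed.

Lemma energy1P : intg leb energy1 /\ \int[leb]_x energy1 x = ip mu g g.
Proof.
split; last by rewrite /ip /Rintegral energy1E.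
apply/integrableP; split.
  have mF := @measurable_fubini_F _ _ _ _ _ leb leb _ ig.
  apply: eq_measurable_fun mF => x _; rewrite /fubini_F /= RintE//.
  by have s := sqi_slice1 x; exact: sqi_mul.
rewrite (_ : (fun x => _) = (fun x => (energy1 x)%:E)) ?energy1E ?total_lty//.
by apply/funext => x /=; rewrite ger0_norm// ip_ge0.
Qed.

Lemma energy0_ge0 y : 0 <= energy0 y. Proof. exact: ip_ge0. Qed.
Lemma energy1_ge0 x : 0 <= energy1 x. Proof. exact: ip_ge0. Qed.

End Slices.

(** The constant to subtract from a potential. In the plane the energy does not control point
    values; averaging over a horizontal edge turns energies of single vertical lines into the full
    energy. *)
Definition edge_mean f : R := \int[leb]_s (ind 0 1 s * f (s, 0)).

Section Pointwise.
Variable f : R2 -> R.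
Hypothesis tf : test_function f.
Let sf := test_smooth tf.
Let cf := smooth_continuous sf.
Let c0 : continuous (partial 0 f) := smooth_continuous (smooth_partial 0 sf).
Let c1 : continuous (partial 1 f) := smooth_continuous (smooth_partial 1 sf).
Let b0 : bsupp (partial 0 f) := bsupp_partial 0 (test_bsupp tf).
Let b1 : bsupp (partial 1 f) := bsupp_partial 1 (test_bsupp tf).

Lemma increment0 x s y :
  (f (x, y) - f (s, y)) ^+ 2 <= `|x - s| * energy0 (partial 0 f) y.
Proof.
have e : derive1 (fun t => f (t, y)) = fun t => partial 0 f (t, y).
  by apply/funext => t; rewrite partial_slice0.
have := @increment_sqr_le _ (fun t => f (t, y)) x s; rewrite e; apply.
- by move=> t; apply/derivable_slice0; exact: smooth_derivable.
- exact: continuous_slice0.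
- exact: sqi_slice0.
Qed.

Lemma increment1 x s y :
  (f (x, y) - f (x, s)) ^+ 2 <= `|y - s| * energy1 (partial 1 f) x.
Proof.
have e : derive1 (fun t => f (x, t)) = fun t => partial 1 f (x, t).
  by apply/funext => t; rewrite partial_slice1.
have := @increment_sqr_le _ (fun t => f (x, t)) y s; rewrite e; apply.
- by move=> t; apply/derivable_slice1; exact: smooth_derivable.
- exact: continuous_slice1.
- exact: sqi_slice1.
Qed.

(* Go from (s, 0) up to (s, y), then across to (x, y), and average over s. *)
Lemma poincare_pointwise x y : (f (x, y) - edge_mean f) ^+ 2 <=
  2 * (1 + `|x|) * energy0 (partial 0 f) y +
  2 * `|y| * ip mu (partial 1 f) (partial 1 f).
Proof.
pose h s := f (x, y) - f (s, 0).
have ch : continuous h.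
  by move=> s; apply: cvgB; [exact: cvg_cst|exact: (continuous_slice0 cf)].
have iind : intg leb (ind 0 1 : R -> R).
  have [_] := @sqi_ind R 0 1; rewrite (_ : (fun t => _) = ind 0 1)//.
  by apply/funext => t; rewrite ind_sqr.
have i0 : intg leb (fun t => ind 0 1 t * f (x, y)).
  by apply: intg_ind_mul => t; exact: cvg_cst.
have i1 : intg leb (fun t => ind 0 1 t * f (t, 0)).
  by apply: intg_ind_mul; exact: continuous_slice0.
have [ie e1] := energy1P c1 b1.
have := @mean_square _ 0 1 h ler01 ch; rewrite subr0 mul1r.
have -> : \int[leb]_t (ind 0 1 t * h t) = f (x, y) - edge_mean f.
  rewrite (_ : (fun t => _) = (fun t => ind 0 1 t * f (x, y) - ind 0 1 t * f (t, 0))).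
    rewrite (RintB i0 i1); congr (_ - _).
    by under eq_Rintegral do rewrite mulrC; rewrite RintZ// Rint_ind// subr0 mulr1.
  by apply/funext => t; rewrite /h mulrBr.
move=> /le_trans; apply.
(* The horizontal term is constant in [s], so it keeps the indicator and integrates to itself; the
   vertical one is integrated over the whole line. *)
pose A := 2 * (1 + `|x|) * energy0 (partial 0 f) y.
have A0 : 0 <= A.
  by apply: mulr_ge0; [rewrite mulr_ge0// addr_ge0|exact: energy0_ge0].
have -> : A + 2 * `|y| * ip mu (partial 1 f) (partial 1 f) =
    \int[leb]_s (A * ind 0 1 s + 2 * `|y| * energy1 (partial 1 f) s).
  rewrite RintD ?RintZ// ?Rint_ind ?subr0 ?mulr1 ?e1//; exact: intgZ.
apply: Rint_le.
- by apply: intg_ind_mul => t; apply: cvgM; exact: ch.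
- by apply: intgD; exact: intgZ.
move=> s; have E0 := energy1_ge0 (partial 1 f) s.
have y0 : 0 <= 2 * `|y| * energy1 (partial 1 f) s by rewrite mulr_ge0// mulr_ge0.
rewrite /ind indicE mem_setE in_itv/=.
case: (boolP (0 <= s <= 1)) => [/andP[s0 s1]|_]; last by rewrite mul0r mulr0 add0r.
rewrite mul1r mulr1.
have h0 := increment0 x s y; have h1 := increment1 s 0 y; rewrite subr0 in h1.
have xs : `|x - s| <= 1 + `|x|.
  by rewrite (le_trans (ler_normB _ _))// addrC lerD2r ger0_norm.
have F0 := energy0_ge0 (partial 0 f) y.
have h2 : `|x - s| * energy0 (partial 0 f) y <= (1 + `|x|) * energy0 (partial 0 f) y.
  by rewrite ler_wpM2r.
rewrite /h /A; move: h0 h1 h2.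
move: (energy0 _ _) (energy1 _ _) (f (x, y)) (f (s, y)) (f (s, 0)) => a b u v w h0 h1 h2.
have : (u - w) ^+ 2 <= 2 * (u - v) ^+ 2 + 2 * (v - w) ^+ 2.
  by have := sqr_ge0 (u - v - (v - w)); nra.
move/le_trans; apply; rewrite -!mulrA; apply: lerD; rewrite ler_wpM2l//.
exact: le_trans h2.
Qed.

End Pointwise.
End WeightedPoincare.

Section Potential.
Context {R : realType}.
Local Notation R2 := (R * R)%type.
Local Notation mu := (@leb2 R).
Local Notation leb := (@lebesgue_measure R).
Implicit Types f g : R2 -> R.

Lemma intg_oneDsqrV : intg leb (fun x : R => (1 + x ^+ 2)^-1).
Proof.
apply/integrableP; split; first exact: measurable_oneDsqrV.
under eq_integral do rewrite /= ger0_norm ?invr_ge0 ?addr_ge0 ?sqr_ge0//.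
by rewrite integral_oneDsqrV ltry.
Qed.

Lemma Rint_oneDsqrV : \int[leb]_x ((1 + x ^+ 2)^-1) = pi.
Proof. by rewrite /Rintegral integral_oneDsqrV. Qed.

(** The square of the weight has reciprocals to spare: one absorbs each linear growth, by
    [(1 + |x|) / (1 + x ^ 2) <= 2] and [2 * |y| / (1 + y ^ 2) <= 1], and the rest stays
    integrable. *)
Lemma kap_sqr_le0 x y (s t : R) : 0 <= s -> 0 <= t ->
  kap (x, y) ^+ 2 * (2 * (1 + `|x|) * s + 2 * `|y| * t) <=
  4 * ((1 + x ^+ 2)^-1 * s) + t * kap (x, y).
Proof.
move=> s0 t0; rewrite /kap/= invfM.
set a := (1 + x ^+ 2)^-1; set b := (1 + y ^+ 2)^-1.
have x0 : 0 < 1 + x ^+ 2 by have := sqr_ge0 x; lra.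
have y0 : 0 < 1 + y ^+ 2 by have := sqr_ge0 y; lra.
have a0 : 0 <= a by rewrite invr_ge0 ltW.
have b0 : 0 <= b by rewrite invr_ge0 ltW.
have a1 : a <= 1 by rewrite invf_le1//; have := sqr_ge0 x; lra.
have b1 : b <= 1 by rewrite invf_le1//; have := sqr_ge0 y; lra.
have ax : a * (1 + `|x|) <= 2.
  rewrite /a mulrC ler_pdivrMr// -(real_normK (num_real x)).
  by have := sqr_ge0 (`|x| - 4^-1); nra.
have byy : b * (2 * `|y|) <= 1.
  rewrite /b mulrC ler_pdivrMr// mul1r -(real_normK (num_real y)).
  by have := sqr_ge0 (`|y| - 1); nra.
have h1 : (a * b) ^+ 2 * (2 * (1 + `|x|) * s) <= 4 * (a * s).
  rewrite (_ : _ * _ = (2 * (a * s)) * (b * b) * (a * (1 + `|x|))); last by ring.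
  have as0 : 0 <= 2 * (a * s) by rewrite mulr_ge0// mulr_ge0.
  have bb1 : b * b <= 1 by rewrite mulr_ile1.
  have w0 : 0 <= a * (1 + `|x|) by rewrite mulr_ge0// addr_ge0.
  rewrite (_ : 4 * (a * s) = 2 * (a * s) * 2); last by ring.
  rewrite -mulrA ler_wpM2l// -[leRHS]mul1r ler_pM// mulr_ge0//.
have h2 : (a * b) ^+ 2 * (2 * `|y| * t) <= t * (a * b).
  rewrite (_ : (a * b) ^+ 2 * (2 * `|y| * t) = (t * (a * b)) * (a * (b * (2 * `|y|)))); last by ring.
  rewrite -[leRHS]mulr1 ler_wpM2l//; first by rewrite mulr_ge0// mulr_ge0.
  by rewrite mulr_ile1// mulr_ge0// mulr_ge0.
by rewrite mulrDr lerD.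
Qed.

Definition weighted f x := kap x * (f x - edge_mean f).

(** The pointwise bound is integrated: [pi] is the integral of [1 / (1 + x ^ 2)], and the energies
    of the horizontal lines add up to that of the plane. *)
Lemma weighted_poincare f : test_function f ->
  sqi mu (weighted f) /\
  ip mu (weighted f) (weighted f) <=
    4 * (pi * ip mu (partial 0 f) (partial 0 f)) +
    ip mu (partial 1 f) (partial 1 f) * \int[mu]_z kap z.
Proof.
move=> tf; have cf := smooth_continuous (test_smooth tf).
have c0 := smooth_continuous (smooth_partial 0 (test_smooth tf)).
have b0 := bsupp_partial 0 (test_bsupp tf).
have [i0 e0] := energy0P c0 b0.
set J1 := ip mu (partial 1 f) (partial 1 f); rewrite -e0.
have J10 : 0 <= J1 by exact: ip_ge0.
pose B (z : R2) := 4 * ((1 + z.1 ^+ 2)^-1 * energy0 (partial 0 f) z.2) + J1 * kap z.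
have iA : intg mu (fun z => (1 + z.1 ^+ 2)^-1 * energy0 (partial 0 f) z.2).
  exact: (@intg_prod _ _ _ _ R leb leb _ _ intg_oneDsqrV i0).
have iB : intg mu B by apply: intgD; apply: intgZ => //; exact: intg_kap.
have pw z : weighted f z ^+ 2 <= B z.
  case: z => x y; rewrite /weighted exprMn /B/=.
  apply: le_trans (kap_sqr_le0 x y (energy0_ge0 _ _) J10).
  by rewrite ler_wpM2l ?sqr_ge0//; exact: poincare_pointwise.
have mw : measurable_fun setT (weighted f : plane R -> R).
  apply: continuous_measurable_plane => z; apply: cvgM; first exact: continuous_kap.
  by apply: cvgB; [exact: cf|exact: cvg_cst].
have iw : intg mu (fun z => weighted f z ^+ 2).
  apply: (@intg_le _ _ _ mu _ B) => //; first exact: measurable_funX.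
  by move=> z; rewrite ger0_norm ?sqr_ge0.
split; first by split.
have eB : \int[mu]_z B z = 4 * (pi * \int[leb]_y energy0 (partial 0 f) y) + J1 * \int[mu]_z kap z.
  rewrite RintD ?(RintZ _ intg_kap) ?(RintZ _ iA); last 2 first.
  - exact: intgZ.
  - by apply: intgZ; exact: intg_kap.
  rewrite (@Rint_prod _ _ _ _ R leb leb _ _ intg_oneDsqrV i0).
  by rewrite Rint_oneDsqrV.
by rewrite -eB; apply: Rint_le.
Qed.

End Potential.

(** * Local square integrability *)

Section LocalIntegrability.
Context {R : realType}.
Local Notation R2 := (R * R)%type.
Local Notation mu := (@leb2 R).
Local Notation leb := (@lebesgue_measure R).
Implicit Types f g : R2 -> R.

Lemma compact_measurable_plane (K : set R2) : compact K ->
  measurable (K : set (plane R)).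
Proof.
move=> cK; have clK : closed K.
  exact (@compact_closed R2 _ (@norm_hausdorff _ R2) cK).
by rewrite -(setCK K); apply: measurableC; apply: open_measurable_plane; exact: closed_openC.
Qed.

Lemma compact_bound (K : set R2) f : compact K -> continuous f ->
  exists B : R, forall x, K x -> `|f x| <= B.
Proof.
move=> cK cf; have : compact (f @` K).
  by apply: continuous_compact => //; exact: continuous_subspaceT.
move=> /compact_bounded[M [_ hM]]; exists (M + 1) => x Kx.
by apply: hM; [rewrite ltrDl|exists x].
Qed.

Lemma L2loc_mul w r : sqi mu w -> continuous r -> L2loc (fun x => w x * r x).
Proof.
move=> sw cr; have mw := sqi_meas sw.
have mr := continuous_measurable_plane cr.
split; first exact: measurable_funM.
move=> K cK; have mK := compact_measurable_plane cK.
have [B hB] := compact_bound cK cr.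
have iw := intgZ (B ^+ 2) (proj2 sw).
apply: (@le_lt_trans _ _ (\int[mu]_(x in K) (B ^+ 2 * w x ^+ 2)%:E)%E).
  apply: ge0_le_integral => //.
  - apply: measurable_funTS; apply/measurable_EFinP; apply: measurable_funX.
    by apply: measurableT_comp => //; exact: measurable_funM.
  - by apply: measurable_funTS; apply/measurable_EFinP; exact: (intg_meas iw).
  - move=> x Kx; rewrite lee_fin normrM exprMn mulrC ler_pM ?sqr_ge0//.
      by rewrite lerXn2r ?nnegrE// ?(le_trans _ (hB _ Kx))// hB.
    by rewrite real_normK ?num_real.
apply: (@le_lt_trans _ _ (\int[mu]_x (B ^+ 2 * w x ^+ 2)%:E)%E).
  apply: ge0_subset_integral => //.
  - by apply/measurable_EFinP; exact: (intg_meas iw).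
  - by move=> x _; rewrite lee_fin mulr_ge0// sqr_ge0.
by rewrite RintE// ltry.
Qed.

Lemma sqi_kap : sqi mu (@kap R).
Proof.
have mk := continuous_measurable_plane (@continuous_kap R).
split => //; apply: (@intg_le _ _ _ mu _ (@kap R)) => [||].
- exact: measurable_funX.
- move=> x; have k0 := kap_gt0 x; rewrite ger0_norm ?sqr_ge0// expr2.
  rewrite -[leRHS]mul1r ler_wpM2r ?(ltW k0)//.
  by rewrite /kap invf_le1 ?kap_den_ge1// (lt_le_trans ltr01) ?kap_den_ge1.
- exact: intg_kap.
Qed.

Lemma continuous_kapV : continuous (fun x : R2 => (kap x)^-1).
Proof. by move=> x; apply: cvgV; [rewrite gt_eqF ?kap_gt0|exact: continuous_kap]. Qed.

Lemma continuous_L2loc f : continuous f -> L2loc f.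
Proof.
move=> cf; rewrite (_ : f = (fun x => kap x * ((kap x)^-1 * f x))).
  apply: L2loc_mul; first exact: sqi_kap.
  by move=> x; apply: cvgM; [exact: continuous_kapV|exact: cf].
by apply/funext => x; rewrite mulrA divff ?mul1r// gt_eqF ?kap_gt0.
Qed.

Lemma sqi_L2loc f : sqi mu f -> L2loc f.
Proof.
move=> sf; rewrite (_ : f = (fun x => f x * 1)).
  by apply: L2loc_mul => // x; exact: cvg_cst.
by apply/funext => x; rewrite mulr1.
Qed.

Lemma L2locD f g : L2loc f -> L2loc g -> L2loc (fun x => f x + g x).
Proof.
move=> [mf hf] [mg hg]; split; first exact: measurable_funD.
move=> K cK; have mK := compact_measurable_plane cK.
have mq (h : R2 -> R) : measurable_fun setT (h : plane R -> R) ->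
    measurable_fun K (fun x => (`|h x| ^+ 2)%:E : \bar R).
  move=> mh; apply: measurable_funTS; apply/measurable_EFinP.
  by apply: measurable_funX; exact: measurableT_comp.
have p2 (h : R2 -> R) x : (0 <= (`|h x| ^+ 2)%:E)%E by rewrite lee_fin sqr_ge0.
have i2 (h : R2 -> R) : measurable_fun setT (h : plane R -> R) ->
    (\int[mu]_(x in K) (2 * `|h x| ^+ 2)%:E = 2%:E * \int[mu]_(x in K) (`|h x| ^+ 2)%:E)%E.
  by move=> mh; under eq_integral do rewrite EFinM; rewrite ge0_integralZl ?lee_fin//; exact: mq.
apply: (@le_lt_trans _ _ (\int[mu]_(x in K) ((2 * `|f x| ^+ 2)%:E + (2 * `|g x| ^+ 2)%:E))%E).
  apply: ge0_le_integral => //.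
  - by apply: mq; exact: measurable_funD.
  - apply: emeasurable_funD.
      by under eq_fun do rewrite EFinM; apply: measurable_funeM; exact: mq.
    by under eq_fun do rewrite EFinM; apply: measurable_funeM; exact: mq.
  - move=> x _; rewrite -EFinD lee_fin !real_normK ?num_real//.
    by have := sqr_ge0 (f x - g x); nra.
rewrite ge0_integralD//; last 2 first.
- by under eq_fun do rewrite EFinM; apply: measurable_funeM; exact: mq.
- by under eq_fun do rewrite EFinM; apply: measurable_funeM; exact: mq.
rewrite !i2//; apply: lte_add_pinfty; apply: lte_mul_pinfty => //; exact: hf || exact: hg.
Qed.

End LocalIntegrability.

(** * The potential of a limit of test gradients *)

Section Potential.
Context {R : realType}.
Local Notation R2 := (R * R)%type.
Local Notation mu := (@leb2 R).
Local Notation leb := (@lebesgue_measure R).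
Implicit Types f g : R2 -> R.

Lemma edge_meanB f g : continuous f -> continuous g ->
  edge_mean (fun x => f x - g x) = edge_mean f - edge_mean g.
Proof.
move=> cf cg; rewrite /edge_mean -RintB; last 2 first.
- by apply: intg_ind_mul; exact: continuous_slice0.
- by apply: intg_ind_mul; exact: continuous_slice0.
by apply: eq_Rintegral => s _; rewrite mulrBr.
Qed.

Lemma partial_cst j (c : R) : partial j (fun=> c) = (fun=> 0).
Proof. by apply/funext => x; rewrite /partial derive_cst. Qed.

Lemma C1_cst (c : R) : C1 (fun=> c : R).
Proof.
split=> [x|j]; first exact: cvg_cst.
by split=> [x|]; [exact: derivable_cst|rewrite partial_cst => x; exact: cvg_cst].
Qed.

(** The Poincare inequality for differences makes the weighted potentials Cauchy; dividing their
    limit by [kap] gives [u]. Integrability is part of the conclusion because an affine map is later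
    added to [u] under the integral. *)
Lemma potential (f : nat -> R2 -> R) (h : 'I_2 -> R2 -> R) :
  (forall k, nice (f k)) -> (forall j, sqi mu (h j)) ->
  (forall j, L2cvg mu (fun k => partial j (f k)) (h j)) ->
  exists2 u, L2loc u & forall j phi, test_function phi ->
    intg mu (fun x => u x * partial j phi x) /\
    \int[mu]_x (u x * partial j phi x) = - \int[mu]_x (h j x * phi x).
Proof.
move=> nf sh ch; have tf k := proj1 (nf k).
have sf k := nice_smooth (nf k); have cf k := smooth_continuous (sf k).
have sp k j := sqi_nice j (nf k).
have sw k := proj1 (weighted_poincare (tf k)).
set I := \int[mu]_z (@kap R z).
have I0 : 0 <= I by apply: Rint_ge0 => z; rewrite ltW ?kap_gt0.
have cauchy j : exists C : R, forall m n, dst2 mu (partial j (f m)) (partial j (f n)) <=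
    C * (m.+1%:R^-1 + n.+1%:R^-1).
  have [C hC] := ch j; exists (2 * C) => m n.
  have alg (a b d s t : R) : d <= 2 * a + 2 * b -> a <= C * s -> b <= C * t ->
    d <= 2 * C * (s + t) by nra.
  apply: alg (hC m) (hC n).
  have := ip_sqD_le (sqiB (sp m j) (sh j)) (sqiB (sh j) (sp n j)).
  rewrite -!dst2E (dst2C mu (h j)) dst2E.
  rewrite (_ : (fun x => _ + _) = (fun x => partial j (f m) x - partial j (f n) x))//.
  by apply/funext => x; rewrite addrA subrK.
have [C0 hC0] := cauchy 0; have [C1 hC1] := cauchy 1.
have [W sW cW] : exists2 W, sqi mu W & forall n, dst2 mu (weighted (f n)) W <=
    (4 * pi * C0 + C1 * I) * n.+1%:R^-1.
  apply: sqi_complete => // m n.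
  have := proj2 (weighted_poincare (proj1 (nice_lin (-1) (nf m) (nf n)))).
  rewrite !smooth_partial_lin//.
  have e1 (a b : R2 -> R) : (fun x => a x + (-1) * b x) = (fun x => a x - b x).
    by apply/funext => x; rewrite mulN1r.
  rewrite !e1 -!dst2E (_ : weighted _ = (fun x => weighted (f m) x - weighted (f n) x)).
    rewrite -dst2E => h1; apply: le_trans h1 _.
    have p0 := pi_ge0 R.
    have alg (a b s : R) : a <= C0 * s -> b <= C1 * s ->
        4 * (pi * a) + b * I <= (4 * pi * C0 + C1 * I) * s.
      move=> /(ler_wpM2l p0) h3 /(ler_wpM2r I0) h4; nra.
    exact: alg (hC0 m n) (hC1 m n).
  apply/funext => x; rewrite /weighted edge_meanB//.
  by move: (kap x) (edge_mean _) (edge_mean _) => k a b; ring.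
exists (fun x => W x * (kap x)^-1); first exact: L2loc_mul (@continuous_kapV R).
move=> j phi tphi.
have spj := sqi_partial_test j tphi; have ss := test_smooth tphi.
have cpj := smooth_continuous (smooth_partial j ss).
have bpj := bsupp_partial j (test_bsupp tphi).
(* The weight moves to the test function, whose bounded support keeps the product square
   integrable. *)
pose X x := partial j phi x * (kap x)^-1.
have sX : sqi mu X.
  apply: bsupp_sqi; last exact: bsuppM.
  by move=> x; apply: cvgM; [exact: cpj|exact: continuous_kapV].
have sphi : sqi mu phi by apply: bsupp_sqi; [exact: smooth_continuous|exact: test_bsupp].
have eW : (fun x => W x * (kap x)^-1 * partial j phi x) = (fun x => W x * X x).
  by apply/funext => x; rewrite /X mulrAC mulrA.
split; first by rewrite eW; exact: sqi_mul.
rewrite eW.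
have c1 : ip mu (weighted (f n)) X @[n --> \oo] --> ip mu W X.
  by apply: ip_cvg => //; eexists; exact: cW.
have c2 : - ip mu (partial j (f n)) phi @[n --> \oo] --> - ip mu (h j) phi.
  by apply: cvgN; apply: ip_cvg => // n; exact: sp.
have e n : ip mu (weighted (f n)) X = - ip mu (partial j (f n)) phi.
  have h1 := ibp j (smooth_C1 (sf n)) (smooth_C1 ss) (test_bsupp tphi).
  have h2 := ibp j (C1_cst (edge_mean (f n))) (smooth_C1 ss) (test_bsupp tphi).
  have i1 : intg mu (fun x => f n x * partial j phi x).
    by apply: sqi_mul => //; apply: bsupp_sqi => //; exact: nice_bsupp.
  have i2 : intg mu (fun x => edge_mean (f n) * partial j phi x).
    by apply: intgZ; exact: bsupp_intg.
  rewrite /ip -h1 (_ : (fun x => weighted _ _ * X x) =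
    (fun x => f n x * partial j phi x - edge_mean (f n) * partial j phi x)).
    rewrite partial_cst in h2; rewrite RintB// h2.
    under [X in _ - - X]eq_Rintegral do rewrite mul0r.
    by rewrite [X in _ - - X]/Rintegral integral0/= oppr0 subr0.
  apply/funext => x; rewrite /weighted /X -mulrBl.
  have := gt_eqF (kap_gt0 x); move: (kap x) => k /negbT k0; field.
  by [].
have e' : (fun n => ip mu (weighted (f n)) X) = (fun n => - ip mu (partial j (f n)) phi).
  by apply/funext => n; exact: e.
rewrite e' in c1; exact: (cvg_unique (@Rhausdorff R) c1 c2).
Qed.

End Potential.

(** * L2 norms as square roots of inner products *)

Section SquareNorm.
Context d (T : measurableType d) (R : realType).
Variable mu : {measure set T -> \bar R}.
Implicit Types (f g : T -> R).

Lemma Lnorm2E f : 'N[mu]_2%:E[EFin \o f]%E =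
  sqrte (\int[mu]_x (f x ^+ 2)%:E)%E.
Proof.
rewrite unlock poweR12_sqrt; last by apply: integral_ge0 => x _; exact: poweR_ge0.
congr sqrte; apply: eq_integral => x _ /=.
by rewrite powR_mulrn ?normr_ge0// real_normK ?num_real.
Qed.

Lemma sqi_Lnorm2 f : sqi mu f -> 'N[mu]_2%:E[EFin \o f]%E = (Num.sqrt (ip mu f f))%:E.
Proof.
move=> [_ i2]; rewrite Lnorm2E RintE//= /ip; by congr (Num.sqrt _)%:E.
Qed.

Lemma Lnorm2_sqi f : measurable_fun setT f ->
  ('N[mu]_2%:E[EFin \o f] < +oo)%E -> sqi mu f.
Proof.
move=> mf; rewrite Lnorm2E => h; split => //; apply/integrableP; split.
  by apply/measurable_EFinP; exact: measurable_funX.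
under eq_integral do rewrite /= ger0_norm ?sqr_ge0//.
by move: h; case: (\int[mu]_x (f x ^+ 2)%:E)%E => // r _; exact: ltry.
Qed.

Lemma Lfun2P f : f \in Lfun mu 2%:E <-> sqi mu f.
Proof.
split => [fL|sf].
  move: (fL); rewrite inE => /andP[/set_mem mf _]; split => //.
  exact: Lfun2_integrable_sqr.
rewrite inE; apply/andP; split; first by rewrite inE/=; exact: sqi_meas sf.
by rewrite inE/= /finite_norm sqi_Lnorm2// ltry.
Qed.

End SquareNorm.

(** * A measurable choice of angle *)

Section Angle.
Context {R : realType}.
Implicit Types x t c s : R.

Lemma lipschitz1 (f df : R -> R) x : (forall t, is_derive t 1 f (df t)) ->
  (forall t, `|df t| <= 1) -> `|f x - f 0| <= `|x|.
Proof.
move=> fd d1.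
have cf (A : set R) : {within A, continuous f}.
  apply: continuous_subspaceT => t; apply: differentiable_continuous.
  by apply/derivable1_diffP; have [] := fd t.
have [x0|x0|->] := ltgtP x 0; last by rewrite !subrr normr0.
  have [c _] := MVT x0 (fun t _ => fd t) (cf _).
  by rewrite sub0r distrC => ->; rewrite normrM normrN ler_piMl.
have [c _ ->] := MVT x0 (fun t _ => fd t) (cf _).
by rewrite subr0 normrM ler_piMl.
Qed.

Lemma abs_sin_le x : `|sin x| <= `|x|.
Proof.
have := @lipschitz1 sin cos x; rewrite sin0 subr0; apply=> t.
by rewrite ler_norml cos_geN1 cos_le1.
Qed.

Lemma abs_atan_le x : `|atan x| <= `|x|.
Proof.
have := @lipschitz1 atan (fun t => (1 + t ^+ 2)^-1) x.
rewrite atan0 subr0; apply=> t.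
have t0 : 0 < 1 + t ^+ 2 by have := sqr_ge0 t; lra.
by rewrite ger0_norm ?invr_ge0 ?(ltW t0)// invf_le1//; have := sqr_ge0 t; lra.
Qed.

(** The left side is [4 * sin (x / 2) ^ 2]. *)
Lemma one_sub_cos_le x : 2 - 2 * cos x <= x ^+ 2.
Proof.
have e : cos x = cos (x / 2) ^+ 2 *+ 2 - 1 
  by rewrite -cos_mulr2n; congr cos; rewrite -[RHS]mulr_natr divfK.
have := abs_sin_le (x / 2); rewrite -(@ler_pXn2r _ 2) ?nnegrE//.
rewrite !real_normK ?num_real// e; have := cos2Dsin2 (x / 2).
by move: (cos _) (sin _) => c s; rewrite expr_div_n; lra.
Qed.

(* The half-angle formula; [`^ (-1)] is the inverse in a form known to be
   measurable, and the value off the unit circle is junk. *)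
Definition angle c s : R := if c ^+ 2 + s ^+ 2 == 1 then
  (if c == -1 then pi else 2 * atan (s * (1 + c) `^ (-1))) else 0.

Lemma cos_sqr_atan t : cos (atan t) ^+ 2 = (1 + t ^+ 2)^-1.
Proof. by rewrite cos_atan exprVn sqr_sqrtr// addr_ge0// sqr_ge0. Qed.

Lemma angleP c s : c ^+ 2 + s ^+ 2 = 1 -> cos (angle c s) = c /\ sin (angle c s) = s.
Proof.
move=> cs; rewrite /angle cs eqxx; case: eqP => [cN|/eqP cN].
  rewrite cospi sinpi cN; split => //; move: cs; rewrite cN => h.
  by apply/eqP; rewrite eq_sym -sqrf_eq0; apply/eqP; nra.
have c1 : 0 < 1 + c.
  have : -1 <= c by have := sqr_ge0 s; nra.
  by rewrite le_eqVlt eq_sym (negPf cN)/=; lra.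
rewrite powR_inv1 ?ltW//; set t := s / (1 + c).
have c0 : cos (atan t) != 0 by rewrite gt_eqF// cos_atan invr_gt0 sqrtr_gt0 ltr_pwDl// sqr_ge0.
have et : sin (atan t) = t * cos (atan t).
  by rewrite -{2}(atanK t) /tan divfK.
have ct := cos_sqr_atan t.
have e2 : (1 + t ^+ 2)^-1 = (1 + c) / 2.
  have -> : 1 + t ^+ 2 = 2 / (1 + c).
    rewrite /t; have -> : 2 = (1 + c) + (1 - c) by lra.
    have -> : (s / (1 + c)) ^+ 2 = (1 - c) / (1 + c).
      have -> : (s / (1 + c)) ^+ 2 = s ^+ 2 / (1 + c) / (1 + c).
        by rewrite expr_div_n expr2 invfM mulrA.
      have -> : s ^+ 2 = (1 - c) * (1 + c) by nra.
      by rewrite mulfK// gt_eqF.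
    by field; rewrite gt_eqF.
  by rewrite invf_div.
rewrite e2 in ct; rewrite mulr_natl cos_mulr2n sin_mulr2n et ct; split; first by lra.
rewrite mulrCA -expr2 ct /t -mulr_natr -mulrA divfK//.
by rewrite divfK// gt_eqF.
Qed.

(** On the circle, with angle [2 * atan t], the claim is [4 * atan t ^ 2 <= 32 * t ^ 2 / (1 + t ^
    2)]: use [|atan t| <= |t|] when [t ^ 2 <= 1] and [|atan t| <= 2] otherwise, the case that fixes
    the 8. At [c = -1], [pi <= 4] suffices. *)
Lemma angle_sqr_le c s : angle c s ^+ 2 <= 8 * ((c - 1) ^+ 2 + s ^+ 2).
Proof.
have [cs|cs] := eqVneq (c ^+ 2 + s ^+ 2) 1; last first.
  by rewrite /angle (negPf cs) expr0n/= mulr_ge0// addr_ge0 ?sqr_ge0.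
have -> : (c - 1) ^+ 2 + s ^+ 2 = 2 - 2 * c by nra.
have [ca _] := angleP cs; move: ca; rewrite /angle cs eqxx.
have pi4 : pi <= 4 :> R by have := @pihalf_lt2 R; lra.
case: eqP => [-> _|_].
  by have := pi_ge0 R; nra.
move: (_ * powR _ _) => t; rewrite mulr_natl cos_mulr2n cos_sqr_atan => <-.
have t0 : 0 < 1 + t ^+ 2 by have := sqr_ge0 t; lra.
rewrite (_ : 8 * _ = 32 * t ^+ 2 / (1 + t ^+ 2)); last first.
  by rewrite -[X in 2 - 2 * (_ - X)](divff (lt0r_neq0 t0)); field; rewrite lt0r_neq0.
rewrite ler_pdivlMr//.
have h1 : atan t ^+ 2 <= t ^+ 2.
  by have := abs_atan_le t; rewrite -(@ler_pXn2r _ 2) ?nnegrE// !real_normK ?num_real.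
have h2 : atan t ^+ 2 <= 4.
  rewrite -(real_normK (num_real _)) -[4](_ : 2 ^+ 2 = _); last by lra.
  rewrite lerXn2r ?nnegrE// ler_norml.
  by have := atan_ltpi2 t; have := atan_gtNpi2 t; lra.
have [t1|t1] := lerP (t ^+ 2) 1; first by have := sqr_ge0 (atan t); nra.
by have := sqr_ge0 (atan t); nra.
Qed.

End Angle.

(** * Components of a matrix and its distance to the rotations *)

Section Components.
Context {R : realType}.
Implicit Types (F Q : 'M[R]_2).

Definition cp F : R := (F 0 0 + F 1 1) / 2.
Definition cq F : R := (F 1 0 - F 0 1) / 2.
Definition ca F : R := (F 0 0 - F 1 1) / 2.
Definition cb F : R := (F 0 1 + F 1 0) / 2.

Lemma frob_ge0 F : 0 <= frob F. Proof. exact: sqrtr_ge0. Qed.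

Lemma frob_sqr F Q : SO2 Q -> frob (F - Q) ^+ 2 =
  2 * ((cp F - Q 0 0) ^+ 2 + (cq F - Q 1 0) ^+ 2 + ca F ^+ 2 + cb F ^+ 2).
Proof.
move=> /SO2P[h1 h2 _]; rewrite frobE sqr_sqrtr ?addr_ge0 ?sqr_ge0// !mxE h1 h2.
by rewrite /cp /cq /ca /cb; field.
Qed.

Lemma dist_SO2_ge0 F : 0 <= dist_SO2 F.
Proof. by have [Q _ [-> _]] := dist_SO2_min F; exact: frob_ge0. Qed.

Lemma dist_SO2_sqr F : dist_SO2 F ^+ 2 =
  2 * ((Num.sqrt (cp F ^+ 2 + cq F ^+ 2) - 1) ^+ 2 + ca F ^+ 2 + cb F ^+ 2).
Proof.
have [Q SQ [-> Qmin]] := dist_SO2_min F.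
move: (frob_sqr F) => frobF; move: (cp F) (cq F) frobF => p q frobF.
pose m : R := Num.sqrt (p ^+ 2 + q ^+ 2); rewrite -/m.
have m0 : 0 <= m by exact: sqrtr_ge0.
have mE : m ^+ 2 = p ^+ 2 + q ^+ 2 by rewrite sqr_sqrtr ?addr_ge0 ?sqr_ge0.
apply/eqP; rewrite eq_le; apply/andP; split; last first.
  rewrite (frobF _ SQ) ler_wpM2l// !lerD2r.
  move/SO2P : SQ => [_ _]; move: (Q 0 0) (Q 1 0) => c s cs.
  have h : p * c + q * s <= m.
    rewrite (le_trans (ler_norm _))// -(@ler_pXn2r _ 2) ?nnegrE//.
    rewrite real_normK ?num_real// mE.
    have := sqr_ge0 (p * s - q * c).
    have : (p * c + q * s) ^+ 2 + (p * s - q * c) ^+ 2 = (p ^+ 2 + q ^+ 2) * (c ^+ 2 + s ^+ 2) by ring.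
    by rewrite cs mulr1; lra.
  have -> : (p - c) ^+ 2 + (q - s) ^+ 2 = (p ^+ 2 + q ^+ 2) + (c ^+ 2 + s ^+ 2) - 2 * (p * c + q * s) by ring.
  have -> : (m - 1) ^+ 2 = m ^+ 2 + 1 - 2 * m by ring.
  by rewrite cs mE; lra.
(* The nearest rotation points in the direction of [(p, q)]; at [(p, q) = 0] all rotations are
   equally near and the identity is taken. *)
have [c [s [cs csm]]] : exists c s, c ^+ 2 + s ^+ 2 = 1 /\
    (p - c) ^+ 2 + (q - s) ^+ 2 = (m - 1) ^+ 2.
  have [m_eq0|m_neq0] := eqVneq m 0.
    exists 1, 0; split; first by ring.
    move: mE; rewrite m_eq0 expr0n /= => /esym/eqP.
    rewrite paddr_eq0 ?sqr_ge0// !sqrf_eq0 => /andP[/eqP -> /eqP ->].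
    by ring.
  exists (p / m), (q / m).
  have e : (p / m) ^+ 2 + (q / m) ^+ 2 = 1.
    by rewrite !expr_div_n -mulrDl -mE divff// expf_neq0.
  split => //.
  have -> : (p - p / m) ^+ 2 + (q - q / m) ^+ 2 =
      (p ^+ 2 + q ^+ 2) + ((p / m) ^+ 2 + (q / m) ^+ 2) - 2 * ((p ^+ 2 + q ^+ 2) / m) by ring.
  by rewrite e -mE expr2 mulfK//; ring.
pose P := mx22 c (- s) s c.
have SP : SO2 P by apply/SO2P; rewrite !mxE.
have := Qmin P SP; rewrite -(@ler_pXn2r _ 2) ?nnegrE ?frob_ge0//.
by rewrite [X in _ <= X -> _](frobF _ SP) !mxE/= csm.
Qed.

End Components.

Lemma sqi_le_sqr d (T : measurableType d) (R : realType) (mu : {measure set T -> \bar R})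
    (f g : T -> R) : measurable_fun setT f -> sqi mu g ->
  (forall x, f x ^+ 2 <= g x ^+ 2) -> sqi mu f.
Proof.
move=> mf sg fg; apply: sqi_le mf sg _ => x; rewrite -(@ler_pXn2r _ 2) ?nnegrE//.
by rewrite !real_normK ?num_real.
Qed.

(** * Norms of a gradient field through its components *)

Section GradientNorm.
Context {R : realType}.
Local Notation R2 := (R * R)%type.
Local Notation mu := (@leb2 R).

Lemma test_partial j (phi : R2 -> R) : test_function phi -> test_function (partial j phi).
Proof.
move=> tphi; apply: bsupp_test; first exact/smooth_partial/test_smooth.
exact/bsupp_partial/test_bsupp.
Qed.

Lemma intg_test (phi : R2 -> R) : test_function phi -> intg mu phi.
Proof.
by move=> tphi; apply: bsupp_intg; [exact/smooth_continuous/test_smooth|exact: test_bsupp].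
Qed.

Lemma integral_partial_test j (phi : R2 -> R) : test_function phi ->
  \int[mu]_x partial j phi x = 0.
Proof.
move=> tphi; have := ibp j (C1_cst (1 : R)) (smooth_C1 (test_smooth tphi)) (test_bsupp tphi).
rewrite partial_cst; under eq_Rintegral do rewrite mul1r.
move=> ->; under eq_Rintegral do rewrite mul0r.
by rewrite /Rintegral integral0 oppr0.
Qed.

(** With [partial 1 phi] and [partial 0 phi] as test functions, both sides come from the integral of
    [u] against the mixed derivative. The constants drop out, since derivatives of test functions
    have integral 0. *)
Lemma weak_gradient_curl_free u (G : R2 -> 'M[R]_2) i c0 c1 : weak_gradient u G ->
  sqi mu (fun x => G x i 0 - c0) -> sqi mu (fun x => G x i 1 - c1) ->
  curl_free (fun x => G x i 0 - c0) (fun x => G x i 1 - c1).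
Proof.
move=> wg s0 s1 phi nphi; have tphi := proj1 nphi.
have t0 := test_partial 0 tphi; have t1 := test_partial 1 tphi.
have main j k c : sqi mu (fun x => G x i j - c) ->
    (\int[mu]_x (G x i j * partial k phi x)%:E =
     (ip mu (fun x => G x i j - c) (partial k phi))%:E)%E.
  move=> sj; have i1 := sqi_mul sj (sqi_nice k nphi).
  have i2 := intgZ c (intg_test (test_partial k tphi)).
  rewrite (_ : (fun x => (G x i j * partial k phi x)%:E) =
      fun x => ((G x i j - c) * partial k phi x + c * partial k phi x)%:E).
    rewrite RintE; last exact: intgD.
    rewrite RintD// RintZ ?integral_partial_test ?mulr0 ?addr0//.
    exact/intg_test/test_partial.
  by apply/funext => x; congr EFin; ring.
have := wg i 0 _ t1; have := wg i 1 _ t0.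
rewrite (main 0 1 c0 s0) (main 1 0 c1 s1).
have -> : partial 0 (partial 1 phi) = partial 1 (partial 0 phi).
  by apply/funext => x; rewrite (proj2 nphi).
move: (ip _ _ _) (ip _ _ _) => a b h1 h0.
by have [/oppr_inj] := etrans (esym h0) h1.
Qed.

Section Field.
Variable G : R2 -> 'M[R]_2.
Hypothesis mG : forall i j, measurable_fun setT (fun x : plane R => G x i j).

Lemma measurable_cp : measurable_fun setT (fun x : plane R => cp (G x)).
Proof. by apply: measurable_funM => //; exact: measurable_funD. Qed.
Lemma measurable_cq : measurable_fun setT (fun x : plane R => cq (G x)).
Proof. by apply: measurable_funM => //; exact: measurable_funB. Qed.
Lemma measurable_ca : measurable_fun setT (fun x : plane R => ca (G x)).
Proof. by apply: measurable_funM => //; exact: measurable_funB. Qed.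
Lemma measurable_cb : measurable_fun setT (fun x : plane R => cb (G x)).
Proof. by apply: measurable_funM => //; exact: measurable_funD. Qed.

Let msqrt (f : R2 -> R) : measurable_fun setT (f : plane R -> R) ->
  measurable_fun setT (fun x : plane R => Num.sqrt (f x)).
Proof.
move=> mf; apply: (@measurableT_comp _ _ _ _ _ _ (@Num.sqrt R)) => //.
by apply: continuous_measurable_fun; exact: sqrt_continuous.
Qed.

Lemma measurable_frob Q : SO2 Q -> measurable_fun setT (fun x : plane R => frob (G x - Q)).
Proof.
move=> SQ; rewrite (_ : (fun x => _) = (fun x => Num.sqrt (2 * ((cp (G x) - Q 0 0) ^+ 2 +
  (cq (G x) - Q 1 0) ^+ 2 + ca (G x) ^+ 2 + cb (G x) ^+ 2)))).
  have [mp mq ma mb] := And4 measurable_cp measurable_cq measurable_ca measurable_cb.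
  apply: msqrt; apply: measurable_funM => //.
  apply: measurable_funD; last exact: measurable_funX.
  apply: measurable_funD; last exact: measurable_funX.
  by apply: measurable_funD; apply: measurable_funX; exact: measurable_funB.
by apply/funext => x; rewrite -(frob_sqr _ SQ) sqrtr_sqr ger0_norm// frob_ge0.
Qed.

Lemma measurable_modulus : measurable_fun setT
  (fun x : plane R => Num.sqrt (cp (G x) ^+ 2 + cq (G x) ^+ 2)).
Proof.
have [mp mq] := (measurable_cp, measurable_cq).
by apply: msqrt; apply: measurable_funD; exact: measurable_funX.
Qed.

Lemma measurable_dist : measurable_fun setT (fun x : plane R => dist_SO2 (G x)).
Proof.
rewrite (_ : (fun x => _) = (fun x => Num.sqrt (2 *
    ((Num.sqrt (cp (G x) ^+ 2 + cq (G x) ^+ 2) - 1) ^+ 2 + ca (G x) ^+ 2 + cb (G x) ^+ 2)))).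
  have [mm ma mb] := And3 measurable_modulus measurable_ca measurable_cb.
  apply: msqrt; apply: measurable_funM => //.
  apply: measurable_funD; last exact: measurable_funX.
  apply: measurable_funD; last exact: measurable_funX.
  by apply: measurable_funX; exact: measurable_funB.
by apply/funext => x; rewrite -dist_SO2_sqr sqrtr_sqr ger0_norm// dist_SO2_ge0.
Qed.

Lemma sqi_frobP Q : SO2 Q -> sqi mu (fun x => frob (G x - Q)) <->
  [/\ sqi mu (fun x => cp (G x) - Q 0 0), sqi mu (fun x => cq (G x) - Q 1 0),
      sqi mu (fun x => ca (G x)) & sqi mu (fun x => cb (G x))].
Proof.
move=> SQ; have [mp mq ma mb] := And4 measurable_cp measurable_cq measurable_ca measurable_cb.
split => [sf|[sp sq sa sb]].
  have alg (a b c d : R) : [/\ a ^+ 2 <= 2 * (a ^+ 2 + b ^+ 2 + c ^+ 2 + d ^+ 2),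
      b ^+ 2 <= 2 * (a ^+ 2 + b ^+ 2 + c ^+ 2 + d ^+ 2),
      c ^+ 2 <= 2 * (a ^+ 2 + b ^+ 2 + c ^+ 2 + d ^+ 2) &
      d ^+ 2 <= 2 * (a ^+ 2 + b ^+ 2 + c ^+ 2 + d ^+ 2)].
    have := sqr_ge0 a; have := sqr_ge0 b; have := sqr_ge0 c; have := sqr_ge0 d.
    by split; lra.
  have le (f : R2 -> R) : measurable_fun setT (f : plane R -> R) ->
      (forall x, f x ^+ 2 <= frob (G x - Q) ^+ 2) -> sqi mu f.
    by move=> mf h; exact: sqi_le_sqr mf sf h.
  by split; apply: le => [|x]; rewrite ?(frob_sqr _ SQ);
    try exact: measurable_funB; try assumption;
    have [] := alg (cp (G x) - Q 0 0) (cq (G x) - Q 1 0) (ca (G x)) (cb (G x)).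
split; first exact: measurable_frob.
rewrite (_ : (fun x => _) = (fun x => 2 * ((cp (G x) - Q 0 0) ^+ 2 +
  (cq (G x) - Q 1 0) ^+ 2 + ca (G x) ^+ 2 + cb (G x) ^+ 2))).
  have [[_ i1] [_ i2] [_ i3] [_ i4]] := And4 sp sq sa sb.
  by apply: intgZ; do 3 (apply: intgD => //).
by apply/funext => x; exact: frob_sqr.
Qed.

Lemma ip_frob Q : SO2 Q -> sqi mu (fun x => frob (G x - Q)) ->
  ip mu (fun x => frob (G x - Q)) (fun x => frob (G x - Q)) =
  2 * (ip mu (fun x => cp (G x) - Q 0 0) (fun x => cp (G x) - Q 0 0) +
       ip mu (fun x => cq (G x) - Q 1 0) (fun x => cq (G x) - Q 1 0) +
       ip mu (fun x => ca (G x)) (fun x => ca (G x)) +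
       ip mu (fun x => cb (G x)) (fun x => cb (G x))).
Proof.
move=> SQ sf; have [[_ i1] [_ i2] [_ i3] [_ i4]] := (sqi_frobP SQ).1 sf.
have i12 := intgD i1 i2; have i123 := intgD i12 i3; have i := intgD i123 i4.
rewrite [LHS](_ : _ = \int[mu]_x (2 * ((cp (G x) - Q 0 0) ^+ 2 +
  (cq (G x) - Q 1 0) ^+ 2 + ca (G x) ^+ 2 + cb (G x) ^+ 2))); last first.
  by apply: eq_Rintegral => x _; rewrite -(frob_sqr _ SQ) expr2.
by rewrite (RintZ _ i) (RintD i123 i4) (RintD i12 i3) (RintD i1 i2).
Qed.

(** A rotation is purely conformal: subtracting [Q] moves [(cp, cq)] by its first column and leaves
    [(ca, cb)] alone. *)
Lemma frob_isometry u Q : weak_gradient u G -> SO2 Q ->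
  sqi mu (fun x => frob (G x - Q)) ->
  ip mu (fun x => cp (G x) - Q 0 0) (fun x => cp (G x) - Q 0 0) +
  ip mu (fun x => cq (G x) - Q 1 0) (fun x => cq (G x) - Q 1 0) =
  ip mu (fun x => ca (G x)) (fun x => ca (G x)) +
  ip mu (fun x => cb (G x)) (fun x => cb (G x)).
Proof.
move=> wg SQ sf; have [sp sq sa sb] := (sqi_frobP SQ).1 sf.
have [h1 h2 _] := (SO2P Q).1 SQ.
have e00 : (fun x => cp (G x) - Q 0 0 + ca (G x)) = (fun x => G x 0 0 - Q 0 0).
  by apply/funext => x; rewrite /cp /ca; field.
have e01 : (fun x => cb (G x) - (cq (G x) - Q 1 0)) = (fun x => G x 0 1 - Q 0 1).
  by apply/funext => x; rewrite h2 /cb /cq; field.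
have e10 : (fun x => cb (G x) + (cq (G x) - Q 1 0)) = (fun x => G x 1 0 - Q 1 0).
  by apply/funext => x; rewrite /cb /cq; field.
have e11 : (fun x => cp (G x) - Q 0 0 - ca (G x)) = (fun x => G x 1 1 - Q 1 1).
  by apply/funext => x; rewrite h1 /cp /ca; field.
have s00 := sqiD sp sa; have s01 := sqiB sb sq; have s10 := sqiD sb sq; have s11 := sqiB sp sa.
have k0 := @weak_gradient_curl_free u G 0 (Q 0 0) (Q 0 1) wg.
have k1 := @weak_gradient_curl_free u G 1 (Q 1 0) (Q 1 1) wg.
rewrite -e00 -e01 in k0; rewrite -e10 -e11 in k1.
exact: gradient_isometry sp sq sa sb (k0 s00 s01) (k1 s10 s11).
Qed.

End Field.
End GradientNorm.

(** * The two directions of the equivalence *)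

Section MainDirections.
Context {R : realType}.
Local Notation R2 := (R * R)%type.
Local Notation mu := (@leb2 R).

Lemma measurable_angle d (T : measurableType d) (c s : T -> R) :
  measurable_fun setT c -> measurable_fun setT s ->
  measurable_fun setT (fun x => angle (c x) (s x)).
Proof.
move=> mc ms; rewrite /angle.
apply: measurable_fun_ifT => //.
  apply: measurable_fun_eqr => //; apply: measurable_funD; exact: measurable_funX.
apply: measurable_fun_ifT => //; first exact: measurable_fun_eqr.
apply: measurable_funM => //; apply: (@measurableT_comp _ _ _ _ _ _ (@atan R)) => //.
  by apply: continuous_measurable_fun; exact: continuous_atan.
apply: measurable_funM => //.
apply: (@measurableT_comp _ _ _ _ _ _ (fun t : R => t `^ (-1))); first exact: measurable_powR.
exact: measurable_funD.
Qed.

(** In complex notation the hypotheses say that [cp F + i cq F] is [R0 0 0 + i R0 1 0] times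
    [exp (i t)]. *)
Lemma rotated_form (R0 F : 'M[R]_2) t : SO2 R0 ->
  cp F = R0 0 0 * cos t - R0 1 0 * sin t -> cq F = R0 1 0 * cos t + R0 0 0 * sin t ->
  F = R0 *m Defs.rot t + mx22 (ca F) (cb F) (cb F) (- ca F).
Proof.
move=> /SO2P[h1 h2 _] hp hq; apply/matrixP => i j.
have o1 : lift ord0 ord0 = 1 :> 'I_2 by exact/val_inj.
rewrite !mxE !big_ord_recl big_ord0 !mxE o1 addr0 /=.
have e00 : F 0 0 = cp F + ca F by rewrite /cp /ca; field.
have e01 : F 0 1 = cb F - cq F by rewrite /cb /cq; field.
have e10 : F 1 0 = cb F + cq F by rewrite /cb /cq; field.
have e11 : F 1 1 = cp F - ca F by rewrite /cp /ca; field.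
by case: (ord2P i) => ->; case: (ord2P j) => ->;
  rewrite /= ?e00 ?e01 ?e10 ?e11 ?hp ?hq ?h1 ?h2; ring.
Qed.

Lemma rotated_components (R0 F : 'M[R]_2) t a b : SO2 R0 ->
  F = R0 *m Defs.rot t + mx22 a b b (- a) ->
  [/\ cp F = R0 0 0 * cos t - R0 1 0 * sin t, cq F = R0 1 0 * cos t + R0 0 0 * sin t,
      ca F = a & cb F = b].
Proof.
move=> /SO2P[h1 h2 _] ->; have o1 : lift ord0 ord0 = 1 :> 'I_2 by exact/val_inj.
rewrite /cp /cq /ca /cb !mxE !big_ord_recl !big_ord0 !mxE o1 /= !addr0 h1 h2.
by split; field.
Qed.

(** [R0] is a unit complex number, so the left side is the squared modulus of [exp (i t) - 1], that
    is [2 - 2 * cos t]. *)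
Lemma rotation_deviation (R0 : 'M[R]_2) t : SO2 R0 ->
  (R0 0 0 * cos t - R0 1 0 * sin t - R0 0 0) ^+ 2 +
  (R0 1 0 * cos t + R0 0 0 * sin t - R0 1 0) ^+ 2 <= t ^+ 2.
Proof.
move=> /SO2P[_ _ cs]; apply: le_trans (one_sub_cos_le t).
have := cos2Dsin2 t; move: cs; move: (R0 0 0) (R0 1 0) (cos t) (sin t) => c0 s0 c s h h'.
rewrite (_ : _ + _ = (c0 ^+ 2 + s0 ^+ 2) * (c ^+ 2 + s ^+ 2 + 1 - 2 * c)); last by ring.
by rewrite h h'; lra.
Qed.

Lemma sqi_rotation (R0 : 'M[R]_2) (alpha : R2 -> R) : SO2 R0 -> sqi mu alpha ->
  sqi mu (fun x => R0 0 0 * cos (alpha x) - R0 1 0 * sin (alpha x) - R0 0 0) /\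
  sqi mu (fun x => R0 1 0 * cos (alpha x) + R0 0 0 * sin (alpha x) - R0 1 0).
Proof.
move=> SR0 sal; have mal := sqi_meas sal.
have mcos : measurable_fun setT (fun x : plane R => cos (alpha x)).
  apply: (@measurableT_comp _ _ _ _ _ _ (@cos R)) => //.
  by apply: continuous_measurable_fun; exact: continuous_cos.
have msin : measurable_fun setT (fun x : plane R => sin (alpha x)).
  apply: (@measurableT_comp _ _ _ _ _ _ (@sin R)) => //.
  by apply: continuous_measurable_fun; exact: continuous_sin.
split; apply: (sqi_le_sqr _ sal).
- by apply: measurable_funB => //; apply: measurable_funB; exact: measurable_funM.
- by move=> x; apply: le_trans (rotation_deviation (alpha x) SR0); rewrite lerDl sqr_ge0.
- by apply: measurable_funB => //; apply: measurable_funD; exact: measurable_funM.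
- by move=> x; apply: le_trans (rotation_deviation (alpha x) SR0); rewrite lerDr sqr_ge0.
Qed.

Section Field.
Variables (R0 : 'M[R]_2) (u : R2 -> 'cV[R]_2) (G : R2 -> 'M[R]_2).
Hypotheses (SR0 : SO2 R0) (wG : W12loc_grad u G).
Let mG i j : measurable_fun setT (fun x : plane R => G x i j).
Proof. by case: wG => _ /(_ i j)[]. Qed.
Let wg : weak_gradient u G. Proof. by case: wG. Qed.
Let modulus x := Num.sqrt (cp (G x) ^+ 2 + cq (G x) ^+ 2).
Let mass := ip mu (fun x => ca (G x)) (fun x => ca (G x)) +
  ip mu (fun x => cb (G x)) (fun x => cb (G x)).

(** The 4 is the 2 of [frob_sqr] times the 2 of the isometry. *)
Lemma L2norm_frob Q : SO2 Q -> sqi mu (fun x => frob (G x - Q)) ->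
  L2norm_mx (fun x => G x - Q) = (Num.sqrt (4 * mass))%:E.
Proof.
move=> SQ sf; have := sqi_Lnorm2 sf; rewrite (ip_frob mG SQ sf).
have alg (a b c d : R) : a + b = c + d -> 2 * (a + b + c + d) = 4 * (c + d) by lra.
by rewrite (alg _ _ _ _ (frob_isometry mG wg SQ sf)).
Qed.

Lemma ip_dist : sqi mu (fun x => dist_SO2 (G x)) ->
  sqi mu (fun x => modulus x - 1) /\
  ip mu (fun x => dist_SO2 (G x)) (fun x => dist_SO2 (G x)) =
  2 * (ip mu (fun x => modulus x - 1) (fun x => modulus x - 1) + mass).
Proof.
move=> sd; have mm := measurable_modulus mG.
have [mca mcb] := (measurable_ca mG, measurable_cb mG).
have alg (a b c : R) : [/\ a ^+ 2 <= 2 * (a ^+ 2 + b ^+ 2 + c ^+ 2),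
    b ^+ 2 <= 2 * (a ^+ 2 + b ^+ 2 + c ^+ 2) & c ^+ 2 <= 2 * (a ^+ 2 + b ^+ 2 + c ^+ 2)].
  by have := sqr_ge0 a; have := sqr_ge0 b; have := sqr_ge0 c; split; lra.
have le (f : R2 -> R) : measurable_fun setT (f : plane R -> R) ->
    (forall x, f x ^+ 2 <= dist_SO2 (G x) ^+ 2) -> sqi mu f.
  by move=> mf h; exact: sqi_le_sqr mf sd h.
have s1 : sqi mu (fun x => modulus x - 1).
  apply: le => [|x]; first exact: measurable_funB.
  by rewrite dist_SO2_sqr; have [] := alg (modulus x - 1) (ca (G x)) (cb (G x)).
have s2 : sqi mu (fun x => ca (G x)).
  apply: le => [//|x].
  by rewrite dist_SO2_sqr; have [] := alg (modulus x - 1) (ca (G x)) (cb (G x)).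
have s3 : sqi mu (fun x => cb (G x)).
  apply: le => [//|x].
  by rewrite dist_SO2_sqr; have [] := alg (modulus x - 1) (ca (G x)) (cb (G x)).
split => //; have [[_ i1] [_ i2] [_ i3]] := And3 s1 s2 s3.
have i12 := intgD i1 i2; have i123 := intgD i12 i3.
rewrite [LHS](_ : _ = \int[mu]_x (2 * ((modulus x - 1) ^+ 2 + ca (G x) ^+ 2 + cb (G x) ^+ 2))).
  by rewrite (RintZ _ i123) (RintD i12 i3) (RintD i1 i2) /mass addrA.
by apply: eq_Rintegral => x _; rewrite -dist_SO2_sqr expr2.
Qed.

Lemma equality_form : L2 (fun x => dist_SO2 (G x)) -> min_equality R0 G ->
  exists alpha a b : R2 -> R, [/\ L2 alpha, L2 a, L2 b & grad_form R0 alpha a b G].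
Proof.
move=> /Lfun2P sd [_ eN].
have mf := measurable_frob mG SR0.
have eD : ('N[mu]_2%:E[(fun x => (dist_SO2 (G x))%:E)])%E = _ := sqi_Lnorm2 sd.
rewrite eD in eN.
(* The right side of the equality is a finite number, hence so is the norm on the left. *)
have sf : sqi mu (fun x => frob (G x - R0)).
  apply: Lnorm2_sqi => //.
  by have -> : ('N[mu]_2%:E[EFin \o (fun x => frob (G x - R0))])%E = _ := eN; rewrite -EFinM ltry.
have [sm ed] := ip_dist sd.
have m1 : {ae mu, forall x, modulus x - 1 = 0}.
  (* The equality reads [4 * M = 2 * (2 * (X + M))], which forces [X = 0]. *)
  apply: ip_eq0 => //; move: eN; rewrite (L2norm_frob SR0 sf) ed -EFinM => -[].
  have M0 : 0 <= mass by rewrite addr_ge0// ip_ge0.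
  have X0 := ip_ge0 mu (fun x => modulus x - 1).
  move: M0 X0; move: mass (ip _ _ _) => M X M0 X0.
  rewrite -sqrtrM// => /eqP; rewrite eqr_sqrt ?mulr_ge0 ?addr_ge0// => /eqP; lra.
have [sp sq sa sb] := (sqi_frobP mG SR0).1 sf.
have [mp mq] := (measurable_cp mG, measurable_cq mG).
have [_ _ cs] := (SO2P R0).1 SR0.
(* [c + i s] is the conjugate of [R0] times [cp + i cq]; its argument is the required angle. *)
pose c x := R0 0 0 * cp (G x) + R0 1 0 * cq (G x).
pose s x := R0 0 0 * cq (G x) - R0 1 0 * cp (G x).
exists (fun x => angle (c x) (s x)), (fun x => ca (G x)), (fun x => cb (G x)).
split; try exact/Lfun2P.
(* The 8 of [angle_sqr_le] over the 2 of [frob_sqr] leaves [2 ^ 2]; multiplication by a unit complex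
   number keeps distances. *)
- apply/Lfun2P; apply: (sqi_le_sqr _ (sqiZ 2 sf)).
    apply: measurable_angle.
      by apply: measurable_funD; apply: measurable_funM.
    by apply: measurable_funB; apply: measurable_funM.
  move=> x; apply: le_trans (angle_sqr_le _ _) _.
  rewrite exprMn (frob_sqr _ SR0) /c /s.
  have := sqr_ge0 (ca (G x)); have := sqr_ge0 (cb (G x)).
  move: (cp _) (cq _) (ca _) (cb _) => p q a b.
  move: cs; move: (R0 0 0) (R0 1 0) => c0 s0 cs b2 a2.
  have -> : (c0 * p + s0 * q - 1) ^+ 2 + (c0 * q - s0 * p) ^+ 2 = (p - c0) ^+ 2 + (q - s0) ^+ 2.
    rewrite [LHS](_ : _ = (p ^+ 2 + q ^+ 2) * (c0 ^+ 2 + s0 ^+ 2) - 2 * (c0 * p + s0 * q) + 1); last by ring.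
    rewrite [RHS](_ : _ = p ^+ 2 + q ^+ 2 - 2 * (c0 * p + s0 * q) + (c0 ^+ 2 + s0 ^+ 2)); last by ring.
    by rewrite cs mulr1.
  by lra.
apply: ae_imp m1 => x /subr0_eq hm.
have pq1 : cp (G x) ^+ 2 + cq (G x) ^+ 2 = 1.
  by rewrite -[LHS]sqr_sqrtr ?addr_ge0 ?sqr_ge0// -/(modulus x) hm expr1n.
have [ec es] : cos (angle (c x) (s x)) = c x /\ sin (angle (c x) (s x)) = s x.
  apply: angleP; rewrite /c /s -[RHS]mulr1 -{1}pq1 -cs; ring.
apply: rotated_form => //; rewrite ec es /c /s -[LHS]mul1r -cs; ring.
Qed.

Lemma form_equality (alpha a b : R2 -> R) : L2 alpha -> L2 a -> L2 b ->
  grad_form R0 alpha a b G ->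
  L2 (fun x => dist_SO2 (G x)) /\ min_equality R0 G.
Proof.
move=> /Lfun2P sal /Lfun2P sa /Lfun2P sb gf.
have [mp mq mca mcb] := And4 (measurable_cp mG) (measurable_cq mG) (measurable_ca mG) (measurable_cb mG).
have [sP sQ] := sqi_rotation SR0 sal; have [mP mQ] := (sqi_meas sP, sqi_meas sQ).
pose P x := R0 0 0 * cos (alpha x) - R0 1 0 * sin (alpha x) - R0 0 0.
pose Q x := R0 1 0 * cos (alpha x) + R0 0 0 * sin (alpha x) - R0 1 0.
have aP : {ae mu, forall x, P x = cp (G x) - R0 0 0}.
  by apply: ae_imp gf => x /(rotated_components SR0)[-> _ _ _].
have aQ : {ae mu, forall x, Q x = cq (G x) - R0 1 0}.
  by apply: ae_imp gf => x /(rotated_components SR0)[_ -> _ _].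
have aa : {ae mu, forall x, a x = ca (G x)}.
  by apply: ae_imp gf => x /(rotated_components SR0)[_ _ -> _].
have ab : {ae mu, forall x, b x = cb (G x)}.
  by apply: ae_imp gf => x /(rotated_components SR0)[_ _ _ ->].
have sf : sqi mu (fun x => frob (G x - R0)).
  apply/(sqi_frobP mG SR0); split.
  - by apply: sqi_ae_eq aP sP => //; exact: measurable_funB.
  - by apply: sqi_ae_eq aQ sQ => //; exact: measurable_funB.
  - exact: (sqi_ae_eq (sqi_meas sa) mca aa sa).
  - exact: (sqi_ae_eq (sqi_meas sb) mcb ab sb).
have sd : sqi mu (fun x => dist_SO2 (G x)).
  apply: sqi_le_sqr (measurable_dist mG) sf _ => x.
  rewrite lerXn2r ?nnegrE ?dist_SO2_ge0 ?frob_ge0//.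
  by have [V SV [-> Vmin]] := dist_SO2_min (G x); exact: Vmin.
have [sm ed] := ip_dist sd.
have m1 : {ae mu, forall x, modulus x - 1 = 0}.
  apply: ae_imp gf => x /(rotated_components SR0)[hp hq _ _].
  have [_ _ cs] := (SO2P R0).1 SR0.
  suff -> : modulus x = 1 by rewrite subrr.
  rewrite /modulus hp hq -[RHS]sqrtr1; congr Num.sqrt; have := cos2Dsin2 (alpha x); move: cs.
  move: (R0 0 0) (R0 1 0) (cos _) (sin _) => c0 s0 c s h h'.
  by rewrite -[RHS]mulr1 -{1}h -h'; ring.
have X0 : ip mu (fun x => modulus x - 1) (fun x => modulus x - 1) = 0.
  have msm := sqi_meas sm.
  transitivity (\int[mu]_x (0 : R)); last by rewrite /Rintegral integral0.
  apply: Rint_ae_eq => //; first exact: measurable_funM.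
  by apply: ae_imp m1 => x ->; rewrite mulr0.
rewrite X0 add0r in ed.
split; first exact/Lfun2P.
split.
  split; first by exists R0.
  (* The isometry gives the same norm for every rotation at finite distance. *)
  move=> _ [V SV <-]; rewrite (L2norm_frob SR0 sf).
  have [Vfin|] := boolP (L2norm_mx (fun x => (G x - V)%R) < +oo)%E.
    have sV : sqi mu (fun x => frob (G x - V)).
      by apply: Lnorm2_sqi; [exact: measurable_frob|exact: Vfin].
    by rewrite (L2norm_frob SV sV).
  by rewrite ltey negbK => /eqP ->; exact: leey.
rewrite (L2norm_frob SR0 sf).
have -> : ('N[mu]_2%:E[(fun x => (dist_SO2 (G x))%:E)])%E = _ := sqi_Lnorm2 sd.
rewrite ed -EFinM -sqrtrM//; congr (Num.sqrt _)%:E.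
by rewrite mulrA; congr (_ * _); ring.
Qed.

End Field.
End MainDirections.

(** * Construction of a field with a prescribed angle *)

Section Existence.
Context {R : realType}.
Local Notation R2 := (R * R)%type.
Local Notation mu := (@leb2 R).

Lemma affine_C1 (c : 'I_2 -> R) : C1 (fun x : R2 => c 0 * x.1 + c 1 * x.2) /\
  forall j, partial j (fun x : R2 => c 0 * x.1 + c 1 * x.2) = (fun=> c j).
Proof.
have d (a b t : R) : is_derive t 1 (fun s : R => a * s + b) a.
  rewrite (_ : (fun s => _) = (fun s => s * a + b)); first exact: is_derive_affine.
  by apply/funext => s; rewrite mulrC.
have p j : partial j (fun x : R2 => c 0 * x.1 + c 1 * x.2) = (fun=> c j).
  apply/funext => -[x y]; case: (ord2P j) => ->.
    by rewrite partial_slice0 derive1E; have [_ ->] := d (c 0) (c 1 * y) x.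
  rewrite partial_slice1 derive1E (_ : (fun t => _) = (fun t => c 1 * t + c 0 * x)).
    by have [_ ->] := d (c 1) (c 0 * x) y.
  by apply/funext => t; rewrite addrC.
split=> //; split.
  move=> x; apply: cvgD; apply: cvgM; try exact: cvg_cst.
    exact: cvg_fst.
  exact: cvg_snd.
move=> j; split; last by rewrite p => x; exact: cvg_cst.
move=> -[x y]; case: (ord2P j) => ->.
  by apply/derivable_slice0; have [] := d (c 0) (c 1 * y) x.
apply/derivable_slice1; rewrite (_ : (fun t => _) = (fun t => c 1 * t + c 0 * x)).
  by have [] := d (c 1) (c 0 * x) y.
by apply/funext => t; rewrite addrC.
Qed.

Lemma weak_derivative_affineD (c : 'I_2 -> R) (v : R2 -> R) (h : 'I_2 -> R2 -> R) j phi :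
  (forall j, sqi mu (h j)) -> test_function phi ->
  intg mu (fun x => v x * partial j phi x) ->
  \int[mu]_x (v x * partial j phi x) = - (\int[mu]_x (h j x * phi x)) ->
  (\int[mu]_x ((c 0 * x.1 + c 1 * x.2 + v x) * partial j phi x)%:E =
   - \int[mu]_x ((c j + h j x) * phi x)%:E)%E.
Proof.
move=> sh tphi iv ev; have [cA pA] := affine_C1 c.
have sphi := test_smooth tphi; have cphi := smooth_continuous sphi.
have bphi := test_bsupp tphi.
have eA := ibp j cA (smooth_C1 sphi) bphi.
have i1 : intg mu (fun x => (c 0 * x.1 + c 1 * x.2) * partial j phi x).
  have bj := bsupp_partial j bphi; apply: bsupp_intg.
  2: by case: bj => N hN; exists N => x /hN ->; rewrite mulr0.
  by move=> x; apply: cvgM; [exact: (proj1 cA)|exact: (smooth_continuous (smooth_partial j sphi))].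
have i2 : intg mu (fun x => c j * phi x) by apply: intgZ; exact: intg_test.
have i3 : intg mu (fun x => h j x * phi x) by apply: sqi_mul => //; exact: bsupp_sqi.
rewrite pA in eA.
rewrite (_ : (fun x => ((c 0 * _ + _ + _) * _)%:E) =
  fun x => ((c 0 * x.1 + c 1 * x.2) * partial j phi x + v x * partial j phi x)%:E); last first.
  by apply/funext => x; rewrite mulrDl.
rewrite (_ : (fun x => ((c j + _) * _)%:E) = fun x => (c j * phi x + h j x * phi x)%:E); last first.
  by apply/funext => x; rewrite mulrDl.
rewrite (RintE (intgD i1 iv)) (RintE (intgD i2 i3)) (RintD i1 iv) (RintD i2 i3).
by rewrite eA ev -EFinN opprD.
Qed.

Lemma potential_rows (f g : nat -> R2 -> R) (h : 'I_2 -> 'I_2 -> R2 -> R) :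
  (forall k, nice (f k)) -> (forall k, nice (g k)) -> (forall i j, sqi mu (h i j)) ->
  (forall j, L2cvg mu (fun k => partial j (f k)) (h 0 j)) ->
  (forall j, L2cvg mu (fun k => partial j (g k)) (h 1 j)) ->
  forall R0 : 'M[R]_2, exists u : R2 -> 'cV[R]_2,
    W12loc_grad u (fun x => \matrix_(i, j) (R0 i j + h i j x)).
Proof.
move=> nf ng sh cf cg R0.
have [v0 l0 w0] := potential nf (sh 0) cf; have [v1 l1 w1] := potential ng (sh 1) cg.
pose v (i : 'I_2) := if i == 0 then v0 else v1.
have lv i : L2loc (v i) by case: (ord2P i) => ->.
have wv i j phi : test_function phi -> intg mu (fun x => v i x * partial j phi x) /\
    \int[mu]_x (v i x * partial j phi x) = - \int[mu]_x (h i j x * phi x).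
  by case: (ord2P i) => -> tphi; [exact: w0|exact: w1].
exists (fun x => \col_i (R0 i 0 * x.1 + R0 i 1 * x.2 + v i x)); split.
- move=> i; rewrite (_ : (fun x => _) = (fun x => R0 i 0 * x.1 + R0 i 1 * x.2 + v i x)).
    by apply: L2locD => //; apply: continuous_L2loc; have [[]] := affine_C1 (R0 i).
  by apply/funext => x; rewrite mxE.
- move=> i j; rewrite (_ : (fun x => _) = (fun x => R0 i j + h i j x)).
    apply: L2locD; last exact: sqi_L2loc.
    by apply: continuous_L2loc => x; exact: cvg_cst.
  by apply/funext => x; rewrite mxE.
move=> i j phi tphi; have [iv ev] := wv i j phi tphi.
rewrite (_ : (fun x => _) = fun x => ((R0 i 0 * x.1 + R0 i 1 * x.2 + v i x) * partial j phi x)%:E).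
  rewrite (weak_derivative_affineD (R0 i) (sh i) tphi iv ev); congr (- _)%E.
  by apply: eq_integral => x _; rewrite mxE.
by apply/funext => x; rewrite mxE.
Qed.

(** The conformal part of [R0 R(alpha) - R0] is square integrable because [alpha] is;
    [beurling_gradient] completes it to two rows with potentials, and the linear map [R0] restores
    the constant. *)
Lemma field_of_angle (R0 : 'M[R]_2) (alpha : R2 -> R) : SO2 R0 -> L2 alpha ->
  exists (a b : R2 -> R) (u : R2 -> 'cV[R]_2) (G : R2 -> 'M[R]_2),
    [/\ L2 a, L2 b, W12loc_grad u G & grad_form R0 alpha a b G].
Proof.
move=> SR0 /Lfun2P sal; have [sP sQ] := sqi_rotation SR0 sal.
have [f [g [a [b [[nf ng] [sa sb] _ [c00 c01] [c10 c11]]]]]] := beurling_gradient sP sQ.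
set P := (fun x => _ - _ - _) in sP c00 c11; set Q := (fun x => _ + _ - _) in sQ c01 c10.
pose h (i j : 'I_2) : R2 -> R := if i == 0
  then (if j == 0 then fun x => P x + a x else fun x => b x - Q x)
  else (if j == 0 then fun x => b x + Q x else fun x => P x - a x).
have sh i j : sqi mu (h i j).
  case: (ord2P i) => ->; case: (ord2P j) => ->.
  - exact: sqiD sP sa.
  - exact: sqiB sb sQ.
  - exact: sqiD sb sQ.
  - exact: sqiB sP sa.
have cf j : L2cvg mu (fun k => partial j (f k)) (h 0 j) by case: (ord2P j) => ->.
have cg j : L2cvg mu (fun k => partial j (g k)) (h 1 j) by case: (ord2P j) => ->.
have [u wu] := potential_rows nf ng sh cf cg R0.
exists a, b, u, (fun x => \matrix_(i, j) (R0 i j + h i j x)); split => //; try exact/Lfun2P.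
apply: aeW => x; apply/matrixP => i j.
have o1 : lift ord0 ord0 = 1 :> 'I_2 by exact/val_inj.
have [h1 h2 _] := (SO2P R0).1 SR0.
rewrite !mxE !big_ord_recl big_ord0 !mxE o1 addr0.
by case: (ord2P i) => ->; case: (ord2P j) => ->; rewrite /h /P /Q /= ?h1 ?h2; ring.
Qed.

End Existence.

Theorem theorem1p7 (R : realType) (R0 : 'M[R]_2) (hR0 : SO2 R0) :
  (forall (u : R * R -> 'cV[R]_2) (gradu : R * R -> 'M[R]_2),
     W12loc_grad u gradu ->
     ((L2 (fun x => dist_SO2 (gradu x)) /\ min_equality R0 gradu) <->
      exists alpha a b : R * R -> R,
        [/\ L2 alpha, L2 a, L2 b & grad_form R0 alpha a b gradu])) /\
  (forall alpha : R * R -> R, L2 alpha ->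
     exists (a b : R * R -> R) (u : R * R -> 'cV[R]_2)
            (gradu : R * R -> 'M[R]_2),
       [/\ L2 a, L2 b, W12loc_grad u gradu,
           min_equality R0 gradu & grad_form R0 alpha a b gradu]).
Proof.
split=> [u G wG|alpha sal].
  split=> [[sd eN]|[alpha [a [b [sal sa sb gf]]]]].
    exact: equality_form hR0 wG sd eN.
  exact (form_equality hR0 wG sal sa sb gf).
have [a [b [u [G [sa sb wG gf]]]]] := field_of_angle hR0 sal.
exists a, b, u, G; split => //.
by have [] := form_equality hR0 wG sal sa sb gf.
Qed.
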